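(* Let $\{U_k \colon k \in \mathbb{N}\}$ be a sequence of independent, identically distributed, non-negative random variables such that $\mathbb{P}\{U_1 = 0\} < 1$ and $\mathbb{E}[U_1^p] < \infty$ for some $p > 2$. Set $S_0 = 0$, $S_n = \sum_{k=1}^n U_k$ for $n \in \mathbb{N}$, and let $L = \{L(t) \colon t \geq 0\}$ be the renewal process $L(t) = \sum_{n=1}^\infty \mathbb{I}_{[0,t]}(S_n)$, where $\mathbb{I}_A$ denotes the indicator function of the set $A$. For $n \in \mathbb{N}$ define the process $X_n = \{X_n(t) \colon t \in [0,1]\}$ by \[ X_n(t) = C\sqrt{n} \int_0^t (-1)^{L(n u)}\, du, \] where $C > 0$ satisfies $C^2 = \mathbb{E}[U_1]/\mathrm{Var}(U_1)$. Then, as $n \to \infty$, the processes $X_n$ converge weakly (in distribution) in the space $\mathcal{C}([0,1])$ of continuous functions on $[0,1]$, endowed with the uniform topology, to a standard Brownian motion. *)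

(* Defs.v *)
From HB Require Import structures.
From mathcomp Require Import all_boot all_order all_algebra.
From mathcomp Require Import all_classical all_reals all_analysis.
Set Implicit Arguments. Unset Strict Implicit. Unset Printing Implicit Defensive.
Import Order.TTheory GRing.Theory Num.Theory.
Import numFieldNormedType.Exports.
Local Open Scope classical_set_scope.
Local Open Scope ring_scope.

Section defs.
Context {d : measure_display} {T : measurableType d} {R : realType}.

Definition indep_fin (P : probability T R) (n : nat) (X : nat -> T -> R) :=
  forall B : nat -> set R, (forall i, measurable (B i)) ->
    P (\big[setI/setT]_(i < n) (X i @^-1` B i)) =
    (\prod_(i < n) P (X i @^-1` B i))%E.

(** Mutual independence of a sequence: every finite initial family
    (hence every finite subfamily, taking B i = setT) is independent. *)
Definition indep_seq (P : probability T R) (X : nat -> T -> R) :=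
  forall n, indep_fin P n X.

Definition ident_distr (P : probability T R) (X : nat -> T -> R) :=
  forall k (B : set R), measurable B -> P (X k @^-1` B) = P (X 0%N @^-1` B).

(** Partial sums S_n = U_1 + ... + U_n ; here U_k is written U (k-1). *)
Definition partial_sum (U : nat -> T -> R) (n : nat) (w : T) : R :=
  \sum_(k < n) U k w.

Definition renewal (U : nat -> T -> R) (w : T) (t : R) : \bar R :=
  (\sum_(1 <= n <oo) (\1_(`[0, t]) (partial_sum U n w))%:E)%E.

(** (-1)^x for x a (finite) natural number in \bar R; value 1 on +oo/-oo
    (this only happens on a null event). *)
Definition sgn_pow (x : \bar R) : R :=
  if x is r%:E then (-1) ^+ (Num.truncn r) else 1.

Definition Xproc (C : R) (U : nat -> T -> R) (n : nat) (w : T) (t : R) : R :=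
  C * Num.sqrt (n%:R) *
  \int[lebesgue_measure]_(u in `[0, t]) sgn_pow (renewal U w (n%:R * u)).

Definition standard_BM (P : probability T R) (W : R -> T -> R) :=
  [/\ (forall t, measurable_fun setT (W t)),
      (forall w, W 0 w = 0),
      (forall w, {within `[0, 1], continuous (fun t => W t w)}),
      (forall s t, 0 <= s -> s < t -> t <= 1 -> forall B : set R, measurable B ->
         P ((fun w => W t w - W s w) @^-1` B) = normal_prob 0 (Num.sqrt (t - s)) B)
    & (forall n (tt : nat -> R), 0 <= tt 0%N -> (forall i, tt i <= tt i.+1) ->
         tt n <= 1 ->
         indep_fin P n (fun i w => W (tt i.+1) w - W (tt i) w))].

End defs.

Section Cfun.
Context {R : realType}.

(** Elements of C([0,1]) represented by functions R -> R continuous on [0,1]. *)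
Definition cont01 (f : R -> R) := {within `[0, 1], continuous f}.

Definition bounded_cont_functional (F : (R -> R) -> R) :=
  (exists M : R, forall f, cont01 f -> `|F f| <= M) /\
  (forall f, cont01 f -> forall e : R, 0 < e ->
     exists2 del : R, 0 < del & forall g, cont01 g ->
       (forall t, 0 <= t <= 1 -> `|f t - g t| < del) -> `|F f - F g| < e).
End Cfun.

(* Main.v *)
(* Direct proof, without tightness.  By Lipschitz regularization (from below, for
   F and for -F) it is enough to bound E[F(X_n)] from below by E[Phi(W)] - e when
   Phi <= F is bounded and Lipschitz for the uniform distance.  Cut the sequence U
   into m blocks of N ~ n/(m mu) consecutive terms, mu = E[U_1].  The value of X_n
   at the n-scaled renewal time S_k is (C/sqrt n) sum_(j<k) (-1)^j U_j, in which U_j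
   may be replaced by U_j - mu at the cost of O(1/sqrt n).  Outside an event of small
   probability, controlled by Chebyshev's inequality and Ottaviani's maximal
   inequality, X_n is uniformly close to the polyline with m steps whose increments
   are the m independent block sums.  A Lindeberg replacement, block by block, turns
   each block sum into a centered Gaussian variable of variance 1/m, i.e. the polyline
   into the interpolation of the Brownian motion W at the times l/m.  The map
   w |-> F(X_n w) need not be measurable: the integral of an arbitrary real function
   is still monotone, and this is all that is used. *)

Require Import Defs.
From HB Require Import structures.
From mathcomp Require Import all_boot all_order all_algebra.
From mathcomp Require Import all_classical all_reals all_analysis.
From mathcomp Require Import measurable_realfun.
From mathcomp Require Import ring lra zify.
Set Implicit Arguments. Unset Strict Implicit. Unset Printing Implicit Defensive.
Import Order.TTheory GRing.Theory Num.Theory.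
Import numFieldNormedType.Exports.
Local Open Scope classical_set_scope.
Local Open Scope ring_scope.

(** * Independence and product laws *)

(** Counting the blocks is the obstacle. About [m] of them must be kept quiet, each of variance
    about [1 / m]: Chebyshev's inequality at the end of a block gives a probability of order
    [1 / m], and the sum over the blocks does not become small. The central limit theorem of a block
    is therefore used before the union bound: it transfers the Gaussian tail, and the Gaussian
    fourth moment [3 / m^2] makes the sum of order [1 / m]. The order of choices is the Lipschitz
    constant, [eps], [m], and [n] last.

    The block theorem has to be uniform over all functions with a given Lipschitz constant, because
    it is applied to sections of a functional of all blocks. Its Gaussian partner is [W] itself: [N]
    increments of mesh [1 / (m N)] are independent and Gaussian, and telescope to an increment of
    mesh [1 / m], so the stability of Gaussian laws under addition is read off [W].

    The variables [U] and [W] live on unrelated spaces. Replacement thus integrates out the last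
    coordinate on each side instead of mixing both families in one sequence. *)

Section independence.
Context {d} {T : measurableType d} {R : realType}.
Implicit Types (P : probability T R) (X : nat -> T -> R).

(** Both sides are finite measures in [A], a restriction of [P] and a multiple of [P]. They agree on
    a pi-system that contains [setT], hence on the sigma-algebra it generates. *)
Lemma pi_system_indep P (G : set (set T)) (H : set T) :
  G `<=` measurable -> G setT -> setI_closed G -> measurable H ->
  (forall A, G A -> (P (A `&` H) = P A * P H)%E) ->
  forall A, <<s G >> A -> (P (A `&` H) = P A * P H)%E.
Proof.
move=> Gm GT GI mH GH A sA.
have PHfin : P H \is a fin_num by exact: fin_num_measure.
have PH0 : 0 <= fine (P H) by rewrite fine_ge0.
pose m1 : {measure set T -> \bar R} := mrestr P mH.
pose m2 : {measure set T -> \bar R} := mscale (NngNum PH0) P.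
have := @g_sigma_algebra_measure_unique _ _ _ G Gm (fun=> setT) (fun=> GT) _ m1 m2 GI.
have -> : (P (A `&` H) = m1 A)%E by [].
have -> : (P A * P H = m2 A)%E by rewrite /m2/= /mscale/= fineK// muleC.
apply => //.
- by rewrite bigcup_const//; exists 0%N.
- by move=> B GB; rewrite /m1/= /mrestr GH// /m2/= /mscale/= fineK// muleC.
- by move=> k; rewrite /m1/= /mrestr/= setTI ltey_eq fin_num_measure.
Qed.

(** A pi-system generating the sigma-algebra of the coordinates from [lo] to [hi - 1]. Below, [T]
    equipped with this smaller sigma-algebra plays the role of the random vector of these
    coordinates. *)
Definition cylinder X (lo hi : nat) : set (set T) :=
  [set E | exists2 B : nat -> set R, (forall i, measurable (B i)) &
     E = \big[setI/setT]_(lo <= i < hi) (X i @^-1` B i)].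

Lemma cylinder_measurable X lo hi : (forall i, measurable_fun setT (X i)) ->
  cylinder X lo hi `<=` measurable.
Proof.
move=> mX _ [B mB ->]; apply: big_ind => //; first exact: measurableI.
by move=> i _; rewrite -[_ @^-1` _]setTI; exact: mX.
Qed.

Lemma cylinderT X lo hi : cylinder X lo hi setT.
Proof. by exists (fun=> setT) => //; rewrite big1// => i _; rewrite preimage_setT. Qed.

Lemma cylinderI X lo hi : setI_closed (cylinder X lo hi).
Proof.
move=> _ _ [B mB ->] [C mC ->]; exists (fun i => B i `&` C i).
  by move=> i; exact: measurableI.
by rewrite -big_split.
Qed.

Lemma sub_cylinder_sigma X lo hi : (forall i, measurable_fun setT (X i)) ->
  <<s cylinder X lo hi >> `<=` measurable.
Proof.
move=> mX; apply: smallest_sub; first exact: sigma_algebra_measurable.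
exact: cylinder_measurable.
Qed.

Lemma indep_cylinder_prod P X n lo hi (B : nat -> set R) : indep_fin P n X ->
  (hi <= n)%N -> (forall i, measurable (B i)) ->
  (P (\big[setI/setT]_(lo <= i < hi) (X i @^-1` B i)) =
    \prod_(lo <= i < hi) P (X i @^-1` B i))%E.
Proof.
move=> iX hn mB.
(* Coordinates outside the range are padded with [setT], which contributes a factor 1. *)
pose C i := if (lo <= i < hi)%N then B i else setT.
have mC i : measurable (C i) by rewrite /C; case: ifP.
have := iX C mC.
rewrite -(big_mkord xpredT (fun i => X i @^-1` C i)).
rewrite -(big_mkord xpredT (fun i => P (X i @^-1` C i))).
have CE i : C i = if (lo <= i < hi)%N then B i else setT by [].
have [hl|lh] := leqP hi lo.
  by rewrite !(big_geq hl) probability_setT.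
rewrite !(@big_cat_nat _ _ _ lo 0 n) ?(leq_trans (ltnW lh))//=.
rewrite !(@big_cat_nat _ _ _ hi lo n) ?(ltnW lh)//=.
have H1 i : (i < lo)%N -> C i = setT.
  by move=> il; rewrite CE; case: ifP => // /andP[]; lia.
have H2 i : (hi <= i)%N -> C i = setT.
  by move=> il; rewrite CE; case: ifP => // /andP[]; lia.
have H3 i : (lo <= i < hi)%N -> C i = B i by rewrite CE => ->.
have E1 : \big[setI/setT]_(0 <= i < lo) X i @^-1` C i = setT.
  by rewrite big_nat big1// => i /andP[_ ?]; rewrite H1// preimage_setT.
have E2 : \big[setI/setT]_(hi <= i < n) X i @^-1` C i = setT.
  by rewrite big_nat big1// => i /andP[? _]; rewrite H2// preimage_setT.
have E3 : \big[setI/setT]_(lo <= i < hi) X i @^-1` C i =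
          \big[setI/setT]_(lo <= i < hi) X i @^-1` B i.
  by apply: eq_big_nat => i ?; rewrite H3.
have E4 : (\prod_(0 <= i < lo) P (X i @^-1` C i) = 1)%E.
  by rewrite big_nat big1// => i /andP[_ ?]; rewrite H1// preimage_setT probability_setT.
have E5 : (\prod_(hi <= i < n) P (X i @^-1` C i) = 1)%E.
  by rewrite big_nat big1// => i /andP[? _]; rewrite H2// preimage_setT probability_setT.
have E6 : (\prod_(lo <= i < hi) P (X i @^-1` C i) =
          \prod_(lo <= i < hi) P (X i @^-1` B i))%E.
  by apply: eq_big_nat => i ?; rewrite H3.
by rewrite E1 E2 E3 E4 E5 E6 setTI setIT mul1e mule1.
Qed.

(** The pi-system argument is applied twice: once to [A] with [B] fixed, then, for [A] a cylinder,
    to [B]. Two cylinders over adjacent ranges form a single cylinder. *)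
Lemma indep_cylinder P X n lo mid hi : indep_fin P n X ->
  (forall i, measurable_fun setT (X i)) -> (lo <= mid)%N -> (mid <= hi)%N -> (hi <= n)%N ->
  forall A B, <<s cylinder X lo mid >> A -> <<s cylinder X mid hi >> B ->
  (P (A `&` B) = P A * P B)%E.
Proof.
move=> iX mX lm mh hn A B sA sB.
apply: (@pi_system_indep P (cylinder X lo mid)) => //.
- exact: cylinder_measurable.
- exact: cylinderT.
- exact: cylinderI.
- exact: sub_cylinder_sigma sB.
move=> {sA} {}A cA; rewrite setIC muleC.
apply: (@pi_system_indep P (cylinder X mid hi)) => //.
- exact: cylinder_measurable.
- exact: cylinderT.
- exact: cylinderI.
- exact: cylinder_measurable cA.
move=> {sB} {}B [C mC ->]; case: cA => D mD ->; rewrite setIC muleC.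
pose E i := if (i < mid)%N then D i else C i.
have mE i : measurable (E i) by rewrite /E; case: ifP.
have := indep_cylinder_prod lo iX hn mE.
rewrite !(@big_cat_nat _ _ _ mid lo hi)//=.
rewrite (@indep_cylinder_prod _ _ n)// ?(leq_trans mh)// (@indep_cylinder_prod _ _ n)//.
have -> : \big[setI/setT]_(lo <= i < mid) X i @^-1` E i =
          \big[setI/setT]_(lo <= i < mid) X i @^-1` D i.
  by apply: eq_big_nat => i /andP[_ ?]; rewrite /E ifT.
have -> : \big[setI/setT]_(mid <= i < hi) X i @^-1` E i =
          \big[setI/setT]_(mid <= i < hi) X i @^-1` C i.
  by apply: eq_big_nat => i /andP[? _]; rewrite /E ifF//; lia.
move=> ->; congr (_ * _)%E.
  by apply: eq_big_nat => i /andP[_ ?]; rewrite /E ifT.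
by apply: eq_big_nat => i /andP[? _]; rewrite /E ifF//; lia.
Qed.

Lemma cylinder_coord X lo hi i : (lo <= i < hi)%N ->
  measurable_fun [set: g_sigma_algebraType (cylinder X lo hi)] (X i).
Proof.
move=> lih _ B mB; rewrite setTI; apply: sub_sigma_algebra.
exists (fun j => if j == i then B else setT).
  by move=> j; case: ifP.
rewrite (bigD1_seq i) /= ?iota_uniq ?mem_index_iota ?eqxx//.
by rewrite big1 ?setIT// => j /negbTE ->; rewrite preimage_setT.
Qed.

End independence.

Section product_law.
Context {d d1 d2} {T : measurableType d} {T1 : measurableType d1}
  {T2 : measurableType d2} {R : realType}.
Local Open Scope ereal_scope.

(** The law of the pair is the product of the law of [X1] with [nu], by uniqueness of product
    measures. In the applications [X1] is the identity map from [T] to [T] with the sigma-algebra of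
    the first coordinates. *)
Lemma indep_tonelli (P : probability T R) (nu : probability T2 R)
    (X1 : T -> T1) (X2 : T -> T2) :
  measurable_fun setT X1 -> measurable_fun setT X2 ->
  (forall A B, measurable A -> measurable B ->
     P (X1 @^-1` A `&` X2 @^-1` B) = P (X1 @^-1` A) * nu B) ->
  forall f : T1 * T2 -> \bar R, measurable_fun [set: T1 * T2] f -> (forall z, 0 <= f z) ->
  \int[P]_w f (X1 w, X2 w) = \int[P]_w \int[nu]_y f (X1 w, y).
Proof.
move=> m1 m2 ind f mf f0.
pose X1' : {mfun T >-> T1} := HB.pack X1 (isMeasurableFun.Build _ _ _ _ X1 m1).
have m12 : measurable_fun setT (fun w => (X1 w, X2 w)) by exact: measurable_fun_pair.
pose X12 : {mfun T >-> (T1 * T2)%type} :=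
  HB.pack (fun w => (X1 w, X2 w)) (isMeasurableFun.Build _ _ _ _ _ m12).
transitivity (\int[distribution P X12]_z f z).
  by rewrite ge0_integral_distribution.
transitivity (\int[(distribution P X1' \x nu)]_z f z).
  apply: eq_measure_integral => A mA _; apply/esym.
  apply: (@product_measure_unique _ _ _ _ _ (distribution P X1') nu (distribution P X12)) => //.
rewrite (@fubini_tonelli1 _ _ _ _ _ (distribution P X1') nu f mf f0).
rewrite ge0_integral_distribution//.
  exact: (@measurable_fun_fubini_tonelli_F _ _ _ _ _ nu).
by move=> x; exact: integral_ge0.
Qed.

End product_law.

(** * Integrals of bounded functions *)

Section integral_utils.
Import HBNNSimple.
Context {d} {T : measurableType d} {R : realType}.

(** The integral of a nonnegative function is a supremum over the simple functions below it, which
    is monotone without measurability; positive and negative parts are compared separately. *)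
Lemma le_integralT (mu : {measure set T -> \bar R}) (f g : T -> \bar R) :
  (forall x, (f x <= g x)%E) -> (\int[mu]_x f x <= \int[mu]_x g x)%E.
Proof.
have ge0 (u v : T -> \bar R) : (forall x, (0 <= u x)%E) ->
    (forall x, (u x <= v x)%E) -> (\int[mu]_x u x <= \int[mu]_x v x)%E.
  move=> u0 uv; rewrite !ge0_integralTE//; last by move=> x; exact: le_trans (uv x).
  apply: ge_ereal_sup => _ [h hu <-]; apply: ereal_sup_ubound.
  by exists h => // x; exact: le_trans (uv x).
move=> fg; rewrite [leLHS]integralE [leRHS]integralE; apply: leeB; apply: ge0 => // x.
  by rewrite !funeposE ge_max !le_max fg lexx orbT.
by rewrite !funenegE ge_max !le_max leeN2 fg lexx orbT.
Qed.

Variable P : probability T R.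

Lemma bounded_integrable (f : T -> R) (M : R) : measurable_fun setT f ->
  (forall x, `|f x| <= M) -> P.-integrable setT (EFin \o f).
Proof.
move=> mf fM; apply: measurable_bounded_integrable => //.
  by rewrite ltey_eq fin_num_measure.
exists M; split; first exact: num_real.
by move=> x Mx y _; apply: le_trans (ltW Mx).
Qed.

Lemma Rintegral_prob_cst (r : R) : \int[P]_x r = r.
Proof.
rewrite Rintegral_cst// [X in _ * X](_ : _ = 1) ?mulr1//.
exact: (congr1 fine (@probability_setT _ _ _ P)).
Qed.

Lemma le_abs_Rintegral (f g : T -> R) : P.-integrable setT (EFin \o f) ->
  P.-integrable setT (EFin \o g) ->
  (forall x, `|f x| <= g x) -> `|\int[P]_x f x| <= \int[P]_x g x.
Proof.
move=> fi gi fg; apply: le_trans (le_normr_Rintegral _ fi) _ => //.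
apply: le_Rintegral => //.
exact: (integrable_norm fi).
Qed.

Lemma abs_Rintegral_le (f : T -> R) (M : R) : measurable_fun setT f ->
  (forall x, `|f x| <= M) -> `|\int[P]_x f x| <= M.
Proof.
move=> mf fM; rewrite -[leRHS]Rintegral_prob_cst; apply: le_abs_Rintegral => //.
  exact: bounded_integrable fM.
exact: finite_measure_integrable_cst.
Qed.

End integral_utils.

Section indep_fubini.
Context {d d1 d2} {T : measurableType d} {T1 : measurableType d1}
  {T2 : measurableType d2} {R : realType}.

(** Tonelli's theorem for the nonnegative function [f + M]. *)
Lemma indep_fubini (P : probability T R) (nu : probability T2 R)
    (X1 : T -> T1) (X2 : T -> T2) (f : T1 * T2 -> R) (M : R) :
  measurable_fun setT X1 -> measurable_fun setT X2 ->
  (forall A B, measurable A -> measurable B ->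
     P (X1 @^-1` A `&` X2 @^-1` B) = P (X1 @^-1` A) * nu B)%E ->
  measurable_fun [set: T1 * T2] f -> (forall z, `|f z| <= M) ->
  \int[P]_w f (X1 w, X2 w) = \int[P]_w \int[nu]_y f (X1 w, y).
Proof.
move=> m1 m2 ind mf fM.
have m12 : measurable_fun setT (fun w => (X1 w, X2 w)) by exact: measurable_fun_pair.
have mfM : measurable_fun [set: T1 * T2] (fun z => f z + M).
  by apply: measurable_funD.
have fM0 z : 0 <= f z + M.
  by have := fM z; rewrite ler_norml => /andP[h _]; rewrite -lerBlDr sub0r.
have := @indep_tonelli _ _ _ T T1 T2 R P nu X1 X2 m1 m2 ind
  (fun z => (f z + M)%:E) (proj2 (measurable_EFinP _ _) mfM) fM0.
have mx x : measurable_fun setT (fun y => f (x, y)).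
  by apply: measurableT_comp => //; exact: pair1_measurable.
have in2 x : (\int[nu]_y (f (x, y) + M)%:E = (\int[nu]_y f (x, y) + M)%:E)%E.
  rewrite -[in RHS](Rintegral_prob_cst nu M) -RintegralD//.
  - rewrite /Rintegral fineK//; apply: integrable_fin_num => //.
    apply: (@bounded_integrable _ _ _ nu _ (M + M)).
      by apply: measurable_funD.
    move=> y; apply: le_trans (ler_normD _ _) _; apply: lerD; first exact: fM.
    by rewrite ger0_norm// (le_trans _ (fM (x, y))).
  - exact: bounded_integrable (fun y => fM (x, y)).
  - exact: finite_measure_integrable_cst.
under [in X in _ = X -> _]eq_integral do rewrite in2.
have mF : measurable_fun setT (fun w => \int[nu]_y f (X1 w, y)).
  have -> : (fun w => \int[nu]_y f (X1 w, y)) = 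
    (fun x => fine (\int[nu]_y (f (x, y) + M)%:E)%E - M) \o X1.
    by apply/funext => w /=; rewrite in2/= addrK.
  apply: measurableT_comp => //; apply: measurable_funB => //.
  apply: measurableT_comp => //.
  apply: (@measurable_fun_fubini_tonelli_F _ _ _ _ _ nu (fun z => (f z + M)%:E)) => //.
  exact/measurable_EFinP.
have FM w : `|\int[nu]_y f (X1 w, y)| <= M.
  exact: abs_Rintegral_le (fun y => fM (X1 w, y)).
move=> /(congr1 fine); rewrite -!/(Rintegral _ _ _) RintegralD//; last 2 first.
- by apply: (@bounded_integrable _ _ _ P _ M) => //; exact: measurableT_comp.
- exact: finite_measure_integrable_cst.
rewrite RintegralD//; last 2 first.
- exact: bounded_integrable FM.
- exact: finite_measure_integrable_cst.
by move/addIr.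
Qed.

End indep_fubini.

(** * Lipschitz functions of independent sequences *)

Section lipseq.
Context {R : realType}.

(** Functions of [n] variables are functions of lists constrained only at length [n], so that
    peeling off the last variable is an [rcons] and involves no type depending on [n]. *)
Definition lipseq (n : nat) (K : R) (G : seq R -> R) :=
  forall s s', size s = n -> size s' = n ->
    `|G s - G s'| <= K * \sum_(i < n) `|s`_i - s'`_i|.

Definition boundedseq (n : nat) (M : R) (G : seq R -> R) :=
  forall s, size s = n -> `|G s| <= M.

Lemma measurable_countable_range d (T : measurableType d) (I : countType) (q : T -> I)
    (f : I -> R) :
  (forall i, measurable (q @^-1` [set i])) -> measurable_fun setT (f \o q).
Proof.
move=> mq _ B mB; rewrite setTI.
rewrite (_ : _ @^-1` _ = \bigcup_(i in [set: I]) (q @^-1` [set i] `&` [set w | B (f i)])).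
  apply: countable_bigcupT_measurable; first exact: countableP.
  move=> i; apply: measurableI => //.
  have [Bi|Bi] := pselect (B (f i)).
    by rewrite (_ : [set _ | _] = setT)//; apply/seteqP; split.
  by rewrite (_ : [set _ | _] = set0)//; apply/seteqP; split.
apply/seteqP; split => [w/= Bw|w [i _ [/= <-]]//].
by exists (q w).
Qed.

(** Countable ranges stand in for a measurable structure on lists: the coordinates are rounded down
    to multiples of [1 / (j + 1)], and the Lipschitz bound yields pointwise convergence as [j]
    grows. *)
Lemma measurable_lipseq d (T : measurableType d) (X : nat -> T -> R) n K G :
  (forall i, (i < n)%N -> measurable_fun setT (X i)) -> lipseq n K G ->
  measurable_fun setT (fun w => G (mkseq (X ^~ w) n)).
Proof.
move=> mX lG.
pose q (j : nat) w : seq int := mkseq (fun i => Num.floor (X i w * j.+1%:R)) n.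
pose h (j : nat) (s : seq int) := G [seq z%:~R / j.+1%:R | z <- s].
apply: (@measurable_fun_cvg _ _ _ _ (fun j => h j \o q j)).
  move=> j; apply: measurable_countable_range => s.
  have [sn|sn] := eqVneq (size s) n; last first.
    rewrite (_ : _ @^-1` _ = set0)//; apply/seteqP; split => // w /= qs.
    by move: sn; rewrite -qs /q size_mkseq eqxx.
  pose F (i : nat) := (fun w => X i w * j.+1%:R) @^-1`
         [set x | (s`_i)%:~R <= x < (s`_i + 1)%:~R].
  rewrite (_ : _ @^-1` _ = \big[setI/setT]_(i < n) F i); last first.
    rewrite -bigcap_mkord; apply/seteqP; split => [w /= qs|w /=].
      move=> i /= ilt; rewrite /F/=.
      rewrite -qs /q nth_mkseq//; exact: floor_itv.
    move=> H; apply: (@eq_from_nth _ 0).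
      by rewrite size_mkseq.
    move=> i; rewrite size_mkseq => ilt; rewrite nth_mkseq//.
    by have /= := H _ ilt; exact: floor_def.
  apply: big_ind => //; first exact: measurableI.
  move=> i _; rewrite /F -[_ @^-1` _]setTI.
  have mXi : measurable_fun setT (fun w => X i w * j.+1%:R).
    by apply: measurable_funM => //; exact: mX.
  apply: mXi => //.
  have -> : [set x : R | (s`_i)%:~R <= x < (s`_i + 1)%:~R] =
      `[(s`_i)%:~R, (s`_i + 1)%:~R[%classic.
    by apply/seteqP; split => x /=; rewrite in_itv.
  exact: measurable_itv.
move=> w _.
have lim0 : K * (n%:R * j.+1%:R^-1) @[j --> \oo] --> (0 : R).
  rewrite -(mulr0 K); apply: cvgMr; rewrite -(mulr0 n%:R); apply: cvgMr.
  exact: cvg_harmonic.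
apply/cvgrPdist_le => e e0.
move/cvgrPdist_le : lim0 => /(_ _ e0); apply: filterS => j.
rewrite sub0r normrN => le; apply: le_trans _ le.
rewrite /= /h.
set s' := map _ _; have s'n : size s' = n by rewrite size_map size_mkseq.
apply: le_trans (lG _ _ (size_mkseq _ _) s'n) _.
have [K0|K0] := leP 0 K; last first.
  apply: le_trans _ (normr_ge0 _).
  by rewrite nmulr_rle0// sumr_ge0.
apply: le_trans (ler_norm _); apply: ler_wpM2l => //.
rewrite (le_trans (y := \sum_(i < n) j.+1%:R^-1))//; last first.
  by rewrite sumr_const card_ord mulr_natl.
apply: ler_sum => i _; rewrite nth_mkseq// (nth_map 0) ?size_mkseq// nth_mkseq//.
have j0 : (0 : R) < j.+1%:R by [].
have /andP[lo hi] := floor_itv (X i w * j.+1%:R).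
have -> : X i w - (Num.floor (X i w * j.+1%:R))%:~R / j.+1%:R =
   (X i w * j.+1%:R - (Num.floor (X i w * j.+1%:R))%:~R) / j.+1%:R.
  by rewrite mulrBl mulfK ?gt_eqF.
rewrite ger0_norm; last by rewrite divr_ge0 ?subr_ge0// ltW.
rewrite ler_pdivrMr// mulVf ?gt_eqF// lerBlDl.
by move: hi; rewrite intrD => /ltW.
Qed.

Lemma mkseqS (f : nat -> R) n : mkseq f n.+1 = rcons (mkseq f n) (f n).
Proof. by rewrite /mkseq -addn1 iotaD map_cat/= cats1. Qed.

Lemma lipseq_rcons n K G s y y' : lipseq n.+1 K G -> size s = n ->
  `|G (rcons s y) - G (rcons s y')| <= K * `|y - y'|.
Proof.
move=> lG sn; apply: le_trans (lG _ _ _ _) _; rewrite ?size_rcons ?sn//.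
rewrite big_ord_recr/= big1 ?add0r; last first.
  by move=> i _; rewrite !nth_rcons sn ltn_ord subrr normr0.
by rewrite !nth_rcons sn ltnn eqxx.
Qed.

Lemma lip_measurable K (h : R -> R) : (forall x y, `|h x - h y| <= K * `|x - y|) ->
  measurable_fun setT h.
Proof.
move=> hK; pose G (s : seq R) := h s`_0.
have := @measurable_lipseq _ R (fun _ x => x) 1 K G (fun _ _ => @measurable_id _ _ _).
apply => s s' _ _; rewrite big_ord1; exact: hK.
Qed.

Lemma lipseq_int n K M G (nu : probability R R) : lipseq n.+1 K G -> boundedseq n.+1 M G ->
  lipseq n K (fun s => \int[nu]_y G (rcons s y)) /\
  boundedseq n M (fun s => \int[nu]_y G (rcons s y)).
Proof.
move=> lG bG.
have mG s : size s = n -> measurable_fun setT (fun y => G (rcons s y)).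
  move=> sn; apply: (@lip_measurable K) => x y; exact: (lipseq_rcons x y lG sn).
have iG s : size s = n -> nu.-integrable setT (EFin \o (fun y => G (rcons s y))).
  move=> sn; apply: (@bounded_integrable _ _ _ nu _ M); first exact: mG.
  by move=> y; apply: bG; rewrite size_rcons sn.
split => [s s' sn s'n|s sn]; last first.
  apply: abs_Rintegral_le; first exact: mG.
  by move=> y; apply: bG; rewrite size_rcons sn.
rewrite -RintegralB//; [|exact: iG..].
apply: abs_Rintegral_le => [|y].
  by apply: measurable_funB; exact: mG.
apply: le_trans (lG _ _ _ _) _; rewrite ?size_rcons ?sn ?s'n//.
rewrite big_ord_recr/= !nth_rcons sn s'n ltnn eqxx subrr normr0 addr0.
rewrite le_eqVlt; apply/orP; left; apply/eqP; congr (_ * _).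
by apply: eq_bigr => i _; rewrite !nth_rcons sn s'n ltn_ord.
Qed.

End lipseq.

(** * Replacing independent coordinates one at a time *)

Section swap.
Context {R : realType}.

Lemma indep_finS d (T : measurableType d) (P : probability T R) (X : nat -> T -> R) n :
  indep_fin P n.+1 X -> indep_fin P n X.
Proof.
move=> iX B mB; pose C i := if (i < n)%N then B i else setT.
have mC i : measurable (C i) by rewrite /C; case: ifP.
have := indep_cylinder_prod 0 iX (leqnSn n) mB.
by rewrite !big_mkord.
Qed.

Lemma indep_peel d (T : measurableType d) (P : probability T R) (X : nat -> T -> R)
    (nu : probability R R) n K M G :
  (forall i, measurable_fun setT (X i)) -> indep_fin P n.+1 X ->
  (forall B, measurable B -> P (X n @^-1` B) = nu B) ->
  lipseq n.+1 K G -> boundedseq n.+1 M G ->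
  \int[P]_w G (mkseq (X ^~ w) n.+1) =
  \int[P]_w \int[nu]_y G (rcons (mkseq (X ^~ w) n) y).
Proof.
move=> mX iX law lG bG.
pose T1 := g_sigma_algebraType (cylinder X 0 n).
pose f (z : T1 * R) := G (rcons (mkseq (X ^~ z.1) n) z.2).
have fM z : `|f z| <= M by apply: bG; rewrite size_rcons size_mkseq.
have mf : measurable_fun setT f.
  (* Joint measurability: the first [n] coordinates and the second component are [n + 1] measurable
     functions on [T1 * R], so [measurable_lipseq] applies. *)
  pose X' i (z : T1 * R) := if (i < n)%N then X i z.1 else z.2.
  have -> : f = fun z => G (mkseq (X' ^~ z) n.+1).
    apply/funext => z; rewrite mkseqS /X' ltnn /f; congr (G (rcons _ _)).
    apply: (@eq_from_nth _ 0); rewrite !size_mkseq// => i ilt.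
    by rewrite !nth_mkseq// ilt.
  apply: (measurable_lipseq _ lG) => i _; rewrite /X'.
  have [ilt|_] := ltnP i n; last exact: measurable_snd.
  apply: (measurableT_comp (f := (X i : T1 -> R))) => //.
  by apply: cylinder_coord; rewrite leq0n.
have mid : measurable_fun [set: T] (fun w => w : T1).
  move=> _ A mA; rewrite setTI; exact: sub_cylinder_sigma mA.
rewrite -(@indep_fubini _ _ _ T T1 R R P nu (fun w => w : T1) (X n) f M mid)//.
  by apply: eq_Rintegral => w _; rewrite mkseqS.
move=> A B mA mB; rewrite (_ : _ @^-1` A = A)// -law//.
apply: (indep_cylinder (lo := 0) (mid := n) iX mX) => //.
by apply: sub_sigma_algebra; exists (fun=> B) => //; rewrite big_nat1.
Qed.

(** Lindeberg's telescoping in abstract form: [Cl n] is a class of functions of [n] variables stable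
    under integrating out the last one, and [delta n] is the price of changing the law of that one.
    It serves twice, inside a block with smooth functions of the sum, and across blocks with
    Lipschitz functions of the block values. *)
Lemma swap_indep d1 d2 (T1 : measurableType d1) (T2 : measurableType d2)
    (P1 : probability T1 R) (P2 : probability T2 R)
    (X : nat -> T1 -> R) (Y : nat -> T2 -> R) (nu gam : nat -> probability R R)
    (Cl : nat -> (seq R -> R) -> Prop) (delta : nat -> R) :
  (forall i, measurable_fun setT (X i)) -> (forall i, measurable_fun setT (Y i)) ->
  (forall n G, Cl n G -> exists K M, lipseq n K G /\ boundedseq n M G) ->
  (forall n G, Cl n.+1 G -> Cl n (fun s => \int[nu n]_y G (rcons s y))) ->
  (forall n G s, Cl n.+1 G -> size s = n ->
     `|\int[nu n]_y G (rcons s y) - \int[gam n]_y G (rcons s y)| <= delta n) ->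
  forall n, indep_fin P1 n X -> indep_fin P2 n Y ->
  (forall i B, (i < n)%N -> measurable B -> P1 (X i @^-1` B) = nu i B) ->
  (forall i B, (i < n)%N -> measurable B -> P2 (Y i @^-1` B) = gam i B) ->
  forall G, Cl n G ->
  `|\int[P1]_w G (mkseq (X ^~ w) n) - \int[P2]_w G (mkseq (Y ^~ w) n)|
    <= \sum_(i < n) delta i.
Proof.
move=> mX mY Cl1 Cl2 Cl3; elim => [|n IH] iX iY lX lY G ClG.
  by rewrite /mkseq/= !Rintegral_prob_cst subrr normr0 big_ord0.
have [K [M [lG bG]]] := Cl1 _ _ ClG.
rewrite (indep_peel mX iX (fun B => lX n B (ltnSn n)) lG bG).
rewrite (indep_peel mY iY (fun B => lY n B (ltnSn n)) lG bG).
set G1 := fun s => \int[nu n]_y G (rcons s y).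
set G2 := fun s => \int[gam n]_y G (rcons s y).
have [lG1 bG1] : lipseq n K G1 /\ boundedseq n M G1 by exact: lipseq_int.
have [lG2 bG2] : lipseq n K G2 /\ boundedseq n M G2 by exact: lipseq_int.
rewrite -/(G1 _) -/(G2 _) big_ord_recr/=.
(* Hybrid term: the last coordinate follows [nu n], the others are those of [Y]. The first
   difference is the induction hypothesis for [G1], the second is bounded pointwise by [delta n]. *)
rewrite -(subrKA (\int[P2]_w G1 (mkseq (Y ^~ w) n))).
apply: le_trans (ler_normD _ _) _; apply: lerD.
  apply: IH (Cl2 _ _ ClG); [exact: indep_finS|exact: indep_finS| |].
    by move=> i B ilt; apply: lX; rewrite ltnW.
  by move=> i B ilt; apply: lY; rewrite ltnW.
have mG (G' : seq R -> R) : lipseq n K G' ->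
    measurable_fun setT (fun w => G' (mkseq (Y ^~ w) n)).
  by move=> lG'; exact: (measurable_lipseq (fun i _ => mY i) lG').
have iG (G' : seq R -> R) : lipseq n K G' -> boundedseq n M G' ->
    P2.-integrable setT (EFin \o (fun w => G' (mkseq (Y ^~ w) n))).
  move=> lG' bG'; apply: (@bounded_integrable _ _ _ P2 _ M); first exact: mG.
  by move=> y; apply: bG'; rewrite size_mkseq.
rewrite -[X in `|_ - X|]/(\int[P2]_w G2 (mkseq (Y ^~ w) n)).
rewrite -RintegralB//; [|by apply: iG..].
apply: abs_Rintegral_le => [|y].
  by apply: measurable_funB; exact: mG.
by apply: Cl3 => //; rewrite size_mkseq.
Qed.

End swap.

(** * Moments of the normal law *)

Section normal_moments.
Context {R : realType}.
Local Notation mu := (@lebesgue_measure R).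

(** The change of variables produces the Radon-Nikodym derivative; it equals [normal_pdf] almost
    everywhere since both have the same integral over every measurable set. *)
Lemma ge0_integral_normal_prob (m s : R) (f : R -> \bar R) :
  measurable_fun setT f -> (forall x, (0 <= f x)%E) ->
  (\int[normal_prob m s]_x f x = \int[mu]_x (f x * (normal_pdf m s x)%:E))%E.
Proof.
move=> mf f0; have dom := normal_prob_dominates m s.
rewrite -(Radon_Nikodym_SigmaFinite.change_of_variables dom)//.
have mg := measurable_int mu (Radon_Nikodym_SigmaFinite.f_integrable dom).
have mp : measurable_fun setT (fun x => (normal_pdf m s x)%:E).
  by apply/measurable_EFinP; exact: measurable_normal_pdf.
apply: ge0_ae_eq_integral => //.
- exact: emeasurable_funM.
- exact: emeasurable_funM.
- by move=> x _; rewrite mule_ge0// Radon_Nikodym_SigmaFinite.f_ge0.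
- by move=> x _; rewrite mule_ge0// lee_fin normal_pdf_ge0.
apply: ae_eqe_mul2l => /=.
apply: integral_ae_eq => //=.
  exact: (Radon_Nikodym_SigmaFinite.f_integrable dom).
by move=> E _ mE; rewrite -Radon_Nikodym_SigmaFinite.f_integral.
Qed.


Variable (s : R).
Hypothesis s0 : 0 < s.
Local Notation p := (normal_pdf 0 s).

Let pE x : p x = normal_peak s * expR (- (x ^+ 2 / (s ^+ 2 *+ 2))).
Proof. by rewrite normal_pdfE ?gt_eqF// /normal_fun subr0 mulNr. Qed.

Let is_derive_p (x : R) : is_derive x 1 (p : R^o -> R^o) (- (x / s ^+ 2) * p x).
Proof.
have -> : p = fun x => normal_peak s * expR (- (x ^+ 2 / (s ^+ 2 *+ 2))).
  by apply/funext => y; exact: pE.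
apply: is_derive_eq.
rewrite /GRing.scale/=.
have := lt0r_neq0 s0; move=> ?; field => //.
Qed.

(** Integration by parts in disguise: [F k] is an antiderivative of [f k], so that the moment of
    order [k + 2] is [(k + 1) s^2] times the moment of order [k], up to the boundary term
    [F k n]. *)
Let F k (x : R) := s ^+ 2 * x ^+ k.+1 * p x.
Let f k (x : R) := k.+1%:R * s ^+ 2 * (x ^+ k * p x) - x ^+ k.+2 * p x.

Let is_derive_F k (x : R) : is_derive x 1 (F k : R^o -> R^o) (f k x).
Proof.
have d1 := @is_deriveX R R^o id k.+1 x 1 1 (is_derive_id _ _).
have := is_deriveZ (s ^+ 2) (is_deriveM d1 (is_derive_p x)).
have -> : s ^+ 2 \*: ((id : R^o -> R^o) ^+ k.+1 * p) = F k.
  by apply/funext => y; rewrite /F !fctE/= /GRing.scale/= mulrA.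
move=> dF; apply: (is_derive_eq dF).
rewrite /GRing.scale/= /f fctE/= !exprS.
have := lt0r_neq0 s0; move=> ?; field => //.
Qed.

Let cp : continuous p.
Proof. by apply: continuous_normal_pdf; rewrite gt_eqF. Qed.

Let cxp k : continuous (fun x : R => x ^+ k * p x).
Proof. by move=> x; apply: cvgM; [exact: exprn_continuous|exact: cp]. Qed.

Let ixp k n : mu.-integrable `[0, n] (EFin \o (fun x => x ^+ k * p x)).
Proof.
apply: continuous_compact_integrable; first exact: segment_compact.
by apply: continuous_subspaceT; exact: cxp.
Qed.

Let J k n := \int[mu]_(x in `[0, n]) (x ^+ k * p x).

Let JE k n : (\int[mu]_(x in `[0%R, n]) (x ^+ k * p x)%:E = (J k n)%:E)%E.
Proof. by rewrite /J /Rintegral fineK//; exact: (integrable_fin_num _ (ixp k n)). Qed.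

Let J_rec k n : 0 < n -> J k.+2 n = k.+1%:R * s ^+ 2 * J k n - F k n.
Proof.
move=> n0.
have cF x : {for x, continuous (F k)}.
  by apply: differentiable_continuous; apply/derivable1_diffP; case: (is_derive_F k x).
have cf : continuous (f k).
  move=> x; apply: (@cvgB _ R^o); last exact: cxp.
  by apply: cvgM; [exact: cvg_cst|exact: cxp].
have := @continuous_FTC2 R (f k) (F k) 0 n n0 (continuous_subspaceT cf).
have -> : F k 0 = 0 by rewrite /F expr0n/= mulr0 mul0r.
have -> : (\int[mu]_(x in `[0%R, n]) (f k x)%:E =
          (k.+1%:R * s ^+ 2 * J k n - J k.+2 n)%:E)%E.
  rewrite EFinB EFinM -!JE.
  rewrite -integralZl//=; last exact: ixp.
  rewrite -integralB//=; last 2 first.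
  - by apply: (integrableZl (mu := mu) _ (k.+1%:R * s ^+ 2)); last exact: ixp.
  - exact: ixp.
move=> FTC.
have dF : derivable_oo_LRcontinuous (F k) 0 n.
  split.
  - by move=> x _; apply: ex_derive; exact: is_derive_F.
  - by apply: cvg_at_right_filter; exact: cF.
  - by apply: cvg_at_left_filter; exact: cF.
have F'f : {in `]0, n[, (F k)^`()%classic =1 f k}.
  by move=> x _; rewrite derive1E; apply: derive_val; exact: is_derive_F.
by have := congr1 fine (FTC dF F'f); rewrite sube0 /= => <-; ring.
Qed.

Let I k := (\int[mu]_(x in `[0%R, +oo[) (x ^+ k * p x)%:E)%E.

Let J_cvg k : ~~ odd k -> (J k n%:R)%:E @[n --> \oo] --> I k.
Proof.
move=> ek; rewrite /I; under eq_fun do rewrite -JE.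
apply: ge0_cvgn_integral.
  by move=> x; rewrite mulr_ge0 ?normal_pdf_ge0// exprn_even_ge0.
by apply: continuous_measurable_fun; exact: cxp.
Qed.

Let F_cvg k : (k <= 2)%N -> F k n%:R @[n --> \oo] --> 0.
Proof.
move=> k2; rewrite -(cvg_shiftS (fun n => F k n%:R)).
pose C := s ^+ 2 * normal_peak s * (8 * s ^+ 4).
have lim0 : C * n.+1%:R^-1 @[n --> \oo] --> (0 : R).
  by rewrite -(mulr0 C); apply: cvgMr; exact: cvg_harmonic.
apply: (squeeze_cvgr _ (cvg_cst 0) lim0).
near=> n; apply/andP; split.
  by rewrite /F mulr_ge0 ?normal_pdf_ge0// mulr_ge0 ?sqr_ge0// exprn_ge0.
set x : R := n.+1%:R; have x0 : 0 < x by [].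
have x1 : 1 <= x by rewrite ler1n.
rewrite /= /F -/x pE /C.
set y := x ^+ 2 / _.
have y0 : 0 < y by rewrite divr_gt0 ?exprn_gt0// pmulrn_lgt0 ?exprn_gt0.
(* From [exp y >= y^2 / 2] with [y = x^2 / (2 s^2)]. The decay [x^-4] beats the factor [x ^+ k.+1]
   because [k <= 2]. *)
have ey : expR (- y) <= 8 * s ^+ 4 / x ^+ 4.
  rewrite expRN -[leRHS]invrK lef_pV2 ?posrE ?invr_gt0 ?expR_gt0 ?divr_gt0 ?mulr_gt0 ?exprn_gt0//.
  apply: le_trans (expR_ge1Dxn 1 (ltW y0)).
  rewrite -[leLHS]add0r lerD// le_eqVlt; apply/orP; left; apply/eqP.
  rewrite /y; have := lt0r_neq0 s0; have := lt0r_neq0 x0; move=> ? ?.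
  rewrite (_ : 2`!%:R = 2)//; field; exact/andP.
have -> : s ^+ 2 * normal_peak s * (8 * s ^+ 4) * x^-1 =
   s ^+ 2 * x ^+ 3 * (normal_peak s * (8 * s ^+ 4 / x ^+ 4)).
  by have := lt0r_neq0 x0; move=> ?; field.
apply: ler_pM.
- by rewrite mulr_ge0 ?sqr_ge0// exprn_ge0// ltW.
- by rewrite mulr_ge0 ?normal_peak_ge0// expR_ge0.
- by apply: ler_wpM2l; [exact: sqr_ge0|exact: ler_weXn2l].
- by apply: ler_wpM2l ey; exact: normal_peak_ge0.
Unshelve. all: by end_near. Qed.

Let I_rec k r : (k <= 2)%N -> ~~ odd k -> I k = r%:E ->
  I k.+2 = (k.+1%:R * s ^+ 2 * r)%:E.
Proof.
move=> k2 ek Ir.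
have Jr : J k n%:R @[n --> \oo] --> r by have := J_cvg ek; rewrite Ir => /fine_cvgP[].
have ek2 : ~~ odd k.+2 by rewrite /= negbK.
have := J_cvg ek2; rewrite -(cvg_shiftS (fun n => (J k.+2 n%:R)%:E)).
under eq_fun do rewrite J_rec//.
move=> H; apply: cvg_unique H _ => //.
apply/fine_cvgP; split; first by near=> n.
rewrite -[k.+1%:R * _ * r]subr0; apply: (@cvgB _ R^o).
  apply: cvgM; first exact: cvg_cst.
  by rewrite (cvg_shiftS (fun n => J k n%:R)).
by rewrite (cvg_shiftS (fun n => F k n%:R)); exact: F_cvg.
Unshelve. all: by end_near. Qed.

Let even_moment k : ~~ odd k ->
  (\int[normal_prob 0 s]_x (x ^+ k)%:E = 2%:E * I k)%E.
Proof.
move=> ek; rewrite ge0_integral_normal_prob; last 2 first.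
- by apply/measurable_EFinP; exact: measurable_funX.
- by move=> x; rewrite lee_fin exprn_even_ge0.
under eq_integral do rewrite -EFinM.
rewrite ge0_symfun_integralT.
- by rewrite /I set_itvcy.
- by move=> x; rewrite mulr_ge0 ?normal_pdf_ge0// exprn_even_ge0.
- exact: cxp.
- by move=> x; rewrite /= !pE sqrrN exprNn -signr_odd (negbTE ek) mul1r.
Qed.

Lemma normal_prob_moment2 : (\int[normal_prob 0 s]_x (x ^+ 2)%:E = (s ^+ 2)%:E)%E.
Proof.
have I0 : I 0 = 2^-1%:E.
  have := @even_moment 0 isT.
  rewrite (eq_integral (cst 1%E))// integral_cst// mul1e.
  rewrite [X in X = _ -> _](_ : _ = 1%E); last exact: probability_setT.
  by move=> /(congr1 (fun z => 2^-1%:E * z)%E); rewrite mule1 muleA -EFinM mulVf// mul1e.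
by rewrite even_moment// (I_rec _ _ I0)// -EFinM; congr EFin; field.
Qed.

Lemma normal_prob_moment4 :
  (\int[normal_prob 0 s]_x (x ^+ 4)%:E = (3 * s ^+ 4)%:E)%E.
Proof.
have I2 : I 2 = (s ^+ 2 / 2)%:E.
  have := normal_prob_moment2; rewrite even_moment//.
  move=> /(congr1 (fun z => 2^-1%:E * z)%E); rewrite muleA -EFinM mulVf// mul1e => ->.
  by rewrite -EFinM mulrC.
by rewrite even_moment// (I_rec _ _ I2)// -EFinM; congr EFin; field.
Qed.

Lemma normal_prob_mean : \int[normal_prob 0 s]_x x = 0.
Proof.
rewrite /Rintegral integralE.
have mid : measurable_fun [set: R] (EFin : R -> \bar R) by exact/measurable_EFinP.
suff -> : (\int[normal_prob 0 s]_x ((fun x => x%:E)^\- x) =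
           \int[normal_prob 0 s]_x ((fun x => x%:E)^\+ x))%E.
  set A := (X in (X - X)%E).
  by case: A => [r| |] //=; rewrite subrr.
rewrite !ge0_integral_normal_prob//; last 2 first.
- exact: measurable_funepos.
- exact: measurable_funeneg.
(* Lebesgue measure is invariant under [x -> - x], which exchanges the positive and negative parts
   and fixes the density. *)
transitivity (\int[pushforward mu (-%R : _ -> measurableTypeR R)]_x
   ((EFin^\- x * (p x)%:E)))%E.
  by apply: eq_measure_integral => A mA _; exact/esym/lebesgue_measureN.
rewrite ge0_integral_pushforward//=; last 2 first.
- apply: emeasurable_funM; first exact: measurable_funeneg.
  by apply/measurable_EFinP; exact: measurable_normal_pdf.
- by move=> x _; rewrite mule_ge0// lee_fin normal_pdf_ge0.
apply: eq_integral => x _ /=.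
by rewrite funenegE funeposE !pE sqrrN EFinN oppeK.
Qed.

End normal_moments.

(** * Smooth approximation of Lipschitz functions *)

Section taylor.
Context {R : realType}.
Implicit Types (f g h : R -> R) (K B s u x : R).
Local Notation mu := (@lebesgue_measure R).

(** The fundamental theorem differentiates an integral at points to the right of its base point, so
    the base point [- (|x| + 1)] moves with [x]; subtracting the integral up to 0 makes the value
    independent of the base point. *)
Lemma continuous_antiderivative h : continuous h ->
  exists H : R -> R, forall x, is_derive x 1 (H : R^o -> R^o) (h x).
Proof.
move=> ch.
have ih (a b : R) : mu.-integrable `[a, b] (EFin \o h).
  by apply: continuous_compact_integrable; [exact: segment_compact|exact: continuous_subspaceT].
pose HA (A x : R) := \int[mu]_(t in `[- A, x]) h t - \int[mu]_(t in `[- A, 0]) h t.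
have HAE A A' x : 0 <= A' -> A' <= A -> - A' <= x -> HA A x = HA A' x.
  move=> A0 AA Ax; rewrite /HA.
  have E y : - A' <= y -> \int[mu]_(t in `[- A, y]) h t =
      \int[mu]_(t in `[- A', y]) h t + \int[mu]_(t in `[- A, - A']) h t.
    move=> Ay; have := @Rintegral_itvB R h (BLeft (- A)) (BRight y) (- A') (ih _ _).
    rewrite !bnd_simp lerN2 => /(_ AA Ay) H; rewrite -[LHS](subrK (\int[mu]_(t in `[- A, - A']) h t)).
    rewrite H Rintegral_itv_obnd_cbnd//; apply: integrableS (ih (- A') y) => //.
    by apply: subset_itv; rewrite ?bnd_simp.
  by rewrite (E x)// (E 0) ?oppr_le0//; ring.
exists (fun x => HA (`|x| + 1) x) => x.
pose A := `|x| + 2.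
apply: (@near_eq_is_derive _ _ _ (HA A)).
  near=> y; apply: HAE.
  - by rewrite addr_ge0.
  - have : `|x - y| < 1 by near: y; exact: (nbhsx_ballx x (1 : R) ltr01).
    have := ler_distD x y 0; rewrite !subr0 distrC /A; lra.
  - have := ler_norm (- y); rewrite normrN; lra.
have Ax : - A < x by have := ler_norm (- x); rewrite normrN /A; lra.
have x1 : x < x + 1 by rewrite ltrDl.
have [d1 d2] := continuous_FTC1_closed x1 (ih _ _) Ax (ch x).
rewrite -[h x]subr0 /HA; apply: is_deriveB.
by apply: (DeriveDef d1); rewrite -d2 derive1E.
Unshelve. all: by end_near. Qed.

Lemma is_derive_continuous f g : (forall x, is_derive x 1 (f : R^o -> R^o) (g x)) ->
  continuous f.
Proof.
by move=> df x; apply: differentiable_continuous; apply/derivable1_diffP; case: (df x).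
Qed.

Lemma mvt_bound f g B u : (forall x, is_derive x 1 (f : R^o -> R^o) (g x)) ->
  (forall v, `|v| <= `|u| -> `|g v| <= B) -> `|f u - f 0| <= B * `|u|.
Proof.
move=> df gB; have cf := is_derive_continuous df.
have [u0|u0|->] := ltgtP u 0; last by rewrite subrr !normr0 mulr0.
  have [c] := MVT u0 (fun x _ => df x) (continuous_subspaceT cf).
  rewrite in_itv/= => /andP[uc c0]; rewrite sub0r -distrC => ->.
  rewrite normrM normrN; apply: ler_wpM2r => //; apply: gB.
  by rewrite !ltr0_norm// lerN2 ltW.
have [c] := MVT u0 (fun x _ => df x) (continuous_subspaceT cf).
rewrite in_itv/= => /andP[c0 cu]; rewrite subr0 => ->.
rewrite normrM; apply: ler_wpM2r => //; apply: gB.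
by rewrite !gtr0_norm// ltW.
Qed.

Lemma is_derive_shiftr f g (c : R) : (forall x, is_derive x 1 (f : R^o -> R^o) (g x)) ->
  forall x, is_derive x 1 ((fun y => f (c + y)) : R^o -> R^o) (g (c + x)).
Proof.
move=> df x; rewrite -[g (c + x)]mulr1.
apply: (@is_derive1_comp R f (fun y => c + y) x (g (c + x)) 1 (df _)).
by apply: is_derive_eq; rewrite add0r mulr1.
Qed.

Lemma taylor1 f g K x u : (forall x, is_derive x 1 (f : R^o -> R^o) (g x)) ->
  (forall x y, `|g x - g y| <= K * `|x - y|) -> 0 <= K ->
  `|f (x + u) - f x - g x * u| <= K * u ^+ 2.
Proof.
move=> df gK K0.
have dF (v : R) : is_derive v 1 ((fun v : R => f (x + v) - g x * v) : R^o -> R^o) (g (x + v) - g x).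
  have dv : is_derive v 1 ((fun v : R => g x * v) : R^o -> R^o) (g x).
    by apply: is_derive_eq; rewrite /GRing.scale/= mulr1 ?mulr0 ?add0r.
  exact: is_deriveB (is_derive_shiftr x df v) dv.
have := @mvt_bound _ _ (K * `|u|) u dF; rewrite addr0 mulr0 subr0 => H.
rewrite -normr_id normr_id -real_normK ?num_real// expr2 mulrA.
apply: le_trans (H _); first by rewrite addrAC.
move=> v vu; apply: le_trans (gK _ _) _; apply: ler_wpM2l => //.
by rewrite addrAC subrr add0r.
Qed.

Lemma taylor2 f g h K x u : (forall x, is_derive x 1 (f : R^o -> R^o) (g x)) ->
  (forall x, is_derive x 1 (g : R^o -> R^o) (h x)) ->
  (forall x y, `|h x - h y| <= K * `|x - y|) -> 0 <= K ->
  `|f (x + u) - f x - g x * u - h x * u ^+ 2 / 2| <= K * `|u| ^+ 3.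
Proof.
move=> df dg hK K0.
have dF (v : R) : is_derive v 1 ((fun v : R => f (x + v) - (g x * v + h x * v ^+ 2 / 2)) : R^o -> R^o)
    (g (x + v) - (g x + h x * v)).
  have dv : is_derive v 1 ((fun v : R => g x * v + h x * v ^+ 2 / 2) : R^o -> R^o) (g x + h x * v).
    by apply: is_derive_eq; rewrite /GRing.scale/=; field.
  exact: is_deriveB (is_derive_shiftr x df v) dv.
have := @mvt_bound _ _ (K * u ^+ 2) u dF; rewrite addr0 !mulr0 expr0n/= mulr0 mul0r addr0 subr0 => H.
rewrite [`|u| ^+ 3]exprSr real_normK ?num_real// [leRHS]mulrA.
apply: le_trans (H _); first by rewrite le_eqVlt; apply/orP; left; apply/eqP; congr `|_|; ring.
move=> v vu; rewrite opprD addrA.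
apply: le_trans (taylor1 x v dg hK K0) _.
apply: ler_wpM2l => //; rewrite -[v ^+ 2]real_normK ?num_real// -[u ^+ 2]real_normK ?num_real//.
by rewrite lerXn2r// nnegrE.
Qed.

End taylor.

Section smoothing.
Context {R : realType}.
Implicit Types (f g h a b : R -> R) (K B s u x : R).

Definition blip h := exists K M, (forall x y, `|h x - h y| <= K * `|x - y|) /\
  (forall x, `|h x| <= M).

(** [a] and [b] stand for the first two derivatives of [h], but only the Taylor estimate is
    retained: it survives averaging over translations without differentiation under the integral.
    The minimum in the remainder makes second moments sufficient. *)
Record taylor_class B h a b : Prop := TaylorClass {
  tc_h : blip h ; tc_a : blip a ; tc_b : blip b ;
  tc_bB : forall x, `|b x| <= B ;
  tc_rem : forall x u, `|h (x + u) - h x - a x * u - b x * u ^+ 2 / 2| <=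
     B * Num.min (u ^+ 2) (`|u| ^+ 3) }.

Lemma lip_continuous h K : 0 <= K -> (forall x y, `|h x - h y| <= K * `|x - y|) ->
  continuous h.
Proof.
move=> K0 hK x; apply/cvgrPdist_le => e e0.
have eK : 0 < e / (K + 1) by rewrite divr_gt0// ltr_wpDl.
near=> y; apply: le_trans (hK _ _) _.
have : `|x - y| < e / (K + 1) by near: y; exact: (nbhsx_ballx x _ eK).
rewrite ltr_pdivlMr ?ltr_wpDl// => H; apply: le_trans (ltW H).
by rewrite mulrC; apply: ler_wpM2l => //; rewrite lerDl.
Unshelve. all: by end_near. Qed.

(** The approximation is the second difference quotient, of step [s], of a second antiderivative
    [G2] of [h], that is, an average of [h] over [[x, x + 2 s]] with a triangular weight. Its
    derivatives are the same quotients of [G1] and of [h]. *)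
Lemma smooth_approx h K M s : 0 < s -> 0 <= K ->
  (forall x y, `|h x - h y| <= K * `|x - y|) -> (forall x, `|h x| <= M) ->
  exists hs a b, taylor_class (K * (4 / s ^+ 2 + 3 / s)) hs a b /\
    forall x, `|hs x - h x| <= 4 * K * s.
Proof.
move=> s0 K0 hK hM.
have ch := lip_continuous K0 hK.
have [G1 dG1] := continuous_antiderivative ch.
have [G2 dG2] := continuous_antiderivative (is_derive_continuous dG1).
pose D f x := (f (x + 2 * s) - 2 * f (x + s) + f x) / s ^+ 2.
have sn0 : s != 0 by rewrite gt_eqF.
have dsh f g c : (forall x, is_derive x 1 (f : R^o -> R^o) (g x)) ->
    forall x : R, is_derive x 1 ((fun y => f (y + c)) : R^o -> R^o) (g (x + c)).
  move=> df x; rewrite addrC.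
  rewrite (_ : (fun y => f (y + c)) = (fun y => f (c + y))); last first.
    by apply/funext => y; rewrite addrC.
  exact: is_derive_shiftr.
have dD f g : (forall x, is_derive x 1 (f : R^o -> R^o) (g x)) ->
    forall x : R, is_derive x 1 (D f : R^o -> R^o) (D g x).
  move=> df x; have d2 := dsh _ _ (2 * s) df x; have d1 := dsh _ _ s df x.
  have d0 := df x.
  have := is_deriveZ (s ^+ 2)^-1 (is_deriveD (is_deriveB d2 (is_deriveZ 2 d1)) d0).
  rewrite (_ : _ \*: _ = D f); last first.
    by apply/funext => y; rewrite /D !fctE/= /GRing.scale/= mulrC.
  by move=> d; apply: (is_derive_eq d); rewrite /GRing.scale/= /D mulrC.
have b_le x : `|D h x| <= 2 * K / s.
  rewrite /D (_ : _ / _ = ((h (x + 2 * s) - h (x + s)) - (h (x + s) - h x)) / s ^+ 2); last by field.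
  rewrite normrM [X in _ * X]ger0_norm ?invr_ge0 ?sqr_ge0//.
  rewrite ler_pdivrMr ?exprn_gt0// (_ : 2 * K / s * s ^+ 2 = K * s + K * s); last by field.
  apply: le_trans (ler_normB _ _) _; apply: lerD; apply: le_trans (hK _ _) _.
    by rewrite (_ : _ - _ = s) ?gtr0_norm//; ring.
  by rewrite (_ : _ - _ = s) ?gtr0_norm//; ring.
have b_lip x y : `|D h x - D h y| <= (4 * K / s ^+ 2) * `|x - y|.
  have hxy c : `|h (x + c) - h (y + c)| <= K * `|x - y|.
    by apply: le_trans (hK _ _) _; rewrite (_ : _ - _ = x - y)//; ring.
  have h0 := hxy 0; rewrite !addr0 in h0.
  rewrite /D (_ : _ - _ = (h (x + 2 * s) - h (y + 2 * s) -
     2 * (h (x + s) - h (y + s)) + (h x - h y)) / s ^+ 2); last by field.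
  rewrite normrM [X in _ * X]ger0_norm ?invr_ge0 ?sqr_ge0//.
  rewrite ler_pdivrMr ?exprn_gt0//.
  rewrite (_ : 4 * K / s ^+ 2 * `|x - y| * s ^+ 2 = K * `|x - y| + 2 * (K * `|x - y|) + K * `|x - y|); last by field.
  apply: le_trans (ler_normD _ _) _; apply: lerD => //.
  apply: le_trans (ler_normB _ _) _; apply: lerD => //.
  by rewrite normrM ger0_norm//; apply: ler_wpM2l.
have lip_of f g C : (forall x, is_derive x 1 (f : R^o -> R^o) (g x)) ->
    (forall x, `|g x| <= C) -> forall x y, `|f x - f y| <= C * `|x - y|.
  move=> df gC x y; have := mvt_bound (u := x - y) (is_derive_shiftr y df) (fun v _ => gC _).
  by rewrite addr0 (_ : y + (x - y) = x)//; ring.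
have a_lip := lip_of _ _ _ (dD _ _ dG1) b_le.
have a_le x : `|D G1 x| <= K.
  have dphi (v : R) : is_derive v 1 ((fun v : R => G1 (x + s + v) - G1 (x + v)) : R^o -> R^o)
      (h (x + s + v) - h (x + v)).
    exact: is_deriveB (is_derive_shiftr (x + s) dG1 v) (is_derive_shiftr x dG1 v).
  have := mvt_bound (B := K * s) (u := s) dphi.
  rewrite !addr0 => H.
  rewrite /D (_ : _ / _ = (G1 (x + s + s) - G1 (x + s) - (G1 (x + s) - G1 x)) / s ^+ 2); last first.
    by rewrite (_ : x + s + s = x + 2 * s); [field|ring].
  rewrite normrM [X in _ * X]ger0_norm ?invr_ge0 ?sqr_ge0//.
  rewrite ler_pdivrMr ?exprn_gt0// expr2 mulrA -[X in _ * X]gtr0_norm//; apply: H => v _.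
  apply: le_trans (hK _ _) _.
  by rewrite (_ : _ - _ = s) ?gtr0_norm//; ring.
have hs_lip := lip_of _ _ _ (dD _ _ dG2) a_le.
have hs_h x : `|D G2 x - h x| <= 4 * K * s.
  (* The second difference minus [s^2 h x] is treated as a function of the step, vanishing at step
     0; the mean value theorem is used once in the step [v] and once in [w], where
     [|h (x + v + w) - h x| <= K (2 s)]. *)
  have dpsi v (w : R) : is_derive w 1 ((fun w : R => G1 (x + v + w) - w * h x) : R^o -> R^o)
      (h (x + v + w) - h x).
    apply: is_deriveB; first exact: is_derive_shiftr dG1 w.
    by apply: is_derive_eq; rewrite /GRing.scale/=; ring.
  have dphi (v : R) : is_derive v 1 ((fun v : R => G2 (x + 2 * v) - 2 * G2 (x + v) + G2 x - v ^+ 2 * h x) : R^o -> R^o)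
      (2 * (G1 (x + v + v) - G1 (x + v) - v * h x)).
    have d1 := is_derive_shiftr x dG2 v.
    have d2 : is_derive v 1 ((fun v : R => G2 (x + 2 * v)) : R^o -> R^o) (G1 (x + 2 * v) * 2).
      apply: (@is_derive1_comp R (fun z => G2 (x + z)) (fun z => 2 * z)).
        exact: is_derive_shiftr.
      by apply: is_derive_eq; rewrite /GRing.scale/=; ring.
    have d3 : is_derive v 1 ((fun v : R => v ^+ 2 * h x) : R^o -> R^o) (2 * v * h x).
      by apply: is_derive_eq; rewrite /GRing.scale/=; ring.
    have d4 := is_deriveB (is_deriveD (is_deriveB d2 (is_deriveZ 2 d1)) (is_derive_cst (G2 x : R^o) (v : R^o) 1)) d3.
    apply: (is_derive_eq d4); rewrite /GRing.scale/= (_ : x + v + v = x + 2 * v); ring.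
  have phi' (v : R) : `|v| <= `|s| -> `|2 * (G1 (x + v + v) - G1 (x + v) - v * h x)| <= 4 * K * s ^+ 2.
    rewrite [in X in X -> _](gtr0_norm s0) => vs.
    have := mvt_bound (B := K * (2 * s)) (u := v) (dpsi v).
    rewrite addr0 mul0r subr0 addrAC => H.
    rewrite normrM [`|2|]ger0_norm// (_ : 4 * K * s ^+ 2 = 2 * (K * (2 * s) * s)); last by ring.
    apply: ler_wpM2l => //; apply: le_trans (H _) _.
      move=> w wv; apply: le_trans (hK _ _) _; apply: ler_wpM2l => //.
      rewrite (_ : x + v + w - x = v + w); last by ring.
      apply: le_trans (ler_normD _ _) _.
      by move: wv; lra.
    by apply: ler_wpM2l => //; rewrite !mulr_ge0// ltW.
  have := mvt_bound dphi phi'.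
  rewrite mulr0 !addr0 expr0n/= mul0r => H.
  rewrite /D (_ : _ - _ = (G2 (x + 2 * s) - 2 * G2 (x + s) + G2 x - s ^+ 2 * h x) / s ^+ 2); last by field.
  rewrite normrM [X in _ * X]ger0_norm ?invr_ge0 ?sqr_ge0// ler_pdivrMr ?exprn_gt0//.
  apply: le_trans (_ : _ <= 4 * K * s ^+ 2 * `|s|) _; last first.
    by rewrite gtr0_norm// le_eqVlt; apply/orP; left; apply/eqP; ring.
  by apply: le_trans H; rewrite le_eqVlt; apply/orP; left; apply/eqP; congr `|_|; ring.
exists (D G2), (D G1), (D h); split => //.
have Bge : 2 * K / s <= K * (4 / s ^+ 2 + 3 / s).
  rewrite -subr_ge0 (_ : _ - _ = K * (4 / s ^+ 2 + 1 / s)); last by field.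
  by rewrite mulr_ge0// addr_ge0// divr_ge0// ?sqr_ge0// ltW.
split.
- exists K, (4 * K * s + M); split => // x.
  rewrite -[D G2 x](subrK (h x)); apply: le_trans (ler_normD _ _) _; exact: lerD.
- by exists (2 * K / s), K.
- by exists (4 * K / s ^+ 2), (2 * K / s).
- by move=> x; apply: le_trans Bge.
(* First branch: the first-order estimate costs [2 K / s] and the term in [b] costs [K / s]. Second
   branch: the Lipschitz constant [4 K / s^2] of [b]. The constant of the class is the sum of all
   three. *)
move=> x u; rewrite minr_pMr ?le_min; last first.
  by rewrite mulr_ge0// addr_ge0// divr_ge0// ?sqr_ge0// ltW.
apply/andP; split.
  have := taylor1 x u (dD _ _ dG2) a_lip; rewrite divr_ge0 ?mulr_ge0 ?(ltW s0)// => /(_ isT) t1.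
  apply: le_trans (ler_normB _ _) _.
  apply: le_trans (lerD t1 (_ : _ <= K / s * u ^+ 2)) _.
    rewrite -mulrA normrM [X in _ * X]ger0_norm ?divr_ge0 ?sqr_ge0//.
    rewrite (_ : K / s * _ = (2 * K / s) * (u ^+ 2 / 2)); last by field.
    by apply: ler_wpM2r; rewrite ?divr_ge0 ?sqr_ge0.
  rewrite -mulrDl; apply: ler_wpM2r; first exact: sqr_ge0.
  rewrite -subr_ge0 (_ : _ - _ = K * (4 / s ^+ 2)); last by field.
  by rewrite mulr_ge0// divr_ge0// sqr_ge0.
have := taylor2 x u (dD _ _ dG2) (dD _ _ dG1) b_lip.
have p0 : 0 <= 4 * K / s ^+ 2 by rewrite divr_ge0 ?sqr_ge0// mulr_ge0.
move=> /(_ p0) t2.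
apply: le_trans t2 _; apply: ler_wpM2r; first exact: exprn_ge0.
rewrite -subr_ge0 (_ : _ - _ = K * (3 / s)); last by field.
by rewrite mulr_ge0// divr_ge0// ltW.
Qed.

End smoothing.

(** * Lindeberg replacement *)

Section lindeberg.
Context {R : realType}.
Implicit Types (f g h a b : R -> R) (K B s u x : R) (nu : probability R R).

Lemma integrable_subR d (T : measurableType d) (mu : {measure set T -> \bar R}) (f g : T -> R) :
  mu.-integrable setT (EFin \o f) ->
  mu.-integrable setT (EFin \o g) -> mu.-integrable setT (EFin \o (fun w => f w - g w)).
Proof. by move=> i1 i2; have := integrableB measurableT i1 i2; apply: eq_integrable. Qed.

Lemma integrable_mulrR nu f c : nu.-integrable setT (EFin \o f) ->
  nu.-integrable setT (EFin \o (fun w => c * f w)).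
Proof. by move=> i1; have := integrableZl measurableT c i1; apply: eq_integrable. Qed.

Lemma blip_measurable h : blip h -> measurable_fun setT h.
Proof. by move=> [K [M [hK _]]]; exact: lip_measurable hK. Qed.

Lemma blip_shift h x : blip h -> blip (fun y => h (x + y)).
Proof.
move=> [K [M [hK hM]]]; exists K, M; split => // y z.
by apply: le_trans (hK _ _) _; rewrite (_ : x + y - (x + z) = y - z)//; ring.
Qed.

Lemma blip_integrable nu h : blip h -> nu.-integrable setT (EFin \o h).
Proof.
move=> bh; have [K [M [hK hM]]] := bh.
by apply: bounded_integrable hM; exact: blip_measurable.
Qed.

Lemma blip_avg nu h : blip h -> blip (fun x => \int[nu]_y h (x + y)).
Proof.
move=> bh; have [K [M [hK hM]]] := bh; exists K, M; split => [x y|x].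
  rewrite -RintegralB//; [|exact/blip_integrable/blip_shift..].
  apply: abs_Rintegral_le => [|z].
    by apply: measurable_funB; [exact: blip_measurable (blip_shift x bh)|exact: blip_measurable (blip_shift y bh)].
  by apply: le_trans (hK _ _) _; rewrite (_ : x + z - (y + z) = x - y)//; ring.
apply: abs_Rintegral_le => [|z]; [exact: blip_measurable (blip_shift x bh)|exact: hM].
Qed.

Lemma taylor_class_avg nu B h a b : taylor_class B h a b ->
  taylor_class B (fun x => \int[nu]_y h (x + y)) (fun x => \int[nu]_y a (x + y))
    (fun x => \int[nu]_y b (x + y)).
Proof.
move=> [bh ba bb bB rem]; split; try exact: blip_avg.
  by move=> x; apply: abs_Rintegral_le => [|z]; [exact: blip_measurable (blip_shift x bb)|exact: bB].
move=> x u.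
have i1 := blip_integrable nu (blip_shift (x + u) bh).
have i2 := blip_integrable nu (blip_shift x bh).
have i3 := blip_integrable nu (blip_shift x ba).
have i4 := blip_integrable nu (blip_shift x bb).
have i3' : nu.-integrable setT (EFin \o (fun y => a (x + y) * u)).
  rewrite (_ : (fun y => _) = (fun y => u * a (x + y))); first exact: integrable_mulrR.
  by apply/funext => y; rewrite mulrC.
have i4' : nu.-integrable setT (EFin \o (fun y => b (x + y) * (u ^+ 2 / 2))).
  rewrite (_ : (fun y => _) = (fun y => (u ^+ 2 / 2) * b (x + y))); first exact: integrable_mulrR.
  by apply/funext => y; rewrite mulrC.
have i12 : nu.-integrable setT (EFin \o (fun y => h (x + u + y) - h (x + y))).
  exact: integrable_subR.
have i123 : nu.-integrable setT (EFin \o (fun y => h (x + u + y) - h (x + y) - a (x + y) * u)).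
  exact: integrable_subR.
have -> : \int[nu]_y h (x + u + y) - \int[nu]_y h (x + y) -
    (\int[nu]_y a (x + y)) * u - (\int[nu]_y b (x + y)) * u ^+ 2 / 2 =
    \int[nu]_y (h (x + u + y) - h (x + y) - a (x + y) * u - b (x + y) * (u ^+ 2 / 2)).
  by rewrite RintegralB// RintegralB// RintegralB// !RintegralZr// -mulrA.
apply: abs_Rintegral_le => [|y].
  have m1 := blip_measurable (blip_shift (x + u) bh).
  have m2 := blip_measurable (blip_shift x bh).
  have m3 := blip_measurable (blip_shift x ba).
  have m4 := blip_measurable (blip_shift x bb).
  by apply: measurable_funB; [apply: measurable_funB; [exact: measurable_funB|]|];
    apply: measurable_funM.
by rewrite mulrA (_ : x + u + y = x + y + u)//; ring.
Qed.

(** Its integral plays the part of Lindeberg's truncated moment: finite under a second moment, and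
    negligible against the variance after scaling down. *)
Definition min23 (y : R) := Num.min (y ^+ 2) (`|y| ^+ 3).

Record centered_moments nu (v tau : R) : Prop := CenteredMoments {
  cm_int1 : nu.-integrable setT (EFin : R -> \bar R) ;
  cm_int2 : nu.-integrable setT (EFin \o (fun y : R => y ^+ 2)) ;
  cm_mean : \int[nu]_y y = 0 ;
  cm_var : \int[nu]_y (y ^+ 2) = v ;
  cm_tau : \int[nu]_y min23 y <= tau }.

Lemma min23_ge0 y : 0 <= min23 y.
Proof. by rewrite le_min sqr_ge0/= exprn_ge0. Qed.

Lemma measurable_min23 : measurable_fun setT min23.
Proof.
apply: measurable_minr; first exact: measurable_funX.
by apply: measurable_funX; exact: normr_measurable.
Qed.

Lemma taylor_step nu v tau B h a b x : centered_moments nu v tau -> taylor_class B h a b ->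
  `|\int[nu]_y h (x + y) - (h x + b x * (v / 2))| <= B * tau.
Proof.
move=> [i1 i2 m0 m2 mt] [bh ba bb bB rem].
have B0 : 0 <= B by apply: le_trans (bB 0).
have ih := blip_integrable nu (blip_shift x bh).
have ihx : nu.-integrable setT (EFin \o cst (h x)) by exact: finite_measure_integrable_cst.
have ia : nu.-integrable setT (EFin \o (fun y => a x * y)).
  exact: (integrable_mulrR (f := id)).
have ib : nu.-integrable setT (EFin \o (fun y => b x / 2 * y ^+ 2)).
  exact: (integrable_mulrR (f := fun y => y ^+ 2)).
have i12 : nu.-integrable setT (EFin \o (fun y => h (x + y) - h x)).
  exact: (integrable_subR ih ihx).
have i123 : nu.-integrable setT (EFin \o (fun y => h (x + y) - h x - a x * y)).
  exact: (integrable_subR i12 ia).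
have -> : \int[nu]_y h (x + y) - (h x + b x * (v / 2)) =
    \int[nu]_y (h (x + y) - h x - a x * y - b x / 2 * y ^+ 2).
  rewrite RintegralB// RintegralB// RintegralB// Rintegral_prob_cst !RintegralZl//.
  by rewrite m0 m2; field.
have imin : nu.-integrable setT (EFin \o min23).
  apply: (le_integrable measurableT _ _ i2); first by apply/measurable_EFinP; exact: measurable_min23.
  move=> y _; rewrite /= lee_fin ger0_norm ?min23_ge0// ger0_norm ?sqr_ge0//.
  by rewrite ge_min lexx.
apply: le_trans (ler_wpM2l B0 mt); rewrite -RintegralZl//.
apply: le_abs_Rintegral.
- exact: (integrable_subR i123 ib).
- exact: integrable_mulrR.
- move=> y; apply: le_trans (rem x y).
  by rewrite (_ : b x / 2 * y ^+ 2 = b x * y ^+ 2 / 2)//; field.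
Qed.

Lemma seq_sum_dist n (s s' : seq R) : size s = n -> size s' = n ->
  `|\sum_(y <- s) y - \sum_(y <- s') y| <= \sum_(i < n) `|s`_i - s'`_i|.
Proof.
have E t : size t = n -> \sum_(y <- t) y = \sum_(i < n) t`_i.
  by move=> tn; rewrite (big_nth 0) tn big_mkord.
by move=> sn s'n; rewrite !E// -sumrB; exact: ler_norm_sum.
Qed.

Lemma sum_mkseq (f : nat -> R) n : \sum_(y <- mkseq f n) y = \sum_(i < n) f i.
Proof. by rewrite big_map -[X in iota 0 X]subn0 -/(index_iota 0 n) big_mkord. Qed.

(** The replacement class consists of the functions of the sum with a fixed Taylor constant;
    integrating out a coordinate averages translates. The term [8 s] is twice the smoothing error.
    The variances [v1] and [v2] may differ, because a block has an integer number of terms. *)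
Lemma lindeberg d1 d2 (T1 : measurableType d1) (T2 : measurableType d2)
    (P1 : probability T1 R) (P2 : probability T2 R)
    (X : nat -> T1 -> R) (Y : nat -> T2 -> R) (nu gam : nat -> probability R R)
    n (v1 v2 tau1 tau2 K M s : R) h :
  (forall i, measurable_fun setT (X i)) -> (forall i, measurable_fun setT (Y i)) ->
  indep_fin P1 n X -> indep_fin P2 n Y ->
  (forall i (A : set R), (i < n)%N -> measurable A -> P1 (X i @^-1` A) = nu i A) ->
  (forall i (A : set R), (i < n)%N -> measurable A -> P2 (Y i @^-1` A) = gam i A) ->
  (forall i, centered_moments (nu i) v1 tau1) ->
  (forall i, centered_moments (gam i) v2 tau2) ->
  0 < s -> 0 <= K -> (forall x y, `|h x - h y| <= K * `|x - y|) -> (forall x, `|h x| <= M) ->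
  `|\int[P1]_w h (\sum_(i < n) X i w) - \int[P2]_w h (\sum_(i < n) Y i w)|
    <= K * (8 * s + (4 / s ^+ 2 + 3 / s) * (n%:R * (tau1 + tau2 + `|v1 - v2|))).
Proof.
move=> mX mY iX iY lX lY mom1 mom2 s0 K0 hK hM.
have [hs [a [b [tc hsh]]]] := smooth_approx s0 K0 hK hM.
set B := K * _ in tc.
have B0 : 0 <= B by rewrite mulr_ge0// addr_ge0// divr_ge0// ?sqr_ge0// ltW.
pose Cl (n : nat) (G : seq R -> R) := exists h a b, taylor_class B h a b /\
  forall t, size t = n -> G t = h (\sum_(y <- t) y).
have Cl1 k G : Cl k G -> exists K M, lipseq k K G /\ boundedseq k M G.
  move=> [f [_ [_ [[[K' [M' [fK fM]]] _ _ _ _] GE]]]].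
  have K'0 : 0 <= K'.
    by have := fK 1 0; rewrite subr0 normr1 mulr1; apply: le_trans.
  exists K', M'; split => [t t' tk t'k|t tk]; last by rewrite GE.
  rewrite !GE//; apply: le_trans (fK _ _) _; apply: ler_wpM2l => //.
  exact: seq_sum_dist.
have Cl2 k G : Cl k.+1 G -> Cl k (fun t => \int[nu k]_y G (rcons t y)).
  move=> [f [f1 [f2 [tcf GE]]]].
  exists (fun x => \int[nu k]_y f (x + y)), (fun x => \int[nu k]_y f1 (x + y)),
    (fun x => \int[nu k]_y f2 (x + y)); split; first exact: taylor_class_avg.
  move=> t tk; apply: eq_Rintegral => y _.
  by rewrite GE ?size_rcons ?tk// -cats1 big_cat big_seq1.
have Cl3 k G t : Cl k.+1 G -> size t = k ->
    `|\int[nu k]_y G (rcons t y) - \int[gam k]_y G (rcons t y)| <=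
    B * (tau1 + tau2 + `|v1 - v2|).
  move=> [f [f1 [f2 [tcf GE]]]] tk.
  have E (nu' : probability R R) : \int[nu']_y G (rcons t y) = \int[nu']_y f (\sum_(z <- t) z + y).
    apply: eq_Rintegral => y _.
    by rewrite GE ?size_rcons ?tk// -cats1 big_cat big_seq1.
  rewrite !E; set x := \sum_(z <- t) z.
  have e1 := taylor_step x (mom1 k) tcf.
  have e2 := taylor_step x (mom2 k) tcf.
  have e3 : `|f2 x * (v1 / 2) - f2 x * (v2 / 2)| <= B * `|v1 - v2|.
    rewrite -mulrBr -mulrBl normrM; apply: ler_pM => //; first exact: tc_bB tcf x.
    by rewrite normrM [X in _ * X]ger0_norm// ler_piMr// invf_le1// ler1n.
  rewrite !mulrDr; move: e1 e2 e3; rewrite !ler_norml => /andP[? ?] /andP[? ?] /andP[? ?].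
  by apply/andP; split; lra.
have Clh : Cl n (fun t => hs (\sum_(y <- t) y)) by exists hs, a, b.
have := @swap_indep R _ _ T1 T2 P1 P2 X Y nu gam Cl _ mX mY Cl1 Cl2 Cl3 n iX iY lX lY _ Clh.
under eq_Rintegral do rewrite sum_mkseq.
under [in X in _ - X]eq_Rintegral do rewrite sum_mkseq.
rewrite sumr_const card_ord -mulr_natl => sw.
have diff d (T : measurableType d) (P : probability T R) (Z : T -> R) : measurable_fun setT Z ->
    `|\int[P]_w h (Z w) - \int[P]_w hs (Z w)| <= 4 * K * s.
  move=> mZ.
  have mh := lip_measurable hK.
  have mhs := blip_measurable (tc_h tc).
  have [K' [M' [_ hsM]]] := tc_h tc.
  have mhZ : measurable_fun setT (fun w => h (Z w)) by exact: measurableT_comp.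
  have mhsZ : measurable_fun setT (fun w => hs (Z w)) by exact: measurableT_comp.
  rewrite -RintegralB//; last 2 first.
  - exact: (bounded_integrable _ _ (fun w => hM (Z w))).
  - exact: (bounded_integrable _ _ (fun w => hsM (Z w))).
  apply: abs_Rintegral_le => [|w]; first exact: measurable_funB.
  by rewrite distrC.
have mSX : measurable_fun setT (fun w => \sum_(i < n) X i w) by exact: measurable_sum.
have mSY : measurable_fun setT (fun w => \sum_(i < n) Y i w) by exact: measurable_sum.
have d1' := diff _ _ P1 _ mSX; have d2' := diff _ _ P2 _ mSY.
rewrite (_ : K * _ = 4 * K * s + n%:R * (B * (tau1 + tau2 + `|v1 - v2|)) + 4 * K * s); last first.
  by rewrite /B; ring.
move: d1' d2' sw; rewrite !ler_norml => /andP[? ?] /andP[? ?] /andP[? ?].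
by apply/andP; split; lra.
Qed.

End lindeberg.

(** * Image laws, rescaling and Gaussian moments *)

Section laws.
Context {R : realType}.

Lemma EFin_Rintegral d (T : measurableType d) (mu : {measure set T -> \bar R}) (f : T -> R) :
  mu.-integrable setT (EFin \o f) -> (\int[mu]_x (f x)%:E = (\int[mu]_x f x)%:E)%E.
Proof. by move=> fi; rewrite /Rintegral fineK//; exact: (integrable_fin_num _ fi). Qed.

Lemma integrable_addR d (T : measurableType d) (mu : {measure set T -> \bar R}) (f g : T -> R) :
  mu.-integrable setT (EFin \o f) ->
  mu.-integrable setT (EFin \o g) -> mu.-integrable setT (EFin \o (fun x => f x + g x)).
Proof. by move=> i1 i2; have := integrableD measurableT i1 i2; apply: eq_integrable. Qed.

Definition law d (T : measurableType d) (P : probability T R) (X : T -> R)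
    (mX : measurable_fun setT X) : probability R R :=
  distribution P (HB.pack_for {mfun T >-> R} X (isMeasurableFun.Build _ _ _ _ X mX)).

Lemma law_integrable d (T : measurableType d) (P : probability T R) (X : T -> R)
    (mX : measurable_fun setT X) (g : R -> R) : measurable_fun setT g ->
  P.-integrable setT (EFin \o (g \o X)) -> (law P mX).-integrable setT (EFin \o g).
Proof.
move=> mg gi; apply: (integrable_pushforward mX) => //.
exact/measurable_EFinP.
Qed.

Lemma Rintegral_law d (T : measurableType d) (P : probability T R) (X : T -> R)
    (mX : measurable_fun setT X) (g : R -> R) : measurable_fun setT g ->
  P.-integrable setT (EFin \o (g \o X)) ->
  \int[law P mX]_y g y = \int[P]_w g (X w).
Proof.
move=> mg gi; rewrite /Rintegral; congr fine.
rewrite integral_distribution//; exact/measurable_EFinP.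
Qed.

Lemma integrable_min23 (nu : probability R R) :
  nu.-integrable setT (EFin \o (fun y : R => y ^+ 2)) ->
  nu.-integrable setT (EFin \o min23).
Proof.
move=> i2; apply: (le_integrable measurableT _ _ i2).
  by apply/measurable_EFinP; exact: measurable_min23.
move=> y _; rewrite /= lee_fin ger0_norm ?min23_ge0// ger0_norm ?sqr_ge0//.
by rewrite ge_min lexx.
Qed.

Lemma centered_moments_scale (la : probability R R) v tau (c : R)
    (mc : measurable_fun setT (fun y : R => c * y)) :
  centered_moments la v tau ->
  centered_moments (law la mc) (c ^+ 2 * v) (\int[la]_y min23 (c * y)).
Proof.
move=> [i1 i2 m0 m2 _].
have j1 : la.-integrable setT (EFin \o (fun y => c * y)) by exact: (integrable_mulrR (f := id)).
have j2 : la.-integrable setT (EFin \o (fun y => (c * y) ^+ 2)).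
  rewrite (_ : (fun y => _) = (fun y => c ^+ 2 * y ^+ 2)).
    exact: (integrable_mulrR (f := fun y => y ^+ 2)).
  by apply/funext => y; rewrite exprMn.
have j3 : la.-integrable setT (EFin \o (min23 \o (fun y => c * y))).
  apply: (le_integrable measurableT _ _ j2).
    by apply/measurable_EFinP; apply: measurableT_comp => //; exact: measurable_min23.
  move=> y _; rewrite /= lee_fin ger0_norm ?min23_ge0// ger0_norm ?sqr_ge0//.
  by rewrite ge_min lexx.
split.
- exact: law_integrable.
- by apply: law_integrable => //; exact: measurable_funX.
- by rewrite (Rintegral_law mc (g := id))//= (RintegralZl _ _ i1)// m0 mulr0.
- have m2sq : measurable_fun setT (fun y : R => y ^+ 2) by exact: measurable_funX.
  rewrite (Rintegral_law mc m2sq j2)/=.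
  under eq_Rintegral do rewrite exprMn.
  by rewrite RintegralZl// m2.
- by rewrite Rintegral_law//; exact: measurable_min23.
Qed.

(** For [|c| <= 1 / (k + 1)], [min23 (c y) <= c^2 g k y], and the integrals of [g k] tend to 0 by
    dominated convergence, with [y^2] as the dominating function. *)
Lemma min23_scale_small (la : probability R R) :
  la.-integrable setT (EFin \o (fun y : R => y ^+ 2)) -> forall e, 0 < e ->
  exists2 c0, 0 < c0 & forall c, `|c| <= c0 -> \int[la]_y min23 (c * y) <= c ^+ 2 * e.
Proof.
move=> i2 e e0.
pose g (k : nat) (y : R) := Num.min (y ^+ 2) (`|y| ^+ 3 / k.+1%:R).
have g0 k y : 0 <= g k y by rewrite le_min sqr_ge0/= divr_ge0// exprn_ge0.
have mg k : measurable_fun setT (g k).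
  apply: measurable_minr; first exact: measurable_funX.
  by apply: measurable_funM => //; apply: measurable_funX; exact: normr_measurable.
have gi k : la.-integrable setT (EFin \o g k).
  apply: (le_integrable measurableT _ _ i2); first by apply/measurable_EFinP.
  by move=> y _; rewrite /= lee_fin ger0_norm// ger0_norm ?sqr_ge0// ge_min lexx.
have cvg0 : (\int[la]_y (g k y)%:E)%E @[k --> \oo] --> 0%E.
  rewrite -(@integral0 _ _ _ la setT).
  apply: (@dominated_cvg _ _ _ la setT measurableT _ (cst 0%E) (EFin \o (fun y => y ^+ 2))) => //.
  - by move=> k; apply/measurable_EFinP.
  - move=> y _; apply: cvg_EFin; first by near=> k.
    have lim0 : `|y| ^+ 3 * k.+1%:R^-1 @[k --> \oo] --> (0 : R).
      by rewrite -(mulr0 (`|y| ^+ 3)); apply: cvgMr; exact: cvg_harmonic.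
    apply: (squeeze_cvgr _ (cvg_cst 0) lim0).
    by near=> k; rewrite /= g0/= ge_min lexx orbT.
  - by move=> k y _; rewrite /= lee_fin ger0_norm// ge_min lexx.
have /fine_cvgP[_ /cvgrPdist_le /(_ _ e0)[k _ /(_ k (leqnn k))]] := cvg0.
rewrite /= sub0r normrN -/(Rintegral _ _ _) => ge.
exists k.+1%:R^-1 => // c ck.
have i3 : la.-integrable setT (EFin \o (fun y => min23 (c * y))).
  have j2 : la.-integrable setT (EFin \o (fun y => c ^+ 2 * y ^+ 2)).
    exact: (integrable_mulrR (f := fun y => y ^+ 2)).
  apply: (le_integrable measurableT _ _ j2).
    apply/measurable_EFinP; apply: measurableT_comp => //; exact: measurable_min23.
  move=> y _; rewrite /= lee_fin ger0_norm ?min23_ge0// ger0_norm.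
    by rewrite -exprMn ge_min lexx.
  by rewrite mulr_ge0 ?sqr_ge0.
apply: le_trans (ler_wpM2l (sqr_ge0 c) (le_trans (ler_norm _) ge)).
have gi2 := integrable_mulrR (c ^+ 2) (gi k).
rewrite -(RintegralZl (c ^+ 2) measurableT (gi k)); apply: (le_Rintegral measurableT i3 gi2).
move=> y _; rewrite /g minr_pMr ?sqr_ge0// /min23 exprMn le_min ge_min lexx/=.
rewrite ge_min; apply/orP; right.
rewrite normrM exprMn (_ : `|c| ^+ 3 = c ^+ 2 * `|c|); last first.
  by rewrite exprSr real_normK ?num_real.
rewrite -mulrA; apply: ler_wpM2l; first exact: sqr_ge0.
by rewrite mulrC; apply: ler_wpM2l => //; exact: exprn_ge0.
Unshelve. all: by end_near. Qed.

Lemma measurable_idR : measurable_fun [set: measurableTypeR R] (id : measurableTypeR R -> R).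
Proof. by move=> _ B mB; rewrite setTI. Qed.

(* [normal_prob] is a measure on [measurableTypeR R], whose display differs from
   the one of the canonical measurable structure of [R]. *)
Definition gaussian (s : R) : probability R R :=
  law (normal_prob 0 s : probability (measurableTypeR R) R) measurable_idR.

Lemma ge0_integral_gaussian (s : R) (f : R -> \bar R) : measurable_fun setT f ->
  (forall x, (0 <= f x)%E) ->
  (\int[gaussian s]_x f x = \int[normal_prob 0 s]_x f x)%E.
Proof. by move=> mf f0; rewrite /gaussian /law ge0_integral_distribution. Qed.

Lemma gaussian_moment2 (s : R) : 0 < s ->
  (\int[gaussian s]_x (x ^+ 2)%:E = (s ^+ 2)%:E)%E.
Proof.
move=> s0; rewrite ge0_integral_gaussian ?normal_prob_moment2//.
  by apply/measurable_EFinP; exact: measurable_funX.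
by move=> x; rewrite lee_fin sqr_ge0.
Qed.

Lemma gaussian_moment4 (s : R) : 0 < s ->
  (\int[gaussian s]_x (x ^+ 4)%:E = (3 * s ^+ 4)%:E)%E.
Proof.
move=> s0; rewrite ge0_integral_gaussian ?normal_prob_moment4//.
  by apply/measurable_EFinP; exact: measurable_funX.
by move=> x; rewrite lee_fin exprn_even_ge0.
Qed.

Lemma gaussian_centered_moments (s : R) : 0 < s ->
  centered_moments (gaussian s) (s ^+ 2) (2 * s ^+ 3).
Proof.
move=> s0; pose N := gaussian s.
have moment2 := gaussian_moment2 s0; have moment4 := gaussian_moment4 s0.
have int_of (k : nat) r : ~~ odd k -> (\int[N]_x (x ^+ k)%:E = r%:E)%E ->
    N.-integrable setT (EFin \o (fun x => x ^+ k)).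
  move=> ek E; apply/integrableP; split.
    by apply/measurable_EFinP; exact: measurable_funX.
  under eq_integral do rewrite /= ger0_norm ?exprn_even_ge0//.
  by rewrite E ltry.
have i2 := int_of 2 _ isT moment2.
have i4 := int_of 4 _ isT moment4.
have i1 : N.-integrable setT (EFin : R -> \bar R).
  have i12 := integrable_addR (finite_measure_integrable_cst N 1 measurableT) i2.
  apply: (le_integrable measurableT _ _ i12); first by apply/measurable_EFinP.
  move=> y _; rewrite /= lee_fin [X in _ <= X]ger0_norm ?addr_ge0 ?sqr_ge0//.
  have yy : `|y| ^+ 2 = y ^+ 2 by rewrite real_normK ?num_real.
  have := sqr_ge0 (`|y| - 1); have := normr_ge0 y; rewrite sqrrB1 yy mulr2n /cst/=.
  by lra.
split => //.
- rewrite (Rintegral_law measurable_idR (g := id))//; first exact: normal_prob_mean.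
  apply/integrableP; split; first by apply/measurable_EFinP; exact: measurable_idR.
  move/integrableP : i1 => [_]; rewrite ge0_integral_gaussian//.
  by apply/measurable_EFinP; exact: normr_measurable.
- by rewrite /Rintegral moment2.
(* The cubic moment is bounded by [z^3 <= s z^2 / 2 + z^4 / (2 s)], a completed square; the moments
   [s^2] and [3 s^4] then add up to [2 s^3]. *)
have ib : N.-integrable setT (EFin \o (fun y => s / 2 * y ^+ 2 + (2 * s)^-1 * y ^+ 4)).
  by apply: integrable_addR; apply: (integrable_mulrR (f := fun y => y ^+ _)).
apply: (@le_trans _ _ (\int[N]_y (s / 2 * y ^+ 2 + (2 * s)^-1 * y ^+ 4))).
  apply: le_Rintegral => //; first exact: integrable_min23.
  move=> y _; rewrite ge_min; apply/orP; right.
  have e2 : y ^+ 2 = `|y| ^+ 2 by rewrite real_normK ?num_real.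
  have e4 : y ^+ 4 = `|y| ^+ 4 by rewrite (_ : 4%N = (2 * 2)%N)// !exprM e2.
  rewrite e2 e4; move: `|y| (normr_ge0 y) => z z0; rewrite -subr_ge0.
  have sn0 := lt0r_neq0 s0.
  have -> : s / 2 * z ^+ 2 + (2 * s)^-1 * z ^+ 4 - z ^+ 3 = z ^+ 2 * ((s - z) ^+ 2 / (2 * s)) by field.
  by rewrite mulr_ge0 ?sqr_ge0// divr_ge0 ?sqr_ge0// mulr_ge0// ltW.
have j2 := integrable_mulrR (s / 2) i2.
have j4 := integrable_mulrR (2 * s)^-1 i4.
rewrite RintegralD// !RintegralZl// /Rintegral moment2 moment4/=.
have sn0 := lt0r_neq0 s0.
by rewrite le_eqVlt; apply/orP; left; apply/eqP; field.
Qed.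

End laws.

(** * Maximal inequality *)

Lemma big_shift_ord (A : Type) (idx : A) (op : A -> A -> A) a n (F : nat -> A) :
  \big[op/idx]_(a <= i < a + n) F i = \big[op/idx]_(i < n) F (a + i)%N.
Proof.
rewrite -{1}[a]add0n big_addn addKn big_mkord.
by apply: eq_bigr => i _; rewrite addnC.
Qed.

Section partial_sums.
Context {d : measure_display} {T : measurableType d} {R : realType} (P : probability T R).
Variable X : nat -> T -> R.
Hypothesis mX : forall i, measurable_fun setT (X i).

Lemma measurable_partial lo hi : measurable_fun setT (fun w => \sum_(lo <= i < hi) X i w).
Proof. exact: measurable_sum. Qed.

Definition dev lo hi (l : R) : set T := [set w | l <= `|\sum_(lo <= i < hi) X i w|].

Lemma measurable_dev lo hi (l : R) : measurable (dev lo hi l).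
Proof.
have m : measurable_fun setT (fun w => `|\sum_(lo <= i < hi) X i w|).
  by apply: measurableT_comp => //; exact: measurable_partial.
rewrite (_ : dev _ _ _ = (fun w => `|\sum_(lo <= i < hi) X i w|) @^-1` `[l, +oo[%classic).
  by rewrite -[_ @^-1` _]setTI; exact: m.
by apply/seteqP; split => w /=; rewrite in_itv/= andbT.
Qed.

Lemma indep_shift a n : indep_fin P (a + n) X -> indep_fin P n (fun i => X (a + i)%N).
Proof.
move=> iX B mB.
pose C i := B (i - a)%N.
have := @indep_cylinder_prod _ _ _ P X (a + n) a (a + n) C iX (leqnn _) (fun i => mB _).
rewrite !big_shift_ord /C.
rewrite [X in P X = _ -> _](_ : _ = \big[setI/setT]_(i < n) (X (a + i)%N @^-1` B i)).
  rewrite [X in _ = X -> _](_ : _ = (\prod_(i < n) P (X (a + i)%N @^-1` B i))%E)//.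
  by apply: eq_bigr => i _; rewrite addKn.
by apply: eq_bigr => i _; rewrite addKn.
Qed.

(** The square is nonnegative but not bounded, so the last term is peeled off with Tonelli's theorem
    rather than with [indep_peel]; the cross term vanishes after integrating the centered
    variable. *)
Lemma sum_second_moment (nu : nat -> probability R R) v (tau : nat -> R) n :
  indep_fin P n X ->
  (forall i B, (i < n)%N -> measurable B -> P (X i @^-1` B) = nu i B) ->
  (forall i, centered_moments (nu i) v (tau i)) ->
  (\int[P]_w ((\sum_(0 <= i < n) X i w) ^+ 2)%:E = (n%:R * v)%:E)%E.
Proof.
move=> + + mom; elim: n => [|n IH] iX lX.
  rewrite (eq_integral (cst 0%E)); last by move=> w _; rewrite big_geq// expr0n.
  by rewrite integral0 mul0r.
pose T1 := g_sigma_algebraType (cylinder X 0 n).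
pose f (z : T1 * R) := (((\sum_(0 <= i < n) X i z.1) + z.2) ^+ 2)%:E.
have mS : measurable_fun [set: T1] (fun w : T1 => \sum_(0 <= i < n) X i w).
  under eq_fun do rewrite big_mkord.
  by apply: measurable_sum => i; apply: cylinder_coord; rewrite leq0n/=.
have mf : measurable_fun setT f.
  apply/measurable_EFinP; apply: measurable_funX; apply: measurable_funD => //.
  exact: (measurableT_comp mS).
have mid : measurable_fun [set: T] (fun w => w : T1).
  move=> _ A mA; rewrite setTI; exact: sub_cylinder_sigma mA.
have ind (A : set T1) (B : set R) : measurable A -> measurable B ->
    (P ((fun w => w : T1) @^-1` A `&` X n @^-1` B) = P ((fun w => w : T1) @^-1` A) * nu n B)%E.
  move=> mA mB; rewrite (_ : _ @^-1` A = A)// -lX//.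
  apply: (indep_cylinder (lo := 0) (mid := n) iX mX) => //.
  by apply: sub_sigma_algebra; exists (fun=> B) => //; rewrite big_nat1.
have := @indep_tonelli _ _ _ T T1 R R P (nu n) (fun w => w : T1) (X n) mid (mX n) ind f mf.
move=> /(_ (fun z => _)) tonelli.
under eq_integral do rewrite big_nat_recr//=.
rewrite (tonelli _)//; last by move=> z; rewrite lee_fin sqr_ge0.
have [i1 i2 m0 m2 _] := mom n.
have E a : (\int[nu n]_y ((a + y) ^+ 2)%:E = (a ^+ 2)%:E + v%:E)%E.
  have j1 : (nu n).-integrable setT (EFin \o (fun y => a *+ 2 * y)).
    exact: (integrable_mulrR (f := id)).
  have ja : (nu n).-integrable setT (EFin \o cst (a ^+ 2)).
    exact: finite_measure_integrable_cst.
  have j2 := integrable_addR ja j1.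
  have j3 := integrable_addR j2 i2.
  under eq_integral do rewrite sqrrD -mulrnAl.
  rewrite EFin_Rintegral// RintegralD// RintegralD// Rintegral_prob_cst RintegralZl//.
  by rewrite m0 m2 mulr0 addr0.
under eq_integral do rewrite /f /= E.
have mS2 : measurable_fun setT (fun w => ((\sum_(0 <= i < n) X i w) ^+ 2)%:E).
  by apply/measurable_EFinP; apply: measurable_funX; exact: measurable_partial.
have v0 : 0 <= v by rewrite -m2; apply: Rintegral_ge0 => y _; exact: sqr_ge0.
rewrite ge0_integralD//; last first.
  by move=> w _; rewrite lee_fin sqr_ge0.
rewrite IH; last 2 first.
- exact: indep_finS iX.
- by move=> i B ilt; apply: lX; rewrite ltnW.
rewrite integral_cst//.
rewrite [X in (_ + _ * X)%E](_ : _ = 1%E); last exact: probability_setT.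
by rewrite mule1 -EFinD -[n.+1]addn1 natrD mulrDl mul1r.
Qed.

Lemma chebyshev_sum (nu : nat -> probability R R) v (tau : nat -> R) n (l : R) : 0 < l ->
  indep_fin P n X ->
  (forall i B, (i < n)%N -> measurable B -> P (X i @^-1` B) = nu i B) ->
  (forall i, centered_moments (nu i) v (tau i)) ->
  (P (dev 0 n l) <= (n%:R * v / l ^+ 2)%:E)%E.
Proof.
move=> l0 iX lX mom; rewrite EFinM -(sum_second_moment iX lX mom).
rewrite muleC -[X in (X <= _)%E]mul1e -(_ : ((l ^+ 2)^-1%:E * (l ^+ 2)%:E = 1)%E); last first.
  by rewrite -EFinM mulVf// gt_eqF// exprn_gt0.
rewrite -muleA; apply: lee_wpmul2l; first by rewrite lee_fin invr_ge0 sqr_ge0.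
have mD := measurable_dev 0 n l.
rewrite -[X in (_ * P X)%E]setIT -integral_indic// -ge0_integralZl//=.
- apply: le_integralT => w; rewrite -EFinM lee_fin indicE.
  case: (boolP (_ \in _)) => [|_]; last by rewrite mulr0 sqr_ge0.
  rewrite inE/= mulr1 => lw; rewrite -[X in _ <= X]real_normK ?num_real//.
  by rewrite lerXn2r// nnegrE// ltW.
- by apply/measurable_EFinP; exact: measurable_indic.
- by rewrite lee_fin sqr_ge0.
Qed.

(** Decomposition at the first index [k] where the sum reaches [2 l]. This event [E k] is
    independent of the remaining sum, which stays below [l] with probability at least 1/2; on the
    intersection the full sum exceeds [l], and the intersections are disjoint. *)
Lemma ottaviani n (l : R) : indep_fin P n X ->
  (forall k, (k <= n)%N -> (P (dev k n l) <= 2^-1%:E)%E) ->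
  (P (\big[setU/set0]_(k < n.+1) dev 0 k (2 * l)) <= 2%:E * P (dev 0 n l))%E.
Proof.
move=> iX small.
pose D k := dev 0 k (2 * l).
pose E k := D k `\` \big[setU/set0]_(j < k) D j.
pose F k := dev k n l.
have mD k : measurable (D k) by exact: measurable_dev.
have mDk k : <<s cylinder X 0 k >> (D k).
  have m : measurable_fun [set: g_sigma_algebraType (cylinder X 0 k)] (fun w => `|\sum_(0 <= i < k) X i w|).
    apply: measurableT_comp => //.
    under eq_fun do rewrite big_mkord.
    by apply: measurable_sum => i; apply: cylinder_coord; rewrite leq0n/=.
  have := m measurableT `[2 * l, +oo[%classic; rewrite setTI.
  rewrite (_ : _ @^-1` _ = D k); first by apply; exact: measurable_itv.
  by apply/seteqP; split => w /=; rewrite in_itv/= andbT.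
have sub_cyl j k : (j <= k)%N -> <<s cylinder X 0 j >> `<=` <<s cylinder X 0 k >>.
  move=> jk; apply: smallest_sub; first exact: smallest_sigma_algebra.
  move=> _ [B mB ->]; apply: sub_sigma_algebra.
  exists (fun i => if (i < j)%N then B i else setT); first by move=> i; case: ifP.
  rewrite (@big_cat_nat _ _ _ j 0 k)//=.
  rewrite [X in _ = _ `&` X](_ : _ = setT); last first.
    by rewrite big_nat big1// => i /andP[ji _]; rewrite ltnNge ji preimage_setT.
  by rewrite setIT; apply: eq_big_nat => i /andP[_ ->].
have mE k : <<s cylinder X 0 k >> (E k).
  apply: (@measurableD _ (g_sigma_algebraType (cylinder X 0 k))); first exact: mDk.
  apply: (big_ind (<<s cylinder X 0 k >>)).
  - exact: (@measurable0 _ (g_sigma_algebraType (cylinder X 0 k))).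
  - exact: (@measurableU _ (g_sigma_algebraType (cylinder X 0 k))).
  - by move=> j _; apply: sub_cyl (mDk j); exact: ltnW.
have mF k : measurable (~` F k) by apply: measurableC; exact: measurable_dev.
have mFc k : (k <= n)%N -> <<s cylinder X k n >> (~` F k).
  move=> kn.
  apply: (@measurableC _ (g_sigma_algebraType (cylinder X k n))).
  have m : measurable_fun [set: g_sigma_algebraType (cylinder X k n)]
      (fun w => `|\sum_(k <= i < n) X i w|).
    apply: measurableT_comp => //.
    rewrite (_ : (fun w => _) = (fun w => \sum_(i < n - k) X (i + k)%N w)).
      apply: measurable_sum => i; apply: cylinder_coord; rewrite leq_addl/=.
      by rewrite -ltn_subRL; have := ltn_ord i; lia.
    by apply/funext => w; rewrite -{1}(add0n k) big_addn big_mkord.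
  have := m measurableT `[l, +oo[%classic; rewrite setTI.
  rewrite (_ : _ @^-1` _ = F k); first by apply; exact: measurable_itv.
  by apply/seteqP; split => w /=; rewrite in_itv/= andbT.
have mET k : measurable (E k) by exact: (sub_cylinder_sigma mX (mE k)).
have tE : trivIset setT E by exact: trivIset_seqDU.
have PE k : (k <= n)%N -> (P (E k) <= 2%:E * P (E k `&` ~` F k))%E.
  move=> kn; rewrite (indep_cylinder (lo := 0) (mid := k) iX mX _ kn _ (mE k) (mFc k kn))//.
  rewrite muleCA -[X in (X <= _)%E]mule1; apply: lee_wpmul2l => //.
  rewrite probability_setC; last exact: measurable_dev.
  have := small k kn; rewrite -/(F k).
  have : P (F k) \is a fin_num by apply: fin_num_measure; exact: measurable_dev.
  by case: (P (F k)) => // r _; rewrite -EFinB -EFinM !lee_fin; lra.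
have -> : \big[setU/set0]_(k < n.+1) dev 0 k (2 * l) = \big[setU/set0]_(k < n.+1) E k.
  by rewrite (bigsetU_seqDU D n.+1).
apply: le_trans (le_mu_bigsetU _ (fun k _ => mET k)) _.
apply: le_trans (_ : _ <= \sum_(k < n.+1) (2%:E * P (E k `&` ~` F k)))%E _.
  by apply: lee_sum => k _; apply: PE; rewrite -ltnS.
rewrite -ge0_sume_distrr//; apply: lee_wpmul2l => //.
have mEF k : measurable (E k `&` ~` F k) by exact: measurableI.
have tEF : trivIset setT (fun k => E k `&` ~` F k).
  by move=> i j _ _ [w [[Ei _] [Ej _]]]; apply: tE => //; exists w.
have := measure_bigsetU P mEF tEF n.+1 => /esym/eqP.
rewrite eq_le => /andP[+ _]; move/le_trans; apply.
apply: le_measure; rewrite ?inE.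
- by apply: bigsetU_measurable => k _; exact: measurableI.
- exact: measurable_dev.
move=> w; rewrite -(bigcup_mkord n.+1 (fun k => E k `&` ~` F k)) => -[k /= kn [[Dk _] /= /negP Fk]].
move: Dk Fk; rewrite /D /F /dev/= -ltNge => Dk Fk.
rewrite (@big_cat_nat _ _ _ k 0 n)//=.
set a := \sum_(0 <= i < k) _ in Dk *; set b := \sum_(k <= i < n) _ in Fk *.
have := ler_normB (a + b) b; rewrite addrK; move: Dk Fk; lra.
Qed.

End partial_sums.

(** * Paths of the process *)

Section path.
Context {d : measure_display} {T : measurableType d} {R : realType}.
Variables (U : nat -> T -> R) (w : T).
Hypothesis U0 : forall k, 0 <= U k w.
Local Notation S := (fun k => partial_sum U k w).
Local Notation mu := (@lebesgue_measure R).

Lemma partial_sumS k : partial_sum U k.+1 w = partial_sum U k w + U k w.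
Proof. by rewrite /partial_sum big_ord_recr. Qed.

Lemma partial_sum_nd j k : (j <= k)%N -> S j <= S k.
Proof.
move=> jk; rewrite -(subnK jk) addnC; elim: (k - j)%N => [|i IH]; first by rewrite addn0.
by rewrite addnS partial_sumS (le_trans IH)// lerDl.
Qed.

Lemma partial_sum_ge0 k : 0 <= S k.
Proof. by rewrite /partial_sum sumr_ge0. Qed.

(** The series starts at index 1, so exactly the terms 1 to [k] equal 1, and the sign on this
    interval is [(-1)^k]. *)
Lemma renewal_count k (v : R) : S k <= v -> v < S k.+1 -> renewal U w v = (k%:R)%:E.
Proof.
move=> Skv vSk; rewrite /renewal (@nneseries_split _ _ 1 k); last first.
  by move=> j _; rewrite lee_fin indicE.
rewrite [X in (_ + X)%E]eseries0 ?adde0; last first.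
  move=> j kj _; rewrite indicE memNset//= in_itv/= => /andP[_].
  apply/negP; rewrite -ltNge; apply: lt_le_trans vSk _.
  by apply: partial_sum_nd.
rewrite (eq_big_nat _ _ (F2 := fun=> 1%E)); last first.
  move=> j /andP[j1 jk]; rewrite indicE mem_set//= in_itv/= partial_sum_ge0/=.
  by apply: le_trans Skv; apply: partial_sum_nd; rewrite -ltnS.
by rewrite sumEFin sumr_const_nat addKn.
Qed.

Definition gsign (u : R) : R := sgn_pow (renewal U w u).

Lemma gsign_itv k v : S k <= v -> v < S k.+1 -> gsign v = (-1) ^+ k.
Proof. by move=> h1 h2; rewrite /gsign (renewal_count h1 h2)/= natrK. Qed.

Lemma gsign_norm v : `|gsign v| <= 1.
Proof.
by rewrite /gsign; case: (renewal U w v) => [r| |] /=; rewrite ?normrX ?normrN1 ?expr1n ?normr1.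
Qed.

Lemma measurable_gsign : measurable_fun setT gsign.
Proof.
have -> : gsign = (fun m : nat => (-1) ^+ m : R) \o
    (fun v => Num.truncn (fine (renewal U w v))).
  (* At infinite values [fine] returns 0, whose sign [(-1)^0] agrees with the default 1 of
     [sgn_pow]. *)
  apply/funext => v; rewrite /gsign/=; case: (renewal U w v) => [r| |]//=;
  by rewrite (_ : Num.truncn 0 = 0)// -[0]/(0%:R) natrK.
have mr : measurable_fun setT (fun v => fine (renewal U w v)).
  apply: measurableT_comp => //; rewrite /renewal.
  under eq_fun do rewrite eseries_cond.
  apply: (@ge0_emeasurable_sum _ _ _ _ _ (fun i => true && (1 <= i)%N)) => //.
  move=> k _; apply/measurable_EFinP.
  rewrite (_ : (fun v : R => _) = \1_(`[S k, +oo[%classic)).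
    exact: measurable_indic.
  by apply/funext => v; rewrite !indicE !mem_setE !in_itv/= partial_sum_ge0 andbT.
apply: measurable_countable_range => m.
rewrite (_ : _ @^-1` _ = (fun v => fine (renewal U w v)) @^-1` (Num.truncn @^-1` [set m])) //.
rewrite -[X in measurable X]setTI; apply: mr => //.
have [->|m0] := posnP m.
  rewrite (_ : _ @^-1` _ = `]-oo, 1%R[%classic); first exact: measurable_itv.
  apply/seteqP; split => x /=; rewrite in_itv/=.
    by move=> /truncn0Pn; rewrite -ltNge.
  by move=> ?; apply/truncn0Pn; rewrite -ltNge.
rewrite (_ : _ @^-1` _ = `[m%:R, m.+1%:R[%classic); first exact: measurable_itv.
apply/seteqP; split => x /=; rewrite in_itv/=.
  move=> xm; rewrite -xm; apply: truncn_itv.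
  by move: m0; rewrite -xm truncn_gt0; apply: le_trans.
exact: truncn_def.
Qed.

Variable n : nat.
Hypothesis n0 : (0 < n)%N.
Let g u := gsign (n%:R * u).
Let npos : (0 : R) < n%:R. Proof. by rewrite ltr0n. Qed.

Let mg : measurable_fun setT g.
Proof.
apply: measurableT_comp; first exact: measurable_gsign.
by apply: measurable_funM.
Qed.

Let gi (a b : R) : mu.-integrable `[a, b] (EFin \o g).
Proof.
apply: measurable_bounded_integrable => //.
- by rewrite /= lebesgue_measure_itv/=; case: ifP => // _; rewrite -EFinB ltry.
- exact: measurable_funTS.
- exists 1; split; first exact: num_real.
  by move=> x x1 y _; apply: le_trans (ltW x1); exact: gsign_norm.
Qed.

(** Both inequalities are large: the formula for [k] remains valid at the renewal time [S k.+1], and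
    this value starts the next piece in the induction. Vanishing [U k w] are thereby included. *)
Lemma integral_gsign k (x : R) : S k <= n%:R * x -> n%:R * x <= S k.+1 ->
  \int[mu]_(u in `[0, x]) g u =
    (\sum_(j < k) (-1) ^+ j * U j w + (-1) ^+ k * (n%:R * x - S k)) / n%:R.
Proof.
move: k x; have step k (x : R) : S k <= n%:R * x -> n%:R * x <= S k.+1 ->
    \int[mu]_(u in `]S k / n%:R, x]) g u = (-1) ^+ k * (n%:R * x - S k) / n%:R.
  move=> Skx xSk; have ax : S k / n%:R <= x by rewrite ler_pdivrMr// mulrC.
  have gj : mu.-integrable `]S k / n%:R, x[ (EFin \o g).
    apply: integrableS (gi (S k / n%:R) x) => //.
    by apply: subset_itv; rewrite bnd_simp.
  rewrite -Rintegral_itv_bndo_bndc//.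
  rewrite (@eq_Rintegral _ _ _ _ _ (fun=> (-1) ^+ k)); last first.
    move=> u; rewrite inE/= in_itv/= => /andP[ku ux]; apply: gsign_itv.
      by move: ku; rewrite ltr_pdivrMr// mulrC => /ltW.
    by apply: lt_le_trans xSk; rewrite ltr_pM2l.
  rewrite Rintegral_cst// -mulrA; congr (_ * _).
  rewrite [X in fine X](lebesgue_measure_itv (Interval (BRight (S k / n%:R)) (BLeft x))).
  rewrite /= lte_fin; case: ltP => [_|xa].
    by rewrite -EFinB/= mulrBl [n%:R * x]mulrC mulfK// gt_eqF.
  have <- : S k / n%:R = x by apply/eqP; rewrite eq_le ax xa.
  by rewrite [n%:R * _]mulrC divfK ?gt_eqF// subrr mul0r.
elim=> [|k IH] x Skx xSk.
  have x0 : 0 <= x by move: Skx; rewrite /partial_sum big_ord0 pmulr_rge0.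
  have := step 0%N x Skx xSk; rewrite /partial_sum !big_ord0 mul0r add0r => <-.
  rewrite Rintegral_itv_obnd_cbnd//; apply: integrableS (gi 0 x) => //.
  by apply: subset_itv; rewrite bnd_simp.
set a := S k.+1 / n%:R.
have ax : a <= x by rewrite ler_pdivrMr// mulrC.
have a0 : 0 <= a by rewrite divr_ge0// partial_sum_ge0.
have na : n%:R * a = S k.+1 by rewrite mulrC divfK// gt_eqF.
have := @Rintegral_itvB R g (BLeft 0) (BRight x) a (gi 0 x).
rewrite !bnd_simp => /(_ a0 ax) /eqP; rewrite subr_eq => /eqP ->.
rewrite step// IH ?na//; last exact: partial_sum_nd.
rewrite big_ord_recr/= [X in (-1) ^+ k * (X - _)]partial_sumS; field.
by rewrite gt_eqF.
Qed.

Lemma Xproc_val (C : R) k (t : R) : S k <= n%:R * t -> n%:R * t <= S k.+1 ->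
  Xproc C U n w t = C / Num.sqrt n%:R *
    (\sum_(j < k) (-1) ^+ j * U j w + (-1) ^+ k * (n%:R * t - S k)).
Proof.
move=> Skt tSk; rewrite /Xproc -/(gsign _).
have -> : \int[mu]_(u in `[0, t]) sgn_pow (renewal U w (n%:R * u)) = \int[mu]_(u in `[0, t]) g u by [].
rewrite (integral_gsign Skt tSk).
have sn : Num.sqrt n%:R != 0 :> R by rewrite sqrtr_eq0 -ltNge.
by rewrite -[X in _ / X](sqr_sqrtr (ltW npos)); field.
Qed.

Lemma continuous_Xproc (C : R) : cont01 (Xproc C U n w).
Proof.
have := @parameterized_integral_continuous R 0 1 g ler01 (gi 0 1).
by move=> cI x; apply: cvgM; [exact: cvg_cst|exact: cI].
Qed.

End path.

(** * Polygonal lines *)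

Section polygon.
Context {R : realType}.

Definition ramp (u : R) := Num.min 1 (Num.max 0 u).

Lemma ramp_itv u : 0 <= ramp u <= 1.
Proof. by rewrite /ramp le_min ge_min lexx andbT ler01 le_max lexx. Qed.

Lemma ramp0 u : u <= 0 -> ramp u = 0.
Proof. by move=> u0; rewrite /ramp max_l// min_r. Qed.

Lemma ramp1 u : 1 <= u -> ramp u = 1.
Proof. by move=> u1; rewrite /ramp max_r ?min_l// (le_trans _ u1). Qed.

Definition polyline (m : nat) (s : seq R) (t : R) := \sum_(l < m) s`_l * ramp (m%:R * t - l%:R).

Lemma polyline_cell m s i t : (i < m)%N -> i%:R <= m%:R * t -> m%:R * t <= i.+1%:R ->
  polyline m s t = \sum_(l < i) s`_l + s`_i * ramp (m%:R * t - i%:R).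
Proof.
move=> im it ti; rewrite /polyline -(big_mkord xpredT (fun l => s`_l * ramp (m%:R * t - l%:R))).
rewrite (@big_cat_nat _ _ _ i 0 m)//=; last exact: ltnW.
congr (_ + _).
  rewrite big_mkord; apply: eq_bigr => l _; rewrite ramp1 ?mulr1// lerBrDr.
  by apply: le_trans it; rewrite addrC natr1 ler_nat.
rewrite big_ltn// big_nat big1 ?addr0// => l /andP[il _].
by rewrite ramp0 ?mulr0// subr_le0 (le_trans ti)// ler_nat.
Qed.

Lemma polyline_lip m s s' t : `|polyline m s t - polyline m s' t| <= \sum_(l < m) `|s`_l - s'`_l|.
Proof.
rewrite /polyline -sumrB; apply: le_trans (ler_norm_sum _ _ _) _; apply: ler_sum => l _.
have /andP[r0 r1] := ramp_itv (m%:R * t - l%:R).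
by rewrite -mulrBl normrM (ger0_norm r0) ler_piMr.
Qed.

Lemma ramp_lip u v : `|ramp u - ramp v| <= `|u - v|.
Proof.
rewrite /ramp /Num.max; case: (ltP 0 u) => ?; case: (ltP 0 v) => ?;
  rewrite /Num.min; do ![case: ifPn; rewrite -?leNgt => ?];
  by rewrite ler_norml; have := ler_norm (u - v); have := ler_norm (v - u);
    rewrite [`|v - u|]distrC => ? ?; apply/andP; split; lra.
Qed.

Lemma continuous_polyline m s : continuous (polyline m s).
Proof.
apply: (@lip_continuous _ _ (\sum_(l < m) `|s`_l| * m%:R)).
  by apply: sumr_ge0 => l _; rewrite mulr_ge0.
move=> t t'; rewrite /polyline -sumrB mulr_suml; apply: le_trans (ler_norm_sum _ _ _) _.
apply: ler_sum => l _; rewrite -mulrBr normrM -mulrA; apply: ler_wpM2l => //.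
apply: le_trans (ramp_lip _ _) _.
rewrite (_ : m%:R * t - l%:R - (m%:R * t' - l%:R) = m%:R * (t - t')); last by ring.
by rewrite normrM ger0_norm.
Qed.

Lemma cont01_polyline m s : cont01 (polyline m s).
Proof. exact: continuous_subspaceT (@continuous_polyline m s). Qed.

Lemma cell_exists m (t : R) : (0 < m)%N -> 0 <= t <= 1 ->
  exists2 i, (i < m)%N & i%:R <= m%:R * t <= i.+1%:R.
Proof.
move=> m0 /andP[t0 t1]; have m0' : (0 : R) < m%:R by rewrite ltr0n.
have mt0 : 0 <= m%:R * t by rewrite mulr_ge0.
have /andP[h1 h2] := truncn_itv mt0.
have [lt|ge] := ltnP (Num.truncn (m%:R * t)) m.
  by exists (Num.truncn (m%:R * t)); rewrite // h1/= ltW.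
exists m.-1; first by rewrite prednK.
have -> : m%:R * t = m%:R.
  apply/eqP; rewrite eq_le; apply/andP; split; first by rewrite ler_piMr.
  by apply: le_trans h1; rewrite ler_nat.
by rewrite prednK// lexx ler_nat leq_pred.
Qed.

End polygon.

(** * Uniform distance between a path and its polyline *)

Section path_close.
Context {d : measure_display} {T : measurableType d} {R : realType}.
Variables (U : nat -> T -> R) (w : T).
Hypothesis U0 : forall k, 0 <= U k w.
Local Notation S := (fun k => partial_sum U k w).

Lemma cell_partial_sum K (v : R) : 0 <= v -> v < S K -> exists2 k, (k < K)%N & S k <= v < S k.+1.
Proof.
move=> v0; elim: K => [|K IH]; first by rewrite /partial_sum big_ord0 ltNge v0.
move=> vK; have [/IH[k kK kv]|Kv] := ltP v (S K).
  by exists k => //; rewrite ltnS ltnW.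
by exists K => //; rewrite Kv.
Qed.

Variables (mu : R).
Hypothesis mu0 : 0 < mu.
Let Z k := \sum_(j < k) (-1) ^+ j * U j w.
Let Zc k := \sum_(j < k) (-1) ^+ j * (U j w - mu).

(** The alternating partial sums of the constant [mu] take only the values 0 and [mu]. *)
Let Z_Zc k : `|Z k - Zc k| <= mu.
Proof.
have -> : Z k - Zc k = (odd k)%:R * mu.
  elim: k => [|k IH]; first by rewrite /Z /Zc !big_ord0 subrr mul0r.
  rewrite /Z /Zc !big_ord_recr/= (_ : _ - _ = (Z k - Zc k) + (-1) ^+ k * mu); last first.
    by rewrite /Z /Zc; ring.
  by rewrite IH -signr_odd; case: (odd k); rewrite /= ?expr1 ?expr0; ring.
rewrite normrM (ger0_norm (ltW mu0)); apply: ler_piMl; first exact: ltW.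
by case: (odd k); rewrite /= ?normr1 ?normr0.
Qed.

Let convex_norm (x y z th B : R) : 0 <= th <= 1 -> z = x + th * (y - x) ->
  `|x| <= B -> `|y| <= B -> `|z| <= B.
Proof.
move=> /andP[t0 t1] -> xB yB; have t1' : 0 <= 1 - th by rewrite subr_ge0.
rewrite (_ : x + _ = (1 - th) * x + th * y); last by ring.
rewrite (_ : B = (1 - th) * B + th * B); last by ring.
apply: le_trans (ler_normD _ _) _; rewrite !normrM (ger0_norm t0) (ger0_norm t1').
by apply: lerD; apply: ler_wpM2l.
Qed.

Variables (n N m : nat) (C eps : R).
Hypothesis n0 : (0 < n)%N.
Hypothesis m0 : (0 < m)%N.
Hypothesis C0 : 0 < C.
Local Notation c := (C / Num.sqrt n%:R).
Local Notation q := (n%:R / (m%:R * mu)).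
Hypothesis Nq : N%:R <= q.
Hypothesis qN : q <= N.+1%:R.
Hypothesis Nbig : (2 * m + 4 <= N)%N.
(** The tolerance is half of the mean duration [q * mu = n / m] of a block. For [t] in cell [i], the
    index of the current renewal then stays between [(i - 1) N] and [(i + 2) N]; [Nbig] absorbs the
    rounding of [q] to [N], which accumulates over up to [m] blocks. *)
Hypothesis clock : forall k, (k <= m.+1 * N)%N -> `|S k - k%:R * mu| <= n%:R / (2 * m%:R).
Hypothesis osc : forall l j, (l <= m)%N -> (j <= N)%N ->
  c * `|\sum_(l * N <= i < l * N + j) (-1) ^+ i * (U i w - mu)| <= eps.

Let c0 : 0 < c.
Proof. by rewrite divr_gt0// sqrtr_gt0 ltr0n. Qed.

(** The window meets the blocks [i - 1], [i] and [i + 1], and at most two block oscillations lead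
    from [i * N] to [j]. Since [i + 1] may equal [m], one block beyond the [m] blocks of the
    polyline is controlled as well. For [i = 0] the predecessor is 0 and the left block is
    absent. *)
Let osc_window i j : (i < m)%N -> (i.-1 * N <= j)%N -> (j <= i.+2 * N)%N ->
  c * `|Zc j - Zc (i * N)| <= 2 * eps.
Proof.
move=> im ij ji.
have sub a b : (a <= b)%N -> Zc b - Zc a = \sum_(a <= l < b) (-1) ^+ l * (U l w - mu).
  move=> ab; rewrite /Zc -!(big_mkord xpredT (fun l => (-1) ^+ l * (U l w - mu))).
  by rewrite (@big_cat_nat _ _ _ a 0 b)//= [LHS]addrC addKr.
have osc' l j' : (l <= m)%N -> (l * N <= j')%N -> (j' <= l.+1 * N)%N ->
    c * `|Zc j' - Zc (l * N)| <= eps.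
  move=> lm lj jl; rewrite sub//.
  have := @osc l (j' - l * N)%N lm; rewrite subnKC//; apply.
  by rewrite leq_subLR addnC -mulSn.
have eps0 : 0 <= eps.
  have := osc (leq0n m) (leq0n N); rewrite addn0 big_geq// normr0 mulr0; exact: id.
have [jiN|iNj] := leqP j (i * N).
  case: i => [|i] in im ij ji jiN *.
    have -> : j = 0%N by lia.
    by rewrite subrr normr0 mulr0 mulr_ge0.
  have im' : (i <= m)%N by exact: ltnW (ltnW im).
  have o1 := osc' i j im' ij jiN.
  have o2 := osc' i (i.+1 * N)%N im' (leq_mul (leqnSn i) (leqnn N)) (leqnn _).
  rewrite (_ : Zc j - _ = Zc j - Zc (i * N) - (Zc (i.+1 * N) - Zc (i * N))); last by ring.
  apply: le_trans (ler_wpM2l (ltW c0) (ler_normB _ _)) _; rewrite mulrDr.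
  by move: o1 o2; lra.
have [jiN|iNj'] := leqP j (i.+1 * N).
  by have := osc' i j (ltnW im) (ltnW iNj) jiN; lra.
have o1 := osc' i (i.+1 * N)%N (ltnW im) (leq_mul (leqnSn i) (leqnn N)) (leqnn _).
have o2 := osc' i.+1 j im (ltnW iNj') ji.
rewrite (_ : Zc j - _ = (Zc j - Zc (i.+1 * N)) + (Zc (i.+1 * N) - Zc (i * N))); last by ring.
apply: le_trans (ler_wpM2l (ltW c0) (ler_normD _ _)) _; rewrite mulrDr.
by move: o1 o2; lra.
Qed.

Lemma path_close (t : R) : 0 <= t <= 1 ->
  `|Xproc C U n w t -
    polyline m (mkseq (fun l => c * \sum_(l * N <= i < l * N + N) (-1) ^+ i * (U i w - mu)) m) t|
  <= 3 * eps + c * mu.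
Proof.
move=> t01; have [i im /andP[it ti]] := cell_exists m0 t01.
move: (t01) => /andP[t0 t1].
set s := mkseq _ _.
have m0' : (0 : R) < m%:R by rewrite ltr0n.
have n0' : (0 : R) < n%:R by rewrite ltr0n.
have [Q QE] : exists Q, Q = q by exists q.
have NQ : N%:R <= Q by rewrite QE.
have QN : Q <= N.+1%:R by rewrite QE.
have nE : n%:R = m%:R * Q * mu by rewrite QE; field; rewrite !gt_eqF.
have sE l : (l < m)%N -> s`_l = c * (Zc (l.+1 * N) - Zc (l * N)).
  move=> lm; rewrite nth_mkseq//; congr (_ * _).
  rewrite /Zc -!(big_mkord xpredT (fun l => (-1) ^+ l * (U l w - mu))).
  rewrite (@big_cat_nat _ _ _ (l * N) 0 (l.+1 * N))//= ?leq_mul//.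
  by rewrite addrAC subrr add0r mulSnr.
have polylineE : polyline m s t = c * Zc (i * N) + s`_i * ramp (m%:R * t - i%:R).
  rewrite (polyline_cell s im it ti); congr (_ + _).
  elim: i im {it ti} => [|i IH] im; first by rewrite big_ord0 /Zc big_ord0 mulr0.
  by rewrite big_ord_recr/= IH ?(ltnW im)// sE ?(ltnW im)//; ring.
have polyline_near : `|polyline m s t - c * Zc (i * N)| <= eps.
  rewrite polylineE addrAC subrr add0r.
  have /andP[r0 r1] := ramp_itv (m%:R * t - i%:R).
  rewrite normrM (ger0_norm r0); apply: le_trans (ler_piMr _ r1) _ => //.
  by rewrite nth_mkseq// normrM (gtr0_norm c0); apply: osc => //; exact: ltnW.
have Nbig' : 2 * m%:R + 4 <= N%:R :> R by rewrite -natrM -natrD ler_nat.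
have qmu : n%:R / (2 * m%:R) = Q * mu / 2 by rewrite QE; field; rewrite !gt_eqF.
(* The first [m + 1] blocks outlast time [n]: their mean duration [(m + 1) N mu] exceeds [n] by more
   than the tolerance of the clock. *)
have [k kK /andP[Sk kS]] : exists2 k, (k < m.+1 * N)%N & S k <= n%:R * t < S k.+1.
  apply: cell_partial_sum; first by rewrite mulr_ge0.
  have := clock (leqnn _); rewrite qmu ler_norml => /andP[h _].
  apply: (@le_lt_trans _ _ n%:R); first by rewrite ler_piMr.
  move: h QN; rewrite natrM -[m.+1%:R]natr1 -[N.+1%:R]natr1 => h QN'.
  have : m%:R * Q * mu + Q * mu / 2 < (m%:R + 1) * N%:R * mu.
    rewrite (_ : _ + _ = (m%:R * Q + Q / 2) * mu); last by ring.
    by rewrite ltr_pM2r//; nra.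
  by move: h nE; lra.
have ck := clock (ltnW kK); have ck1 := clock kK.
have Qmu0 : 0 <= Q * mu by rewrite mulr_ge0 ?(ltW mu0)// (le_trans _ NQ).
have ntE : n%:R * t = m%:R * t * (Q * mu) by rewrite nE; ring.
have nt_lo : i%:R * Q * mu <= n%:R * t by rewrite ntE -mulrA; exact: ler_wpM2r.
have nt_hi : n%:R * t <= i.+1%:R * Q * mu.
  by rewrite ntE -[i.+1%:R * Q * mu]mulrA; exact: ler_wpM2r.
have im' : i.+1%:R <= m%:R :> R by rewrite ler_nat.
have khi : (k.+1 <= i.+2 * N)%N.
  rewrite -(ler_nat R) natrM.
  move: ck; rewrite qmu ler_norml => /andP[h _].
  have : k%:R * mu <= (i.+1%:R * Q + Q / 2) * mu by move: h Sk nt_hi; lra.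
  rewrite ler_pM2r// => h2.
  move: QN im' h2 Nbig'; rewrite -[N.+1%:R]natr1 -[k.+1%:R]natr1 -[i.+2%:R]natr1 => ? ? ? ?.
  by nra.
have klo : (i.-1 * N <= k)%N.
  case: i im it ti {polylineE polyline_near nt_hi khi im'} nt_lo => [|i] im it ti nt_lo //.
  rewrite -ltnS -(ltr_nat R) natrM.
  move: ck1; rewrite qmu ler_norml => /andP[_ h].
  have : (i.+1%:R * Q - Q / 2) * mu < k.+1%:R * mu by move: h kS nt_lo; lra.
  rewrite ltr_pM2r// => h2.
  have iNQ : i%:R * N%:R <= i%:R * Q by exact: ler_wpM2l.
  have Q0 : 0 <= Q by apply: le_trans NQ.
  by move: iNQ Q0 h2; rewrite -[i.+1%:R]natr1/=; lra.
rewrite (Xproc_val U0 n0 C Sk (ltW kS)).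
have cn z : `|c * z| = c * `|z| by rewrite normrM (gtr0_norm c0).
have close j : (i.-1 * N <= j)%N -> (j <= i.+2 * N)%N ->
    `|c * Z j - c * Zc (i * N)| <= 2 * eps + c * mu.
  move=> j1 j2.
  rewrite (_ : _ - _ = c * (Z j - Zc j) + c * (Zc j - Zc (i * N))); last by ring.
  apply: le_trans (ler_normD _ _) _; rewrite !cn addrC; apply: lerD.
    exact: osc_window.
  by apply: ler_wpM2l (Z_Zc j); exact: ltW.
have ck' := close k klo (ltnW khi).
have ck1' := close k.+1 (leqW klo) khi.
(* Between two renewals the path is affine, so its value is a convex combination of the values
   [c * Z k] and [c * Z k.+1], both already close to [c * Zc (i * N)]. *)
have X_near : `|c * (Z k + (-1) ^+ k * (n%:R * t - S k)) - c * Zc (i * N)| <= 2 * eps + c * mu.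
  have Uk : 0 < U k w by move: Sk kS; rewrite partial_sumS; lra.
  apply: (@convex_norm (c * Z k - c * Zc (i * N)) (c * Z k.+1 - c * Zc (i * N)) _
    ((n%:R * t - S k) / U k w)) => //.
    rewrite divr_ge0 ?subr_ge0//= ler_pdivrMr// mul1r lerBlDr addrC -partial_sumS; exact: ltW.
  have Un0 : U k w != 0 by rewrite gt_eqF.
  have sn0 : Num.sqrt n%:R != 0 :> R by rewrite gt_eqF// sqrtr_gt0.
  by rewrite /Z big_ord_recr/=; field; rewrite ?Un0 ?sn0.
have E (a b z : R) : a - b = (a - z) - (b - z) by ring.
rewrite [X in `|X|](E _ _ (c * Zc (i * N))).
apply: le_trans (ler_normB _ _) _; apply: le_trans (lerD X_near polyline_near) _.
by rewrite le_eqVlt; apply/orP; left; apply/eqP; ring.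
Qed.

End path_close.

(** * Regularization and interpolation *)

Section lipschitz_regularization.
Context {R : realType}.
Implicit Types (f g : R -> R).

Definition dist01_le (r : R) f g := forall t, 0 <= t <= 1 -> `|f t - g t| <= r.

Lemma dist01_le_ge0 r f g : dist01_le r f g -> 0 <= r.
Proof.
by move=> /(_ 0); rewrite lexx ler01 => /(_ isT); apply: le_trans.
Qed.

Variables (F : (R -> R) -> R) (M : R).
Hypothesis FM : forall f, cont01 f -> `|F f| <= M.

Definition lipreg (k : R) f :=
  inf [set y | exists g r, [/\ cont01 g, dist01_le r f g & y = F g + k * r]].

Variable k : R.
Hypothesis k0 : 0 <= k.

Let FMl f : cont01 f -> - M <= F f.
Proof. by move=> /FM; rewrite ler_norml => /andP[]. Qed.

Let FMr f : cont01 f -> F f <= M.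
Proof. by move=> /FM; rewrite ler_norml => /andP[]. Qed.

Let lipreg_lb f : lbound [set y | exists g r, [/\ cont01 g, dist01_le r f g & y = F g + k * r]] (- M).
Proof.
move=> _ [g [r [cg /dist01_le_ge0 r0 ->]]].
by rewrite -[- M]addr0 lerD ?FMl// mulr_ge0.
Qed.

Lemma lipreg_le_val f g r : cont01 g -> dist01_le r f g -> lipreg k f <= F g + k * r.
Proof.
by move=> cg fg; apply: ge_inf; [exists (- M); exact: lipreg_lb|exists g, r].
Qed.

Lemma lipreg_le f : cont01 f -> lipreg k f <= F f.
Proof.
move=> cf; have := @lipreg_le_val f f 0 cf; rewrite mulr0 addr0; apply.
by move=> t _; rewrite subrr normr0.
Qed.

Lemma le_lipreg f (x : R) : cont01 f ->
  (forall g r, cont01 g -> dist01_le r f g -> x <= F g + k * r) -> x <= lipreg k f.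
Proof.
move=> cf H; apply: lb_le_inf.
  by exists (F f + k * 0), f, 0; split => // t _; rewrite subrr normr0.
by move=> _ [g [r [cg fg ->]]]; exact: H.
Qed.

Lemma lipreg_bound f : cont01 f -> `|lipreg k f| <= M.
Proof.
move=> cf; rewrite ler_norml (le_trans (lipreg_le cf) (FMr cf)) andbT.
by apply: le_lipreg => // g r cg fg; apply: (@lipreg_lb f); exists g, r.
Qed.

Lemma lipreg_lip f g r : cont01 f -> cont01 g -> dist01_le r f g ->
  `|lipreg k f - lipreg k g| <= k * r.
Proof.
have half f1 f2 : cont01 f1 -> cont01 f2 -> dist01_le r f1 f2 ->
    lipreg k f1 - k * r <= lipreg k f2.
  move=> c1 c2 d12; apply: le_lipreg => // h r' ch d2.
  rewrite lerBlDr -addrA -mulrDr; apply: lipreg_le_val => // t t01.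
  rewrite -(subrKA (f2 t)) addrC; apply: le_trans (ler_normD _ _) _.
  by apply: lerD; [exact: d2|exact: d12].
move=> cf cg fg; have gf : dist01_le r g f by move=> t t01; rewrite distrC; exact: fg.
rewrite ler_norml; apply/andP; split.
  by have := half _ _ cg cf gf; lra.
by have := half _ _ cf cg fg; lra.
Qed.

End lipschitz_regularization.

Section lipreg_cvg.
Context {R : realType}.
Variables (F : (R -> R) -> R) (M : R).
Hypothesis FM : forall f, cont01 f -> `|F f| <= M.
Hypothesis Fcont : forall f, cont01 f -> forall e : R, 0 < e ->
  exists2 del : R, 0 < del & forall g, cont01 g ->
    (forall t, 0 <= t <= 1 -> `|f t - g t| < del) -> `|F f - F g| < e.

Lemma lipreg_cvg (f : R -> R) : cont01 f -> lipreg F k%:R f @[k --> \oo] --> F f.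
Proof.
move=> cf; apply/cvgrPdist_le => e e0; have [del del0 H] := Fcont cf e0.
have M0 : 0 <= M by apply: le_trans (FM cf).
near=> k.
have kd : 2 * M <= k%:R * del.
  rewrite -ler_pdivrMr//; near: k; exact: nbhs_infty_ger.
have k0 : 0 <= k%:R :> R by [].
rewrite ger0_norm ?subr_ge0; last exact: (lipreg_le FM).
rewrite lerBlDr -lerBlDl; apply: le_lipreg => // g r cg fg.
have r0 := dist01_le_ge0 fg.
have /andP[Fg1 Fg2] : - M <= F g <= M by rewrite -ler_norml; exact: FM.
have /andP[Ff1 Ff2] : - M <= F f <= M by rewrite -ler_norml; exact: FM.
(* Near [f], continuity of [F] bounds the loss by [e]; farther than [del], the penalty
   [k * r >= 2 M] outweighs the whole oscillation of [F]. *)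
have [rd|dr] := ltP r del.
  have : `|F f - F g| < e by apply: H => // t t01; apply: le_lt_trans (fg _ t01) rd.
  rewrite ltr_norml => /andP[_ h]; have : 0 <= k%:R * r by rewrite mulr_ge0.
  by move: h; lra.
have : k%:R * del <= k%:R * r by exact: ler_wpM2l.
by move: kd Fg1 Ff2 e0; lra.
Unshelve. all: by end_near. Qed.

End lipreg_cvg.

(** * Polygonal interpolation of continuous functions *)

Section polygon_approx.
Context {R : realType}.

(** Heine's theorem through the near-covering form of compactness: a modulus [eta] that works near
    each point works on the whole segment. *)
Lemma cont01_uniform (f : R -> R) (e : R) : cont01 f -> 0 < e ->
  exists2 eta, 0 < eta & forall s t, 0 <= s <= 1 -> 0 <= t <= 1 -> `|s - t| < eta ->
    `|f s - f t| <= e.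
Proof.
move=> cf e0.
have /compact_near_coveringP nc : compact (`[0, 1]%classic : set R) by exact: segment_compact.
pose Pr (eta : R) (s : R) := forall t, 0 <= s <= 1 -> 0 <= t <= 1 -> `|s - t| < eta ->
    `|f s - f t| <= e.
have pt (x : R) : `[0, 1]%classic x -> \forall x' \near x & eta \near 0^'+, Pr eta x'.
  move=> x01; have e20 : 0 < e / 2 by rewrite divr_gt0.
  have /cvgrPdist_lt /(_ _ e20) := (proj1 (subspace_continuousP _ _) cf) x x01.
  move=> /nbhs_ballP[rho /= rho0 near_f].
  have rho20 : 0 < rho / 2 by rewrite divr_gt0.
  near=> x' eta => t x'01 t01 /= x't.
  have xx' : `|x - x'| < rho / 2.
    by near: x'; exact: (nbhsx_ballx x (rho / 2) rho20).
  have eta_rho : eta < rho / 2 by near: eta; exact: nbhs_right_lt.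
  have fx' : `|f x - f x'| < e / 2.
    by apply: near_f; rewrite /ball/= ?in_itv//; move: rho0 xx'; lra.
  have fxt : `|f x - f t| < e / 2.
    apply: near_f; rewrite /ball/= ?in_itv//.
    by have := ler_distD x' x t; move: xx' eta_rho x't; lra.
  have := ler_distD (f x) (f x') (f t); rewrite [`|f x' - f x|]distrC.
  by move: fx' fxt; lra.
have := nc R (0^'+) Pr _ pt => near_eta.
near (0 : R)^'+ => eta.
exists eta; first by near: eta; exact: nbhs_right_gt.
move=> s t s01 t01 st; have : `[0, 1]%classic `<=` Pr eta by near: eta; exact: near_eta.
by move=> /(_ s); apply => //; rewrite /= in_itv.
Unshelve. all: by end_near. Qed.

Lemma polyline_approx (f : R -> R) (e : R) : cont01 f -> f 0 = 0 -> 0 < e ->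
  \forall m \near \oo, dist01_le e f
    (polyline m (mkseq (fun i => f (i.+1%:R / m%:R) - f (i%:R / m%:R)) m)).
Proof.
move=> cf f0 e0; have e20 : 0 < e / 2 by rewrite divr_gt0.
have [eta eta0 unif] := cont01_uniform cf e20.
near=> m => t t01.
have m0 : (0 < m)%N by near: m; exact: nbhs_infty_gt.
have m0' : (0 : R) < m%:R by rewrite ltr0n.
have meta : m%:R^-1 < eta.
  rewrite -[ltRHS]invrK ltf_pV2 ?posrE ?invr_gt0//; near: m; exact: nbhs_infty_gtr.
have [i im /andP[it ti]] := cell_exists m0 t01.
set s := mkseq _ _.
have sum_s : \sum_(l < i) s`_l = f (i%:R / m%:R).
  elim: i im {it ti} => [|i IH] im; first by rewrite big_ord0 mul0r f0.
  by rewrite big_ord_recr/= IH ?(ltnW im)// nth_mkseq ?(ltnW im)// addrC subrK.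
rewrite (polyline_cell s im it ti) sum_s.
have /andP[r0 r1] := ramp_itv (m%:R * t - i%:R).
have i01 : 0 <= (i%:R / m%:R : R) <= 1.
  by rewrite divr_ge0//= ler_pdivrMr// mul1r ler_nat ltnW.
have i101 : 0 <= (i.+1%:R / m%:R : R) <= 1.
  by rewrite divr_ge0//= ler_pdivrMr// mul1r ler_nat.
have d1 : `|f t - f (i%:R / m%:R)| <= e / 2.
  apply: unif => //; apply: le_lt_trans meta.
  have ti1 : i%:R / m%:R <= t by rewrite ler_pdivrMr// mulrC.
  have ti2 : t <= i%:R / m%:R + m%:R^-1.
    by rewrite -[X in _ + X]mul1r -mulrDl natr1 ler_pdivlMr// mulrC.
  by rewrite ger0_norm ?subr_ge0// lerBlDl.
have d2 : `|s`_i| <= e / 2.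
  rewrite nth_mkseq//; apply: unif => //; apply: le_lt_trans meta.
  by rewrite -mulrBl -natr1 addrAC subrr add0r mul1r ger0_norm ?invr_ge0.
rewrite opprD addrA; apply: le_trans (ler_normB _ _) _.
rewrite [leRHS](splitr e); apply: lerD => //.
by rewrite normrM (ger0_norm r0); apply: le_trans d2; exact: ler_piMr.
Unshelve. all: by end_near. Qed.

End polygon_approx.

(** * Brownian increments and block sums *)

Section lipschitz_functional.
Context {R : realType}.

Definition lip_functional (K M : R) (Phi : (R -> R) -> R) :=
  (forall f g r, cont01 f -> cont01 g -> dist01_le r f g -> `|Phi f - Phi g| <= K * r) /\
  (forall f, cont01 f -> `|Phi f| <= M).

Lemma lipseq_polyline K M Phi m : lip_functional K M Phi ->
  lipseq m K (fun s => Phi (polyline m s)) /\ boundedseq m M (fun s => Phi (polyline m s)).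
Proof.
move=> [PhiK PhiM]; split => [s s' _ _|s _]; last by apply: PhiM; exact: cont01_polyline.
apply: PhiK; [exact: cont01_polyline|exact: cont01_polyline|].
by move=> t _; exact: polyline_lip.
Qed.

End lipschitz_functional.

Section brownian.
Context {d : measure_display} {T : measurableType d} {R : realType}.
Variables (P : probability T R) (W : R -> T -> R).
Hypothesis BM : standard_BM P W.

Definition bm_inc (m : nat) (i : nat) (w : T) := W (i.+1%:R / m%:R) w - W (i%:R / m%:R) w.

Lemma measurable_bm_inc m i : measurable_fun setT (bm_inc m i).
Proof. by have [mW _ _ _ _] := BM; exact: measurable_funB. Qed.

Lemma bm_inc_indep m k : (k <= m)%N -> indep_fin P k (bm_inc m).
Proof.
move=> km; have [_ _ _ _ ind] := BM.
apply: (ind k (fun i => i%:R / m%:R)).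
- by rewrite mul0r.
- by move=> i; rewrite ler_wpM2r ?invr_ge0// ler_nat.
- have [->|m0] := posnP m; first by rewrite invr0 mulr0.
  by rewrite ler_pdivrMr ?ltr0n// mul1r ler_nat.
Qed.

Lemma bm_inc_law m i B : (i < m)%N -> measurable B ->
  P (bm_inc m i @^-1` B) = gaussian (Num.sqrt m%:R^-1) B.
Proof.
move=> im mB; have [_ _ _ law _] := BM.
have m0 : (0 : R) < m%:R by rewrite ltr0n (leq_ltn_trans _ im).
have E : i.+1%:R / m%:R - i%:R / m%:R = m%:R^-1 :> R.
  by rewrite -mulrBl -natr1 addrAC subrr add0r mul1r.
have h0 : 0 <= (i%:R / m%:R : R) by rewrite divr_ge0.
have h1 : (i%:R / m%:R : R) < i.+1%:R / m%:R by rewrite ltr_pM2r ?invr_gt0// ltr_nat.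
have h2 : (i.+1%:R / m%:R : R) <= 1 by rewrite ler_pdivrMr// mul1r ler_nat.
by have := law _ _ h0 h1 h2 B mB; rewrite E.
Qed.

Lemma bm_inc_sum m k w : \sum_(i < k) bm_inc m i w = W (k%:R / m%:R) w.
Proof.
have [_ W0 _ _ _] := BM.
elim: k => [|k IH]; first by rewrite big_ord0 mul0r W0.
by rewrite big_ord_recr/= IH /bm_inc addrC subrK.
Qed.

Variables (K M : R) (Phi : (R -> R) -> R).
Hypothesis PhiL : lip_functional K M Phi.
Let path w := fun t => W t w.

Let cpath w : cont01 (path w).
Proof. by have [_ _ cW _ _] := BM; exact: cW. Qed.

Let G m s := Phi (polyline m s).

Lemma measurable_polyline_bm m : measurable_fun setT (fun w => G m (mkseq (bm_inc m ^~ w) m)).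
Proof.
have [lG _] := lipseq_polyline m PhiL.
exact: (measurable_lipseq (fun i _ => measurable_bm_inc m i) lG).
Qed.

Let polyline_bm_cvg w : G m (mkseq (bm_inc m ^~ w) m) @[m --> \oo] --> Phi (path w).
Proof.
have [PhiK _] := PhiL; have [_ W0 _ _ _] := BM.
apply/cvgrPdist_le => e e0.
have K1 : 0 < `|K| + 1 by rewrite ltr_pwDr.
have := polyline_approx (@cpath w) (W0 w) (divr_gt0 e0 K1); apply: filterS => m close.
apply: le_trans (PhiK _ _ _ (@cpath w) (@cont01_polyline _ _ _) close) _.
rewrite mulrCA -[leRHS]mulr1; apply: ler_wpM2l; first exact: ltW.
by rewrite ler_pdivrMr// mul1r; have := ler_norm K; lra.
Qed.

(** A pointwise limit along the interpolations of [W], each a Lipschitz function of finitely many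
    increments; no sigma-algebra on path space is involved. *)
Lemma measurable_functional_bm : measurable_fun setT (fun w => Phi (path w)).
Proof.
apply: (measurable_fun_cvg (fun m => measurable_polyline_bm m)) => w _.
exact: polyline_bm_cvg.
Qed.

Lemma polyline_bm_expectation :
  \int[P]_w Phi (polyline m (mkseq (bm_inc m ^~ w) m)) @[m --> \oo] --> \int[P]_w Phi (path w).
Proof.
have [_ PhiM] := PhiL.
have : (\int[P]_w (G m (mkseq (bm_inc m ^~ w) m))%:E)%E @[m --> \oo] -->
    (\int[P]_w (Phi (path w))%:E)%E.
  apply: (@dominated_cvg _ _ _ P setT measurableT _ _ (cst M%:E)) => //.
  - by move=> m; apply/measurable_EFinP; exact: measurable_polyline_bm.
  - move=> w _; apply: cvg_EFin; first by near=> m.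
    exact: polyline_bm_cvg.
  - exact: finite_measure_integrable_cst.
  - by move=> m w _; rewrite /= lee_fin; apply: PhiM; exact: cont01_polyline.
rewrite EFin_Rintegral; last first.
  apply: (@bounded_integrable _ _ _ P _ M); first exact: measurable_functional_bm.
  by move=> w; exact: PhiM.
by move/fine_cvgP => [].
Unshelve. all: by end_near. Qed.

End brownian.

(** * Independence and central limit theorem for blocks *)

Section blocks.
Context {d : measure_display} {T : measurableType d} {R : realType}.
Variables (P : probability T R) (X : nat -> T -> R).
Hypothesis mX : forall i, measurable_fun setT (X i).

Lemma indep_blocks N m : indep_fin P (m * N) X ->
  indep_fin P m (fun l w => \sum_(l * N <= i < l * N + N) X i w).
Proof.
move=> iX B mB; pose Y l w := \sum_(l * N <= i < l * N + N) X i w.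
(* The induction carries along that the event of the first [k] blocks depends on the first [k * N]
   coordinates only, which makes it independent of the next block. *)
suff H k : (k <= m)%N -> <<s cylinder X 0 (k * N) >> (\big[setI/setT]_(i < k) (Y i @^-1` B i)) /\
   (P (\big[setI/setT]_(i < k) (Y i @^-1` B i)) = \prod_(i < k) P (Y i @^-1` B i))%E.
  by have [] := H m (leqnn _).
have sub_cyl j l : (j <= l)%N -> <<s cylinder X 0 j >> `<=` <<s cylinder X 0 l >>.
  move=> jl; apply: smallest_sub; first exact: smallest_sigma_algebra.
  move=> _ [D mD ->]; apply: sub_sigma_algebra.
  exists (fun i => if (i < j)%N then D i else setT); first by move=> i; case: ifP.
  rewrite (@big_cat_nat _ _ _ j 0 l)//=.
  rewrite [X in _ = _ `&` X](_ : _ = setT); last first.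
    by rewrite big_nat big1// => i /andP[ji _]; rewrite ltnNge ji preimage_setT.
  by rewrite setIT; apply: eq_big_nat => i /andP[_ ->].
have blk a b l : (a <= l * N)%N -> (l * N + N <= b)%N ->
    <<s cylinder X a b >> (Y l @^-1` B l).
  move=> al lb.
  have m1 : measurable_fun [set: g_sigma_algebraType (cylinder X a b)] (Y l).
    rewrite (_ : Y l = (fun w => \sum_(i < N) X (l * N + i)%N w)); last first.
      by apply/funext => w; rewrite /Y big_shift_ord.
    apply: measurable_sum => i; apply: cylinder_coord.
    by rewrite (leq_trans al) ?leq_addr//= (leq_trans _ lb)// ltn_add2l.
  by have := m1 measurableT _ (mB l); rewrite setTI.
elim: k => [|k IH] km.
  rewrite !big_ord0 probability_setT; split => //.
  exact: (@measurableT _ (g_sigma_algebraType (cylinder X 0 (0 * N)))).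
have [sI PI] := IH (ltnW km); rewrite !big_ord_recr/=; split.
  apply: (@measurableI _ (g_sigma_algebraType (cylinder X 0 (k.+1 * N)))).
    by apply: sub_cyl sI; rewrite leq_mul.
  by apply: blk => //; rewrite mulSnr.
rewrite -PI; apply: (indep_cylinder (lo := 0) (mid := k * N) (hi := k * N + N) iX mX) => //.
- by rewrite leq_addr.
- by rewrite -mulSnr leq_mul.
- exact: blk.
Qed.

End blocks.

Lemma Rintegral_eq_law {R : realType} d (T : measurableType d) (P : probability T R)
    (X : T -> R) (nu : probability R R) (h : R -> R) (M : R) :
  measurable_fun setT X -> (forall B, measurable B -> P (X @^-1` B) = nu B) ->
  measurable_fun setT h -> (forall x, `|h x| <= M) ->
  \int[P]_w h (X w) = \int[nu]_y h y.
Proof.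
move=> mX lX mh hM.
rewrite -(Rintegral_law mX mh); last first.
  apply: (@bounded_integrable _ _ _ P _ M); first exact: measurableT_comp.
  by move=> w; exact: hM.
rewrite /Rintegral; congr fine.
by apply: eq_measure_integral => B mB _; exact: lX.
Qed.

Section block_clt.
Context {d : measure_display} {T : measurableType d} {R : realType}.
Variables (P : probability T R) (U : nat -> T -> R) (mu sg tau0 C : R).
Hypothesis mU : forall k, measurable_fun setT (U k).
Hypothesis iU : indep_seq P U.
Hypothesis idU : ident_distr P U.
Hypothesis mu0 : 0 < mu.
Hypothesis C0 : 0 < C.
Hypothesis Csg : C ^+ 2 * sg = mu.

(** The weights are constantly 1 for the renewal clock and alternate between plus and minus
    [C / sqrt n] for the process. *)
Definition scaled (a : nat -> R) i w := a i * (U i w - mu).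

Lemma measurable_scaled a i : measurable_fun setT (scaled a i).
Proof. by apply: measurable_funM => //; exact: measurable_funB. Qed.

Lemma measurable_centered : measurable_fun setT (fun w => U 0%N w - mu).
Proof. exact: measurable_funB. Qed.

Lemma measurable_mulr (a : R) : measurable_fun setT (fun y : R => a * y).
Proof. exact: measurable_funM. Qed.

Let law0 := law P measurable_centered.
Hypothesis mom0 : centered_moments law0 sg tau0.

Let measurable_affine (a : R) (B : set R) : measurable B ->
  measurable ((fun u : R => a * (u - mu)) @^-1` B).
Proof.
move=> mB; rewrite -[_ @^-1` _]setTI.
have m : measurable_fun setT (fun u : R => a * (u - mu)).
  by apply: measurable_funM => //; exact: measurable_funB.
exact: m.
Qed.

Lemma scaled_law a i B : measurable B ->
  P (scaled a i @^-1` B) = law law0 (measurable_mulr (a i)) B.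
Proof.
by move=> mB; exact: (idU i (measurable_affine (a i) mB)).
Qed.

Lemma scaled_indep a n : indep_fin P n (scaled a).
Proof.
move=> B mB.
exact: (@iU n (fun i => (fun u : R => a i * (u - mu)) @^-1` B i)
  (fun i => measurable_affine (a i) (mB i))).
Qed.

Lemma scaled_moments (a : nat -> R) i tau : \int[law0]_y min23 (a i * y) <= tau ->
  centered_moments (law law0 (measurable_mulr (a i))) (a i ^+ 2 * sg) tau.
Proof.
move=> le_tau; have [j1 j2 j3 j4 j5] := centered_moments_scale (measurable_mulr (a i)) mom0.
by split => //; apply: le_trans j5 le_tau.
Qed.

Definition alt (n i : nat) : R := C / Num.sqrt n%:R * (-1) ^+ i.
Definition bsize (m n : nat) : nat := Num.truncn (n%:R / (m%:R * mu)).
Definition block (m n l : nat) (w : T) :=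
  \sum_(l * bsize m n <= i < l * bsize m n + bsize m n) scaled (alt n) i w.

Lemma alt_norm n i : `|alt n i| = C / Num.sqrt n%:R.
Proof.
rewrite /alt normrM normrX normrN1 expr1n mulr1 ger0_norm// divr_ge0 ?sqrtr_ge0//.
exact: ltW.
Qed.

Lemma alt_sqr n i : (0 < n)%N -> alt n i ^+ 2 = C ^+ 2 / n%:R.
Proof.
move=> n0; rewrite -[LHS]real_normK ?num_real// alt_norm exprMn exprVn sqr_sqrtr//.
Qed.

Lemma alt_var n i : (0 < n)%N -> alt n i ^+ 2 * sg = mu / n%:R.
Proof. by move=> n0; rewrite alt_sqr// -Csg; ring. Qed.

Lemma bsize_itv m n : (0 < m)%N ->
  (bsize m n)%:R <= n%:R / (m%:R * mu) /\ n%:R / (m%:R * mu) < (bsize m n).+1%:R.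
Proof.
move=> m0; have q0 : 0 <= n%:R / (m%:R * mu) by rewrite divr_ge0// mulr_ge0// ltW.
by have /andP[] := truncn_itv q0.
Qed.

Lemma bsize_var m n : (0 < m)%N -> (0 < n)%N ->
  m%:R^-1 - mu / n%:R <= (bsize m n)%:R * (mu / n%:R) <= m%:R^-1.
Proof.
move=> m0 n0; have [h1 h2] := bsize_itv n m0.
have m0' : (0 : R) < m%:R by rewrite ltr0n.
have n0' : (0 : R) < n%:R by rewrite ltr0n.
have p : 0 < mu / n%:R by rewrite divr_gt0.
have E : n%:R / (m%:R * mu) * (mu / n%:R) = m%:R^-1.
  by field; rewrite !gt_eqF.
rewrite -E ler_pM2r// h1 andbT lerBlDr -[X in _ + X]mul1r -mulrDl ler_pM2r// natr1.
exact: ltW.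
Qed.

Lemma bsize_large m (r : R) : (0 < m)%N -> \forall n \near \oo, r <= (bsize m n)%:R.
Proof.
move=> m0; have m0' : (0 : R) < m%:R by rewrite ltr0n.
near=> n; have [_ h2] := bsize_itv n m0.
have : (r + 1) * (m%:R * mu) <= n%:R by near: n; exact: nbhs_infty_ger.
rewrite -ler_pdivlMr ?mulr_gt0// => h; move: h2; rewrite -natr1; move: h.
by move: (n%:R / _) => q; lra.
Unshelve. all: by end_near. Qed.

Lemma near_scale_small (r : R) : 0 < r -> \forall n \near \oo, C / Num.sqrt n%:R <= r.
Proof.
move=> r0; near=> n.
have n0 : (0 : R) < n%:R by near: n; exact: nbhs_infty_gtr.
rewrite ler_pdivrMr ?sqrtr_gt0// -ler_pdivrMl//.
rewrite -(ger0_norm (ltW (_ : 0 < r^-1 * C))) ?mulr_gt0 ?invr_gt0// -sqrtr_sqr ler_wsqrtr//.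
by near: n; exact: nbhs_infty_ger.
Unshelve. all: by end_near. Qed.

Lemma near_inv_small (a r : R) : 0 < r -> \forall n \near \oo, a / n%:R <= r.
Proof.
move=> r0; near=> n.
have n0 : (0 : R) < n%:R by near: n; exact: nbhs_infty_gtr.
rewrite ler_pdivrMr// -ler_pdivrMl//.
by near: n; exact: nbhs_infty_ger.
Unshelve. all: by end_near. Qed.

Context {d' : measure_display} {T' : measurableType d'}.
Variables (P' : probability T' R) (W : R -> T' -> R).
Hypothesis BM : standard_BM P' W.

(** The threshold on [n] depends neither on [l] nor on [h]: the error is proportional to the
    Lipschitz constant, so that later any section of a functional may be inserted. *)
Lemma clt_block m (eta : R) : (0 < m)%N -> 0 < eta ->
  \forall n \near \oo, forall l (h : R -> R) (K M : R), 0 <= K ->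
    (forall x y, `|h x - h y| <= K * `|x - y|) -> (forall x, `|h x| <= M) ->
  `|\int[P]_w h (block m n l w) - \int[gaussian (Num.sqrt m%:R^-1)]_x h x| <= K * eta.
Proof.
move=> m0 eta0; have m0' : (0 : R) < m%:R by rewrite ltr0n.
(* Budget: [8 * s = eta / 2] for smoothing, then [eta / 6] for each of the Lindeberg term of the
   block, the third moments of the Gaussian increments, and the mismatch of variances. *)
pose s := eta / 16; have s0 : 0 < s by rewrite divr_gt0.
pose B := 4 / s ^+ 2 + 3 / s.
have B0 : 0 < B by rewrite addr_gt0// divr_gt0// exprn_gt0.
pose A := C ^+ 2 / (m%:R * mu).
have A0 : 0 < A by rewrite divr_gt0 ?mulr_gt0// exprn_gt0.
pose e1 := eta / (6 * B * A).
have e10 : 0 < e1 by rewrite divr_gt0// mulr_gt0// mulr_gt0//.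
have [i1 i2 _ _ _] := mom0.
have [c0 c00 small] := min23_scale_small i2 e10.
have r0 : 0 < eta * m%:R / (12 * B) by rewrite divr_gt0 ?mulr_gt0.
near=> n => l h K M K0 hK hM.
have n0 : (0 < n)%N by near: n; exact: nbhs_infty_gt.
have n0' : (0 : R) < n%:R by rewrite ltr0n.
have cn_small : C / Num.sqrt n%:R <= c0 by near: n; exact: near_scale_small.
have mun_small : mu / n%:R <= eta / (6 * B).
  by near: n; apply: near_inv_small; rewrite divr_gt0// mulr_gt0.
set N := bsize m n.
have N_large : (m%:R * (eta * m%:R / (12 * B)) ^+ 2)^-1 <= N%:R.
  by rewrite /N; near: n; exact: bsize_large.
have N0' : (0 : R) < N%:R.
  by apply: lt_le_trans N_large; rewrite invr_gt0 mulr_gt0// exprn_gt0.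
have N0 : (0 < N)%N by rewrite -(ltr0n R).
have [Nq qN] := bsize_itv n m0.
have /andP[var1 var2] := bsize_var m0 n0.
(* Standard deviation of an increment of [W] of mesh [1 / (m N)], so [N r^2 = 1 / m]. The [N] terms
   of the block have total variance [N mu / n], short of [1 / m] by at most [mu / n]. *)
pose r : R := Num.sqrt (m * N)%:R^-1.
have r20 : r ^+ 2 = (m%:R * N%:R)^-1 by rewrite /r sqr_sqrtr ?invr_ge0// natrM.
have rpos : 0 < r by rewrite sqrtr_gt0 invr_gt0 ltr0n muln_gt0 m0.
have r_small : r <= eta * m%:R / (12 * B).
  rewrite -(ger0_norm (ltW r0)) -sqrtr_sqr /r ler_wsqrtr// natrM.
  rewrite -[leRHS]invrK lef_pV2 ?posrE ?(mulr_gt0 m0' N0') ?invr_gt0 ?exprn_gt0//.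
  move: N_large; rewrite invfM [m%:R^-1 * _]mulrC ler_pdivrMr//.
  by rewrite [N%:R * _]mulrC.
pose X i := scaled (alt n) (l * N + i)%N.
pose nu i := law law0 (measurable_mulr (alt n (l * N + i)%N)).
pose tau1 := C ^+ 2 / n%:R * e1.
have mX i : measurable_fun setT (X i) by exact: measurable_scaled.
have iX : indep_fin P N X by apply: indep_shift; exact: scaled_indep.
have lX i (D : set R) : (i < N)%N -> measurable D -> P (X i @^-1` D) = nu i D.
  by move=> _; exact: scaled_law.
have momX i : centered_moments (nu i) (mu / n%:R) tau1.
  rewrite -(alt_var (l * N + i) n0); apply: scaled_moments.
  by rewrite /tau1 -(alt_sqr (l * N + i) n0); apply: small; rewrite alt_norm.
have lY i (D : set R) : (i < N)%N -> measurable D ->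
    P' (bm_inc W (m * N) i @^-1` D) = gaussian r D.
  by move=> iN; apply: bm_inc_law => //; apply: leq_trans iN _; rewrite leq_pmull.
have iY : indep_fin P' N (bm_inc W (m * N)) by apply: bm_inc_indep => //; rewrite leq_pmull.
have := lindeberg mX (measurable_bm_inc BM (m * N)) iX iY lX lY momX
  (fun i => gaussian_centered_moments rpos) s0 K0 hK hM.
have -> : \int[P]_w h (\sum_(i < N) X i w) = \int[P]_w h (block m n l w).
  by apply: eq_Rintegral => w _; rewrite /block big_shift_ord.
(* The fine increments telescope to [W (1 / m)], an increment of mesh [1 / m], whose law is given by
   [standard_BM]. *)
have -> : \int[P']_w h (\sum_(i < N) bm_inc W (m * N) i w) =
    \int[gaussian (Num.sqrt m%:R^-1)]_x h x.
  have mh := lip_measurable hK.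
  have <- := @Rintegral_eq_law _ _ _ P' _ _ h M (measurable_bm_inc BM m 0)
    (fun D mD => bm_inc_law BM m0 mD) mh hM.
  apply: eq_Rintegral => w _; rewrite (bm_inc_sum BM); congr h.
  have [_ W0 _ _ _] := BM; rewrite /bm_inc mul0r W0 subr0 natrM invfM mulrCA.
  by rewrite mulfV ?gt_eqF// mulr1 mul1r.
move=> H; apply: le_trans H _; apply: ler_wpM2l => //; rewrite -/B.
have NA : N%:R * (C ^+ 2 / n%:R) <= A.
  rewrite (_ : A = n%:R / (m%:R * mu) * (C ^+ 2 / n%:R)); last first.
    by rewrite /A; field; rewrite !gt_eqF.
  by apply: ler_wpM2r => //; rewrite divr_ge0// sqr_ge0.
have t1 : N%:R * tau1 <= A * e1.
  by rewrite /tau1 mulrA; apply: ler_wpM2r => //; exact: ltW.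
have Bt1 : B * (A * e1) = eta / 6.
  by rewrite /e1; field; rewrite !gt_eqF.
have t2 : N%:R * (2 * r ^+ 3) = 2 / m%:R * r.
  by rewrite exprSr r20; field; rewrite !gt_eqF.
have t2' : B * (2 / m%:R * r) <= eta / 6.
  apply: le_trans (_ : _ <= B * (2 / m%:R * (eta * m%:R / (12 * B)))) _.
    by apply: ler_wpM2l; [exact: ltW|apply: ler_wpM2l => //; rewrite divr_ge0// ltW].
  by rewrite le_eqVlt; apply/orP; left; apply/eqP; field; rewrite !gt_eqF.
have t3 : N%:R * `|mu / n%:R - r ^+ 2| <= mu / n%:R.
  rewrite -{1}(ger0_norm (ltW N0')) -normrM mulrBr r20.
  rewrite (_ : N%:R * (m%:R * N%:R)^-1 = m%:R^-1); last by field; rewrite !gt_eqF.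
  by rewrite ler_norml; move: var1 var2; rewrite -/N => ? ?; apply/andP; split; lra.
have t3' : B * (mu / n%:R) <= eta / 6.
  rewrite (_ : eta / 6 = B * (eta / (6 * B))); last by field; rewrite gt_eqF.
  by apply: ler_wpM2l => //; exact: ltW.
have -> : N%:R * (tau1 + 2 * r ^+ 3 + `|mu / n%:R - r ^+ 2|) =
  N%:R * tau1 + 2 / m%:R * r + N%:R * `|mu / n%:R - r ^+ 2| by rewrite -t2; ring.
have Bt1' : B * (N%:R * tau1) <= eta / 6 by rewrite -Bt1; apply: ler_wpM2l => //; exact: ltW.
have Bt3' : B * (N%:R * `|mu / n%:R - r ^+ 2|) <= eta / 6.
  by apply: le_trans t3'; apply: ler_wpM2l => //; exact: ltW.
have -> : 8 * s = eta / 2 by rewrite /s; field.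
by rewrite !mulrDr; move: Bt1' t2' Bt3'; lra.
Unshelve. all: by end_near. Qed.

End block_clt.

(** * Bad events *)

Section bad_events.
Context {d : measure_display} {T : measurableType d} {R : realType}.
Variables (P : probability T R) (U : nat -> T -> R) (mu sg tau0 C : R).
Hypothesis mU : forall k, measurable_fun setT (U k).
Hypothesis iU : indep_seq P U.
Hypothesis idU : ident_distr P U.
Hypothesis mu0 : 0 < mu.
Hypothesis C0 : 0 < C.
Hypothesis Csg : C ^+ 2 * sg = mu.
Let law0 := law P (measurable_centered mu mU).
Hypothesis mom0 : centered_moments law0 sg tau0.

Let sg0 : 0 <= sg.
Proof. by have [_ _ _ <- _] := mom0; apply: Rintegral_ge0 => y _; exact: sqr_ge0. Qed.

Lemma scaled_dev (a : nat -> R) v lo n l : 0 < l -> (forall i, a i ^+ 2 * sg = v) ->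
  forall k, (k <= n)%N ->
  (P (dev (fun i => scaled U mu a (lo + i)%N) k n l) <= (n%:R * v / l ^+ 2)%:E)%E.
Proof.
move=> l0 av k kn.
have v0 : 0 <= v by rewrite -(av 0%N) mulr_ge0 ?sqr_ge0.
pose X i := scaled U mu a (lo + k + i)%N.
have mX i : measurable_fun setT (X i) by exact: measurable_scaled.
pose tau i := \int[law0]_y min23 (a (lo + k + i)%N * y).
have iX : indep_fin P (n - k) X by apply: indep_shift; exact: scaled_indep.
have lX i B : (i < n - k)%N -> measurable B ->
    P (X i @^-1` B) = law law0 (measurable_mulr (a (lo + k + i)%N)) B.
  by move=> _; exact: scaled_law.
have momX i : centered_moments (law law0 (measurable_mulr (a (lo + k + i)%N))) v (tau i).
  by rewrite -(av (lo + k + i)%N); apply: (scaled_moments mom0); exact: lexx.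
have := chebyshev_sum mX l0 iX lX momX.
rewrite (_ : dev X 0 (n - k) l = dev (fun i => scaled U mu a (lo + i)%N) k n l); last first.
  apply/funext => w; rewrite /dev/= -{2}(subnKC kn) big_shift_ord big_mkord.
  by under eq_bigr do rewrite /X -addnA.
move=> H; apply: le_trans H _; rewrite lee_fin; apply: ler_wpM2r.
  by rewrite invr_ge0 sqr_ge0.
by apply: ler_wpM2r => //; rewrite ler_nat leq_subr.
Qed.

Definition clock_bad (m n : nat) : set T :=
  \big[setU/set0]_(k < (m.+1 * bsize mu m n).+1)
    dev (scaled U mu (fun=> 1)) 0 k (n%:R / (2 * m%:R)).

Definition block_bad (m n l : nat) (eps : R) : set T :=
  \big[setU/set0]_(k < (bsize mu m n).+1)
    dev (fun i => scaled U mu (alt C n) (l * bsize mu m n + i)%N) 0 k eps.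

Lemma measurable_clock_bad m n : measurable (clock_bad m n).
Proof.
by apply: bigsetU_measurable => k _; apply: measurable_dev => i; exact: measurable_scaled.
Qed.

Lemma measurable_block_bad m n l eps : measurable (block_bad m n l eps).
Proof.
by apply: bigsetU_measurable => k _; apply: measurable_dev => i; exact: measurable_scaled.
Qed.

Lemma clock_bad_small m (del : R) : (0 < m)%N -> 0 < del ->
  \forall n \near \oo, (P (clock_bad m n) <= del%:E)%E.
Proof.
move=> m0 del0; have m0' : (0 : R) < m%:R by rewrite ltr0n.
(* Chebyshev's bound for [(m + 1) N] terms at level [n / (4 m)], half of the threshold of
   [clock_bad] since Ottaviani's inequality doubles the level; [N <= n / (m mu)] brings it to
   [D / n]. *)
pose D := 16 * m%:R * (m%:R + 1) * sg / mu.
near=> n.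
have n0' : (0 : R) < n%:R by near: n; exact: nbhs_infty_gtr.
have D1 : D / n%:R <= 2^-1 by near: n; apply: near_inv_small.
have D2 : D / n%:R <= del / 2 by near: n; apply: near_inv_small; rewrite divr_gt0.
set N := bsize mu m n; pose l : R := n%:R / (4 * m%:R).
have l0 : 0 < l by rewrite divr_gt0// mulr_gt0.
have [Nq _] := bsize_itv mu0 n m0.
have bound : (m.+1 * N)%:R * sg / l ^+ 2 <= D / n%:R.
  rewrite (_ : D / n%:R = (m%:R + 1) * (n%:R / (m%:R * mu)) * sg / l ^+ 2); last first.
    by rewrite /D /l; field; rewrite !gt_eqF.
  apply: ler_wpM2r; first by rewrite invr_ge0 sqr_ge0.
  apply: ler_wpM2r => //; rewrite natrM -[m.+1%:R]natr1; apply: ler_wpM2l => //.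
have cheb k : (k <= m.+1 * N)%N ->
    (P (dev (scaled U mu (fun=> 1%R)) k (m.+1 * N) l) <= (D / n%:R)%:E)%E.
  move=> kN; apply: le_trans (_ : _ <= ((m.+1 * N)%:R * sg / l ^+ 2)%:E)%E _.
    by apply: (@scaled_dev (fun=> 1) sg 0) => // i; rewrite expr1n mul1r.
  by rewrite lee_fin.
have := ottaviani (measurable_scaled mu mU (fun=> 1)) (l := l)
  (scaled_indep mu iU (fun=> 1) (m.+1 * N)) (fun k kN => le_trans (cheb k kN) _).
rewrite lee_fin => /(_ D1).
rewrite (_ : 2 * l = n%:R / (2 * m%:R)); last by rewrite /l; field; rewrite gt_eqF.
rewrite -/(clock_bad m n) => H; apply: le_trans H _.
apply: le_trans (lee_wpmul2l _ (cheb 0%N (leq0n _))) _; first by rewrite lee_fin.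
by rewrite -EFinM lee_fin; move: D2; lra.
Unshelve. all: by end_near. Qed.

Context {d' : measure_display} {T' : measurableType d'}.
Variables (P' : probability T' R) (W : R -> T' -> R).
Hypothesis BM : standard_BM P' W.

(** The order [m^-2] of the first term is the point: Ottaviani's inequality reduces to the end of
    the block, [clt_block] passes to the Gaussian law, and its fourth moment bounds the tail. *)
Lemma block_bad_small m (eps eta : R) : (0 < m)%N -> 0 < eps -> 8 / eps ^+ 2 <= m%:R -> 0 < eta ->
  \forall n \near \oo, forall l,
    (P (block_bad m n l eps) <= (2 * (768 / (eps ^+ 4 * m%:R ^+ 2) + 4 / eps * eta))%:E)%E.
Proof.
move=> m0 eps0 meps eta0; have m0' : (0 : R) < m%:R by rewrite ltr0n.
have clt := clt_block iU idU mu0 C0 Csg mom0 BM m0 eta0.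
have npos : \forall n \near \oo, (0 < n)%N := nbhs_infty_gt 0%N.
move: clt npos; apply: filterS2 => n cltn n0 l.
have n0' : (0 : R) < n%:R by rewrite ltr0n.
set N := bsize mu m n.
pose X i := scaled U mu (alt C n) (l * N + i)%N.
have mX i : measurable_fun setT (X i) by exact: measurable_scaled.
have iX : indep_fin P N X by apply: indep_shift; exact: scaled_indep.
have e20 : 0 < eps / 2 by rewrite divr_gt0.
have /andP[_ var2] := bsize_var mu0 m0 n0.
(* The variance of a block is at most [1 / m], so [8 / eps ^+ 2 <= m] is exactly what brings
   Chebyshev's bound at level [eps / 2] down to 1/2. *)
have cheb k : (k <= N)%N -> (P (dev X k N (eps / 2)) <= 2^-1%:E)%E.
  move=> kN; apply: le_trans (_ : _ <= (N%:R * (mu / n%:R) / (eps / 2) ^+ 2)%:E)%E _.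
    apply: (@scaled_dev (alt C n)) => // i.
    exact: alt_var.
  rewrite lee_fin ler_pdivrMr ?exprn_gt0//; apply: le_trans var2 _.
  rewrite -[leRHS]invrK lef_pV2 ?posrE ?invr_gt0 ?mulr_gt0 ?exprn_gt0//.
  rewrite (_ : (2^-1 * (eps / 2) ^+ 2)^-1 = 8 / eps ^+ 2)//.
  by field; rewrite gt_eqF.
have := ottaviani mX iX cheb.
rewrite (_ : 2 * (eps / 2) = eps); last by field.
rewrite -/(block_bad m n l eps) => H; apply: le_trans H _.
rewrite EFinM; apply: lee_wpmul2l; first by rewrite lee_fin.
(* A Lipschitz majorant of the indicator of [|x| >= eps / 2] that vanishes for [|x| <= eps / 4]. *)
pose h (x : R) := ramp ((`|x| - eps / 4) * (4 / eps)).
have h01 x : 0 <= h x <= 1 by exact: ramp_itv.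
have hM x : `|h x| <= 1 by have /andP[h0 h1] := h01 x; rewrite ger0_norm.
have hK x y : `|h x - h y| <= 4 / eps * `|x - y|.
  apply: le_trans (ramp_lip _ _) _.
  rewrite -mulrBl (_ : _ - eps / 4 - _ = `|x| - `|y|); last by ring.
  rewrite normrM [X in _ * X]ger0_norm; last by rewrite divr_ge0// ltW.
  rewrite mulrC; apply: ler_wpM2l; first by rewrite divr_ge0// ltW.
  exact: ler_dist_dist.
have mh := lip_measurable hK.
have K0 : 0 <= 4 / eps by rewrite divr_ge0// ltW.
have mblk : measurable_fun setT (block U mu C m n l).
  by apply: measurable_sum => i; exact: measurable_scaled.
have mhb : measurable_fun setT (fun w => h (block U mu C m n l w)) by exact: measurableT_comp.
have ihb : P.-integrable setT (EFin \o (fun w => h (block U mu C m n l w))).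
  by apply: (@bounded_integrable _ _ _ P _ 1) => // w; exact: hM.
apply: le_trans (_ : _ <= (\int[P]_w h (block U mu C m n l w))%:E)%E _.
  have mD : measurable (dev X 0 N (eps / 2)) by exact: measurable_dev.
  rewrite -EFin_Rintegral// -[X in (P X <= _)%E]setIT -integral_indic//.
  apply: le_integralT => w; rewrite lee_fin indicE.
  case: (boolP (_ \in _)) => [|_]; last by have /andP[] := h01 (block U mu C m n l w).
  rewrite inE/= /dev/= big_mkord => Dw; rewrite /h ramp1//.
  rewrite (_ : block U mu C m n l w = \sum_(i < N) X i w); last by rewrite /block big_shift_ord.
  have e1 : eps / 4 * (4 / eps) = 1 by field; rewrite gt_eqF.
  by rewrite -[X in X <= _]e1; apply: ler_wpM2r => //; move: Dw; lra.
have := cltn l h (4 / eps) 1 K0 hK hM.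
set r := Num.sqrt m%:R^-1.
have rpos : 0 < r by rewrite sqrtr_gt0 invr_gt0.
have r4 : r ^+ 4 = (m%:R ^+ 2)^-1.
  by rewrite (_ : 4%N = (2 * 2)%N)// exprM sqr_sqrtr ?invr_ge0 ?(ltW m0')// exprVn.
(* Markov's inequality of order four at level [eps / 4]; [768 = 3 * 4^4], where 3 is the Gaussian
   fourth moment. *)
have gauss : \int[gaussian r]_x h x <= 768 / (eps ^+ 4 * m%:R ^+ 2).
  have i4 : (gaussian r).-integrable setT (EFin \o (fun x : R => x ^+ 4)).
    apply/integrableP; split; first by apply/measurable_EFinP; exact: measurable_funX.
    under eq_integral do rewrite /= ger0_norm ?exprn_even_ge0//.
    by rewrite gaussian_moment4// ltry.
  apply: (@le_trans _ _ (\int[gaussian r]_x ((4 / eps) ^+ 4 * x ^+ 4))).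
    apply: le_Rintegral => //.
    - by apply: bounded_integrable hM.
    - exact: integrable_mulrR.
    move=> x _; rewrite -exprMn; have [xe|ex] := leP `|x| (eps / 4).
      rewrite /h ramp0 ?exprn_even_ge0//.
      by rewrite mulr_le0_ge0// subr_le0.
    apply: le_trans (_ : 1 <= _); first by have /andP[] := h01 x.
    rewrite (_ : (4 / eps * x) ^+ 4 = (4 / eps * `|x|) ^+ 4); last first.
      rewrite !exprMn; congr (_ * _).
      by rewrite (_ : 4%N = (2 * 2)%N)// !exprM real_normK ?num_real.
    apply: exprn_ege1; rewrite -ler_pdivrMl ?divr_gt0// mulr1 invf_div.
    exact: ltW.
  rewrite RintegralZl// /Rintegral gaussian_moment4//= r4.
  by rewrite le_eqVlt; apply/orP; left; apply/eqP; field; rewrite !gt_eqF.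
rewrite lee_fin ler_norml => /andP[_]; move: gauss; lra.
Qed.

End bad_events.

(** * From the blocks to the whole path *)

Section lower_bound.
Context {d : measure_display} {T : measurableType d} {R : realType}.
Variables (P : probability T R) (U : nat -> T -> R) (mu sg tau0 C : R).
Hypothesis mU : forall k, measurable_fun setT (U k).
Hypothesis iU : indep_seq P U.
Hypothesis idU : ident_distr P U.
Hypothesis U0 : forall k w, 0 <= U k w.
Hypothesis mu0 : 0 < mu.
Hypothesis C0 : 0 < C.
Hypothesis Csg : C ^+ 2 * sg = mu.
Let law0 := law P (measurable_centered mu mU).
Hypothesis mom0 : centered_moments law0 sg tau0.

Let blk m n := block U mu C m n.

Lemma good_path m n eps w : (0 < m)%N -> (0 < n)%N -> (2 * m + 4 <= bsize mu m n)%N ->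
  ~ clock_bad U mu m n w -> (forall l, (l <= m)%N -> ~ block_bad U mu C m n l eps w) ->
  dist01_le (3 * eps + C / Num.sqrt n%:R * mu) (Xproc C U n w)
    (polyline m (mkseq (blk m n ^~ w) m)).
Proof.
move=> m0 n0 Nbig nclock nblock t t01.
have [Nq qN] := bsize_itv mu0 n m0.
have E l a : \sum_(a <= i < l) scaled U mu (alt C n) i w =
    C / Num.sqrt n%:R * \sum_(a <= i < l) (-1) ^+ i * (U i w - mu).
  by rewrite mulr_sumr; apply: eq_bigr => i _; rewrite /scaled /alt mulrA.
rewrite (_ : mkseq (blk m n ^~ w) m = mkseq (fun l => C / Num.sqrt n%:R *
  \sum_(l * bsize mu m n <= i < l * bsize mu m n + bsize mu m n) (-1) ^+ i * (U i w - mu)) m);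
  last by apply: eq_mkseq => l; rewrite /blk /block E.
apply: (path_close (fun k => U0 k w) mu0 n0 m0 C0 Nq (ltW qN) Nbig) => //.
  move=> k km; rewrite leNgt; apply/negP => bad; apply: nclock.
  rewrite /clock_bad.
  rewrite -(bigcup_mkord _ (fun k => dev (scaled U mu (fun=> 1)) 0 k (n%:R / (2 * m%:R)))); exists k; first by rewrite /= ltnS.
  rewrite /dev/= (_ : \sum_(0 <= i < k) _ = partial_sum U k w - k%:R * mu); first exact: ltW.
  rewrite big_mkord /partial_sum /scaled; under eq_bigr do rewrite mul1r.
  by rewrite sumrB sumr_const card_ord mulr_natl.
move=> l j lm jN; rewrite leNgt; apply/negP => bad; apply: (nblock l lm).
rewrite /block_bad -(bigcup_mkord _ (fun k =>
  dev (fun i => scaled U mu (alt C n) (l * bsize mu m n + i)%N) 0 k eps)); exists j; first by rewrite /= ltnS.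
rewrite /dev/= big_mkord.
rewrite -(@big_shift_ord _ 0 +%R (l * bsize mu m n) j (fun i => scaled U mu (alt C n) i w)).
rewrite E normrM ger0_norm; first exact: ltW.
by rewrite divr_ge0 ?sqrtr_ge0// ltW.
Qed.

Context {d' : measure_display} {T' : measurableType d'}.
Variables (P' : probability T' R) (W : R -> T' -> R).
Hypothesis BM : standard_BM P' W.

Let measurable_blk m n l : measurable_fun setT (blk m n l).
Proof. by apply: measurable_sum => i; exact: measurable_scaled. Qed.

(** Second use of [swap_indep], the coordinates now being the [m] block sums. The class is that of
    the bounded [K]-Lipschitz functions, whose one-variable sections are handled by [clt_block] at
    cost [K * eta] each. *)
Lemma swap_blocks m (eta : R) : (0 < m)%N -> 0 < eta ->
  \forall n \near \oo, forall (G : seq R -> R) (K M : R), 0 <= K ->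
    lipseq m K G -> boundedseq m M G ->
  `|\int[P]_w G (mkseq (blk m n ^~ w) m) - \int[P']_w G (mkseq (bm_inc W m ^~ w) m)|
    <= m%:R * (K * eta).
Proof.
move=> m0 eta0; have := clt_block iU idU mu0 C0 Csg mom0 BM m0 eta0.
apply: filterS => n clt G K M K0 lG bG.
pose nu l := law P (measurable_blk m n l).
rewrite (_ : m%:R * (K * eta) = \sum_(i < m) K * eta); last first.
  by rewrite sumr_const card_ord mulr_natl.
apply: (@swap_indep _ _ _ _ _ P P' (blk m n) (bm_inc W m) nu
  (fun=> gaussian (Num.sqrt m%:R^-1)) (fun k G => lipseq k K G /\ boundedseq k M G)
  (fun=> K * eta)) => //.
- by move=> i; exact: measurable_bm_inc BM _ _.
- by move=> k H [lH bH]; exists K, M.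
- by move=> k H [lH bH]; exact: lipseq_int.
- move=> k H s [lH bH] sk; pose h y := H (rcons s y).
  have hK x y : `|h x - h y| <= K * `|x - y| by exact: (lipseq_rcons x y lH sk).
  have hM x : `|h x| <= M by apply: bH; rewrite size_rcons sk.
  rewrite -(@Rintegral_eq_law _ _ _ P (blk m n k) (nu k) h M) //.
    exact: clt hK hM.
  exact: lip_measurable hK.
- apply: indep_blocks; first by move=> i; exact: measurable_scaled.
  exact: scaled_indep.
- exact: (bm_inc_indep BM).
- by move=> i B im mB; exact: (bm_inc_law BM).
Qed.

Definition path_bad m n eps : set T :=
  clock_bad U mu m n `|` \big[setU/set0]_(l < m.+1) block_bad U mu C m n l eps.

Lemma measurable_path_bad m n eps : measurable (path_bad m n eps).
Proof.
apply: measurableU; first exact: measurable_clock_bad.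
by apply: bigsetU_measurable => l _; exact: measurable_block_bad.
Qed.

Lemma path_bad_small m (eps del : R) : 0 < eps -> 0 < del -> (0 < m)%N ->
  8 / eps ^+ 2 <= m%:R -> 9216 / (eps ^+ 4 * del) <= m%:R ->
  \forall n \near \oo, (P (path_bad m n eps) <= del%:E)%E.
Proof.
move=> eps0 del0 m0 m1 m2; have m0' : (0 : R) < m%:R by rewrite ltr0n.
have m1' : (1 : R) <= m%:R by rewrite ler1n.
(* Over [m + 1] blocks the error of the central limit theorem then sums to [del / 3]; the clock
   takes another third. *)
pose eta := del * eps / (24 * (m%:R + 1)).
have eta0 : 0 < eta by rewrite divr_gt0 ?mulr_gt0// addr_gt0.
have cs := clock_bad_small (m := m) iU idU mu0 mom0 m0 (divr_gt0 del0 (ltr0n R 3)).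
have bs := block_bad_small (m := m) iU idU mu0 C0 Csg mom0 BM m0 eps0 m1 eta0.
move: cs bs; apply: filterS2 => n cs bs.
apply: le_trans (measureU2 _ _ _) _.
- exact: measurable_clock_bad.
- by apply: bigsetU_measurable => l _; exact: measurable_block_bad.
pose b := 2 * (768 / (eps ^+ 4 * m%:R ^+ 2) + 4 / eps * eta).
apply: (@le_trans _ _ ((del / 3)%:E + \sum_(l < m.+1) b%:E)%E).
  apply: leeD => //; apply: le_trans (_ : _ <= \sum_(l < m.+1) P (block_bad U mu C m n l eps))%E _.
    apply: (@content_subadditive _ _ _ P _ (fun l => block_bad U mu C m n l eps)) => //.
      by move=> l _; exact: measurable_block_bad.
    by apply: bigsetU_measurable => l _; exact: measurable_block_bad.
  by apply: lee_sum => l _; exact: bs.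
rewrite sumEFin -EFinD lee_fin sumr_const card_ord -[_ *+ m.+1]mulr_natl -[m.+1%:R]natr1.
have -> : (m%:R + 1) * b = 1536 * (m%:R + 1) / (eps ^+ 4 * m%:R ^+ 2) + del / 3.
  by rewrite /b /eta; field; rewrite !gt_eqF// ltr_wpDr.
(* The last third: with [m + 1 <= 2 m] the left side is at most [3072 / (eps^4 m)], hence the
   constant [9216 = 3 * 3072] in the condition on [m]. *)
suff : 1536 * (m%:R + 1) / (eps ^+ 4 * m%:R ^+ 2) <= del / 3 by lra.
have e4 : 0 < eps ^+ 4 by rewrite exprn_gt0.
rewrite ler_pdivrMr ?mulr_gt0 ?exprn_gt0//.
move: m2; rewrite ler_pdivrMr ?mulr_gt0// => m2.
have : 9216 * m%:R <= m%:R * (eps ^+ 4 * del) * m%:R by rewrite ler_pM2r.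
move: m1'; move: (eps ^+ 4) => q; lra.
Qed.

End lower_bound.

(** * Lower bound for Lipschitz functionals *)

Section lower_bound.
Context {d : measure_display} {T : measurableType d} {R : realType}.
Variables (P : probability T R) (U : nat -> T -> R) (mu sg tau0 C : R).
Hypothesis mU : forall k, measurable_fun setT (U k).
Hypothesis iU : indep_seq P U.
Hypothesis idU : ident_distr P U.
Hypothesis U0 : forall k w, 0 <= U k w.
Hypothesis mu0 : 0 < mu.
Hypothesis C0 : 0 < C.
Hypothesis Csg : C ^+ 2 * sg = mu.
Hypothesis mom0 : centered_moments (law P (measurable_centered mu mU)) sg tau0.
Context {d' : measure_display} {T' : measurableType d'}.
Variables (P' : probability T' R) (W : R -> T' -> R).
Hypothesis BM : standard_BM P' W.

Lemma lower_bound (F Phi : (R -> R) -> R) (K M e : R) : 0 <= K -> 0 <= M -> 0 < e ->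
  lip_functional K M Phi -> (forall f, cont01 f -> Phi f <= F f) ->
  \forall n \near \oo,
    ((\int[P']_w Phi (fun t => W t w) - e)%:E <= \int[P]_w (F (Xproc C U n w))%:E)%E.
Proof.
move=> K0 M0 e0 PhiL PhiF; have [PhiK PhiM] := PhiL.
(* Five errors of at most [e / 8] each: interpolation of [W], replacement of the blocks,
   [K * (3 * eps)], the centering term, and [2 * M * del] for the bad event. The added 1 keeps the
   denominators positive. *)
pose eps := e / (24 * (K + 1)); pose del := e / (8 * (2 * M + 1)).
have K1 : 0 < K + 1 by rewrite ltr_wpDl.
have M1 : 0 < 2 * M + 1 by rewrite ltr_wpDl// mulr_ge0.
have eps0 : 0 < eps by rewrite divr_gt0// mulr_gt0.
have del0 : 0 < del by rewrite divr_gt0// mulr_gt0.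
have e8 : 0 < e / 8 by rewrite divr_gt0.
have [m [m0 m1 m2 mPhi]] : exists m, [/\ (0 < m)%N, 8 / eps ^+ 2 <= m%:R,
    9216 / (eps ^+ 4 * del) <= m%:R &
    `|\int[P']_w Phi (fun t => W t w) -
      \int[P']_w Phi (polyline m (mkseq (bm_inc W m ^~ w) m))| <= e / 8].
  have /cvgrPdist_le /(_ _ e8) poly := polyline_bm_expectation BM PhiL.
  near \oo => m; exists m; split; near: m.
  - exact: nbhs_infty_gt.
  - exact: nbhs_infty_ger.
  - exact: nbhs_infty_ger.
  - exact: poly.
have [lG bG] := lipseq_polyline m PhiL.
have m0' : (0 : R) < m%:R by rewrite ltr0n.
pose eta := e / (8 * (m%:R * K + 1)).
have mK1 : 0 < m%:R * K + 1 by rewrite ltr_wpDl// mulr_ge0// ltW.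
have eta0 : 0 < eta by rewrite divr_gt0// mulr_gt0.
have muK1 : 0 < mu * K + 1 by rewrite ltr_wpDl// mulr_ge0// ltW.
have swap := swap_blocks iU idU mu0 C0 Csg mom0 BM m0 eta0.
have bad := path_bad_small iU idU mu0 C0 Csg mom0 BM eps0 del0 m0 m1 m2.
have large := bsize_large mu0 (2 * m + 4)%:R m0.
have r0 : 0 < e / (8 * (mu * K + 1)) by rewrite divr_gt0// mulr_gt0.
have small := near_scale_small C0 r0.
have npos : \forall n \near \oo, (0 < n)%N := nbhs_infty_gt 0%N.
apply: filterS (filterI (filterI swap bad) (filterI large (filterI small npos))).
move=> n [[swapn badn] [largen [smalln n0]]].
have {}largen : (2 * m + 4 <= bsize mu m n)%N by move: largen; rewrite ler_nat.
set Bad := path_bad U mu C m n eps in badn.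
have mBad : measurable Bad := measurable_path_bad mu C mU m n eps.
pose rho := 3 * eps + C / Num.sqrt n%:R * mu.
have rho0 : 0 <= rho.
  by rewrite addr_ge0// mulr_ge0 ?(ltW eps0) ?(ltW mu0)// divr_ge0 ?sqrtr_ge0// ltW.
pose G s := Phi (polyline m s).
(* A measurable minorant of [F] along the process: off [Bad] the Lipschitz bound loses [K * rho],
   and on [Bad] the bound [M] on [Phi] loses at most [2 * M]. *)
pose g w := G (mkseq (block U mu C m n ^~ w) m) - (K * rho + 2 * M * \1_Bad w).
have mblk l : measurable_fun setT (block U mu C m n l).
  by apply: measurable_sum => i; exact: measurable_scaled.
have mG : measurable_fun setT (fun w => G (mkseq (block U mu C m n ^~ w) m)).
  exact: (measurable_lipseq (fun i _ => mblk i) lG).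
have iG : P.-integrable setT (EFin \o (fun w => G (mkseq (block U mu C m n ^~ w) m))).
  apply: (@bounded_integrable _ _ _ P _ M) => // w.
  by apply: bG; rewrite size_mkseq.
have iB : P.-integrable setT (EFin \o (fun w => \1_Bad w : R)).
  apply: (@bounded_integrable _ _ _ P _ 1); first exact: measurable_indic.
  by move=> w; rewrite indicE; case: (_ \in _); rewrite ?normr1 ?normr0.
have i2B : P.-integrable setT (EFin \o (fun w => 2 * M * \1_Bad w : R)) 
  by have := integrableZl measurableT (2 * M) iB; apply: eq_integrable.
have icst : P.-integrable setT (EFin \o (fun w => K * rho)) by exact: finite_measure_integrable_cst.
have ig2 : P.-integrable setT (EFin \o (fun w => K * rho + 2 * M * \1_Bad w : R)).
  exact: integrable_addR.
have ig : P.-integrable setT (EFin \o g) by exact: integrable_subR.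
have gF w : g w <= F (Xproc C U n w).
  have cX : cont01 (Xproc C U n w) by apply: continuous_Xproc => // k; exact: U0.
  have cP (s : seq R) : cont01 (polyline m s) by exact: cont01_polyline.
  apply: le_trans (PhiF _ cX); rewrite /g indicE.
  set s := mkseq _ _.
  case: (boolP (w \in Bad)) => [_|].
    have := PhiM _ cX; have := PhiM _ (cP s); rewrite !ler_norml /G => /andP[_ h1] /andP[h2 _].
    have : 0 <= K * rho by rewrite mulr_ge0.
    by rewrite mulr1; move: h1 h2; lra.
  rewrite notin_setE => nBad; rewrite mulr0 addr0.
  have close : dist01_le rho (Xproc C U n w) (polyline m s).
    apply: good_path => //.
      by move=> b; apply: nBad; left.
    move=> l lm b; apply: nBad; right.
    rewrite -(bigcup_mkord _ (fun l => block_bad U mu C m n l eps)).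
    by exists l; first by rewrite /= ltnS.
  have := PhiK _ _ _ cX (cP s) close; rewrite ler_norml /G => /andP[h _].
  by move: h; lra.
apply: le_trans (le_integralT P (f := fun w => (g w)%:E) (g := fun w => (F (Xproc C U n w))%:E) _); last first.
  by move=> w; rewrite lee_fin.
rewrite EFin_Rintegral// lee_fin /g RintegralB// RintegralD// Rintegral_prob_cst RintegralZl//.
have PB : \int[P]_w \1_Bad w <= del.
  rewrite -lee_fin -EFin_Rintegral// integral_indic// setIT; exact: badn.
have := swapn G K M K0 lG bG; rewrite ler_norml => /andP[sw _].
move: mPhi; rewrite ler_norml => /andP[_ mPhi].
have h1 : m%:R * (K * eta) <= e / 8.
  rewrite /eta (_ : m%:R * (K * _) = e / 8 * (m%:R * K / (m%:R * K + 1))); last first.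
    by field; rewrite gt_eqF.
  by rewrite ler_piMr ?(ltW e8)// ler_pdivrMr// mul1r lerDl.
have h2 : K * (3 * eps) <= e / 8.
  rewrite /eps (_ : K * (3 * _) = e / 8 * (K / (K + 1))); last by field; rewrite gt_eqF.
  by rewrite ler_piMr ?(ltW e8)// ler_pdivrMr// mul1r lerDl.
have h3 : K * (C / Num.sqrt n%:R * mu) <= e / 8.
  rewrite mulrCA mulrA -mulrA.
  apply: le_trans (ler_wpM2r _ smalln) _; first by rewrite mulr_ge0// ltW.
  rewrite (_ : e / _ * _ = e / 8 * (mu * K / (mu * K + 1))); last by field; rewrite gt_eqF.
  by rewrite ler_piMr ?(ltW e8)// ler_pdivrMr// mul1r lerDl.
have h4 : 2 * M * \int[P]_w \1_Bad w <= e / 8.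
  apply: (@le_trans _ _ (2 * M * del)); first by rewrite ler_wpM2l// mulr_ge0.
  rewrite /del (_ : 2 * M * _ = e / 8 * (2 * M / (2 * M + 1))); last by field; rewrite gt_eqF.
  by rewrite ler_piMr ?(ltW e8)// ler_pdivrMr// mul1r lerDl.
rewrite /rho mulrDr; move: sw mPhi h1 h2 h3 h4; rewrite /G; lra.
Unshelve. all: by end_near. Qed.

End lower_bound.

(** * Moments and conclusion *)

(** The integral is by definition that of the positive part minus that of the negative part, and a
    change of sign swaps the two. Boundedness makes both finite, with no measurability of [f]; an
    upper bound thus follows from the lower bound for the opposite functional. *)
Lemma bounded_integralN {d} {T : measurableType d} {R : realType} (P : probability T R)
    (f : T -> R) (M : R) : (forall w, `|f w| <= M) ->
  (\int[P]_w (f w)%:E)%E \is a fin_num /\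
  (\int[P]_w (- f w)%:E = - \int[P]_w (f w)%:E)%E.
Proof.
move=> fM; pose g w := (f w)%:E.
have part_fin (u : T -> \bar R) : (forall w, 0 <= u w)%E -> (forall w, u w <= M%:E)%E ->
    (\int[P]_w u w)%E \is a fin_num.
  move=> u0 uM; rewrite ge0_fin_numE; last exact: integral_ge0.
  apply: le_lt_trans (le_integralT P uM) _.
  rewrite (EFin_Rintegral (finite_measure_integrable_cst P M measurableT)).
  by rewrite ltry.
have M0 (w : T) : 0 <= M by exact: le_trans (normr_ge0 _) (fM w).
have pos : (\int[P]_w g^\+ w)%E \is a fin_num.
  apply: part_fin => w; first exact: funepos_ge0.
  by rewrite funeposE ge_max !lee_fin (M0 w) (le_trans (ler_norm _) (fM w)).
have neg : (\int[P]_w g^\- w)%E \is a fin_num.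
  apply: part_fin => w; first exact: funeneg_ge0.
  by rewrite funenegE ge_max -EFinN !lee_fin (M0 w) (le_trans (ler_norm _)) ?normrN.
have E : (\int[P]_w (f w)%:E = \int[P]_w g^\+ w - \int[P]_w g^\- w)%E by rewrite integralE.
split; first by rewrite E fin_numB pos neg.
rewrite E fin_num_oppeB// addeC.
rewrite (_ : (fun w => (- f w)%:E) = (\- g)%E); last by apply/funext => w; rewrite EFinN.
by rewrite integralE funeposN funenegN.
Qed.

Lemma centered_moments_of_power {d} {T : measurableType d} {R : realType} (P : probability T R)
    (X : T -> R) (p : R) (mX : measurable_fun setT X)
    (mY : measurable_fun setT (fun w => X w - fine 'E_P[X]%E)) :
  (forall w, 0 <= X w) -> 2 < p -> ('E_P[fun w => (X w `^ p)%R] < +oo)%E ->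
  exists tau, centered_moments (law P mY) (fine 'V_P[X]%E) tau.
Proof.
move=> X0 p2 Xp0; have Xp : (\int[P]_w (X w `^ p)%:E < +oo)%E by move: Xp0; rewrite unlock.
have muE : fine 'E_P[X]%E = \int[P]_w X w by rewrite unlock.
set mu := \int[P]_w X w in muE.
have i2 : P.-integrable setT (EFin \o (fun w => X w ^+ 2)).
  have ip : P.-integrable setT (EFin \o (fun w => X w `^ p)).
    apply/integrableP; split.
      by apply/measurable_EFinP; apply: (measurableT_comp (measurable_powR p)).
    apply: le_lt_trans Xp; apply: le_integralT => w /=.
    by rewrite ger0_norm// powR_ge0.
  (* Domination [x^2 <= 1 + x^p] for [x >= 0], by cases on [x <= 1]. *)
  have i1p := integrable_addR (finite_measure_integrable_cst P 1 measurableT) ip.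
  apply: (le_integrable measurableT _ _ i1p).
    by apply/measurable_EFinP; exact: measurable_funX.
  move=> w _; rewrite /= lee_fin !ger0_norm ?sqr_ge0 ?addr_ge0 ?powR_ge0//.
  have [X1|X1] := leP (X w) 1.
    by rewrite ler_wpDr ?powR_ge0// expr_le1.
  rewrite -powR_mulrn// ler_wpDl// ler_powR ?ltW//.
have i1 : P.-integrable setT (EFin \o X).
  have i12 := integrable_addR (finite_measure_integrable_cst P 1 measurableT) i2.
  apply: (le_integrable measurableT _ _ i12); first exact/measurable_EFinP.
  move=> w _; rewrite /= lee_fin !ger0_norm ?addr_ge0 ?sqr_ge0//.
  by have := sqr_ge0 (X w - 1); rewrite sqrrB expr1n mulr1 => h; have := X0 w; lra.
rewrite muE in mY *.
have icst c : P.-integrable setT (EFin \o (fun=> c)) by exact: finite_measure_integrable_cst.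
have j1 : P.-integrable setT (EFin \o (fun w => X w - mu)) by exact: integrable_subR.
have j2 : P.-integrable setT (EFin \o (fun w => (X w - mu) ^+ 2)).
  have iXmu : P.-integrable setT (EFin \o (fun w => 2 * mu * X w)).
    by have := integrableZl measurableT (2 * mu) i1; apply: eq_integrable.
  have := integrable_addR (integrable_subR i2 iXmu) (icst (mu ^+ 2)).
  by apply: eq_integrable => // w _; rewrite /=; congr EFin; ring.
exists (\int[law P mY]_y min23 y); split => //.
- exact: (@law_integrable R _ _ P _ mY id).
- by apply: (@law_integrable R _ _ P _ mY (fun y => y ^+ 2)) => //; exact: measurable_funX.
- rewrite (@Rintegral_law R _ _ P _ mY id)//.
  by rewrite (RintegralB measurableT i1 (icst mu)) Rintegral_prob_cst subrr.
- rewrite (@Rintegral_law R _ _ P _ mY (fun y => y ^+ 2)); [|exact: measurable_funX|exact: j2].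
  by rewrite /variance unlock muE unlock.
Qed.

(** * Convergence of expectations *)

Section expectation_cvg.
Context {d : measure_display} {T : measurableType d} {R : realType}.
Variables (P : probability T R) (U : nat -> T -> R) (mu sg tau0 C : R).
Hypothesis mU : forall k, measurable_fun setT (U k).
Hypothesis iU : indep_seq P U.
Hypothesis idU : ident_distr P U.
Hypothesis U0 : forall k w, 0 <= U k w.
Hypothesis mu0 : 0 < mu.
Hypothesis C0 : 0 < C.
Hypothesis Csg : C ^+ 2 * sg = mu.
Hypothesis mom0 : centered_moments (law P (measurable_centered mu mU)) sg tau0.
Context {d' : measure_display} {T' : measurableType d'}.
Variables (P' : probability T' R) (W : R -> T' -> R).
Hypothesis BM : standard_BM P' W.

Let path w := fun t => W t w.

Let cpath w : cont01 (path w).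
Proof. by have [_ _ cW _ _] := BM; exact: cW. Qed.

(** A regularization whose expectation along [W] is within [e / 2] of that of [F] is fixed before
    [n] varies. Measurability of [F] along [W] is inherited from the regularizations as their
    pointwise limit. *)
Lemma lower_expectation (F : (R -> R) -> R) (e : R) : bounded_cont_functional F -> 0 < e ->
  \forall n \near \oo,
    ((\int[P']_w F (path w) - e)%:E <= \int[P]_w (F (Xproc C U n w))%:E)%E.
Proof.
move=> [[M FM] Fcont] e0; have e20 : 0 < e / 2 by rewrite divr_gt0.
have M0 : 0 <= M.
  exact: le_trans (normr_ge0 _) (FM _ (@cont01_polyline R 0 [::])).
have lipF (k : nat) : lip_functional k%:R M (lipreg F k%:R).
  by split => [f g r cf cg fg|f cf]; [apply: (lipreg_lip FM)|apply: (lipreg_bound FM)].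
have mk (k : nat) : measurable_fun setT (fun w => lipreg F k%:R (path w)).
  exact: (measurable_functional_bm BM (lipF k)).
have cvgk w : lipreg F k%:R (path w) @[k --> \oo] --> F (path w) by exact: (lipreg_cvg FM).
have mF : measurable_fun setT (fun w => F (path w)).
  by apply: (measurable_fun_cvg mk) => w _; exact: cvgk.
have : (\int[P']_w (lipreg F k%:R (path w))%:E)%E @[k --> \oo] --> (\int[P']_w (F (path w))%:E)%E.
  apply: (@dominated_cvg _ _ _ P' setT measurableT _ _ (cst M%:E)) => //.
  - by move=> k; apply/measurable_EFinP; exact: mk.
  - by move=> w _; apply: cvg_EFin; [near=> k|exact: cvgk].
  - exact: finite_measure_integrable_cst.
  - by move=> k w _; rewrite /= lee_fin; apply: (lipreg_bound FM).
rewrite EFin_Rintegral; last by apply: (@bounded_integrable _ _ _ P' _ M) => // w; exact: FM.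
move=> /fine_cvgP[_] /cvgrPdist_le /(_ _ e20) near_k.
have [k close] : exists k : nat,
    `|\int[P']_w F (path w) - \int[P']_w lipreg F k%:R (path w)| <= e / 2.
  by near \oo => k; exists k; near: k; exact: near_k.
have lF f : cont01 f -> lipreg F k%:R f <= F f by move=> cf; exact: (lipreg_le FM).
have := lower_bound iU idU U0 mu0 C0 Csg mom0 BM (ler0n R k) M0 e20 (lipF k) lF.
apply: filterS => n; apply: le_trans; rewrite lee_fin.
by move: close; rewrite ler_norml => /andP[_]; rewrite /path; lra.
Unshelve. all: by end_near. Qed.

Lemma expectation_cvg (F : (R -> R) -> R) : bounded_cont_functional F ->
  (\int[P]_w (F (Xproc C U n w))%:E)%E @[n --> \oo] --> (\int[P']_w (F (path w))%:E)%E.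
Proof.
move=> bF; have [[M FM] Fcont] := bF.
have bFN : bounded_cont_functional (fun f => - F f).
  split; first by exists M => f cf; rewrite normrN; exact: FM.
  move=> f cf e e0; have [del del0 H] := Fcont f cf e e0.
  by exists del => // g cg fg; rewrite -opprD normrN; exact: H.
have bX n w : (0 < n)%N -> `|F (Xproc C U n w)| <= M.
  by move=> n0; apply: FM; apply: continuous_Xproc => // k; exact: U0.
have [finW EW] := bounded_integralN P' (fun w => FM _ (@cpath w)).
rewrite -(fineK finW); apply/fine_cvgP; split.
  near=> n; have n0 : (0 < n)%N by near: n; exact: nbhs_infty_gt.
  by have [] := bounded_integralN P (fun w => bX n w n0).
apply/cvgrPdist_le => e e0.
have lo := lower_expectation bF e0; have up := lower_expectation bFN e0.
near=> n.
have n0 : (0 < n)%N by near: n; exact: nbhs_infty_gt.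
have [finX EX] := bounded_integralN P (fun w => bX n w n0).
have h1 : ((\int[P']_w F (path w) - e)%:E <= \int[P]_w (F (Xproc C U n w))%:E)%E.
  by near: n.
have h2 : ((\int[P']_w (- F (path w)) - e)%:E <= \int[P]_w (- F (Xproc C U n w))%:E)%E.
  by near: n.
move: h2; rewrite EX /Rintegral EW fineN.
move: h1; rewrite /Rintegral -(fineK finX) -EFinN !lee_fin /=.
by rewrite ler_norml; set a := fine _; set b := fine _ => h1 h2; apply/andP; split; lra.
Unshelve. all: by end_near. Qed.

End expectation_cvg.

Theorem theorem1 (d : measure_display) (T : measurableType d) (R : realType)
  (P : probability T R) (U : nat -> T -> R) (C : R) :
  (forall k, measurable_fun setT (U k)) ->
  indep_seq P U -> ident_distr P U ->
  (forall k w, 0 <= U k w) ->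
  (P (U 0%N @^-1` [set 0%R]) < 1)%E ->
  (exists2 p : R, 2 < p & ('E_P[fun w => (U 0%N w `^ p)%R] < +oo)%E) ->
  0 < C -> C ^+ 2 = fine ('E_P[U 0%N])%E / fine ('V_P[U 0%N])%E ->
  forall (d' : measure_display) (T' : measurableType d') (P' : probability T' R)
    (W : R -> T' -> R), standard_BM P' W ->
  forall F : (R -> R) -> R, bounded_cont_functional F ->
    ((fun n => 'E_P[fun w => F (Xproc C U n w)]) @ \oo
      --> 'E_P'[fun w => F (fun t => W t w)])%E.
Proof.
move=> mU iU idU U0 _ [p p2 Up] C0 Csq d' T' P' W BM F bF.
have [tau mom] := centered_moments_of_power (mU 0%N) (measurable_centered _ mU) (U0 0%N) p2 Up.
have C2 : 0 < C ^+ 2 by rewrite exprn_gt0.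
(* The inverse of 0 is 0, so a zero variance would force [C ^+ 2 = 0]. Positivity of the mean then
   follows from [C ^+ 2] times the variance. *)
have sg_neq0 : fine ('V_P[U 0%N])%E != 0.
  by apply: contraTneq C2 => sg0; rewrite Csq sg0 invr0 mulr0 ltxx.
have Csg : C ^+ 2 * fine ('V_P[U 0%N])%E = fine ('E_P[U 0%N])%E by rewrite Csq divfK.
have mu0 : 0 < fine ('E_P[U 0%N])%E.
  rewrite -Csg mulr_gt0// lt_neqAle eq_sym sg_neq0/=.
  exact: fine_ge0 (variance_ge0 _ _).
have := expectation_cvg iU idU U0 mu0 C0 Csg mom BM bF.
by rewrite unlock.
Qed.
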